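(* Let $K=\mathbb{F}_q$ be a finite field with $q=8$ or $q\geq 16$. Let $S\subset\mathbb{P}^3$ be a smooth cubic surface defined over $K$ containing at least one $K$-rational line. Then there exists a point $P\in S(K)$ such that $\mathrm{Span}(P)=S(K)$.
   Context: Secant and tangent operations on a smooth cubic surface $S$ over a field $K$: (Secant) if $P,Q\in S(K)$ with $P\neq Q$ and the line $\ell$ through $P,Q$ is not contained in $S$, then $\ell\cdot S=P+Q+R$ with $R\in S(K)$; if $R\neq P,Q$ we say $R$ is generated from $P$ and $Q$. (Tangent) if $P\in S(K)$, $\Pi_P$ is the tangent plane to $S$ at $P$, and $\ell$ is a $K$-line in $\Pi_P$ through $P$ with $\ell\not\subset S$, then $\ell\cdot S=2P+R$ with $R\in S(K)$; if $R\neq P$ we say $R$ is generated from $P$. For a set $\Sigma\subseteq S(K)$, $\mathrm{Span}(\Sigma)$ is the smallest subset of $S(K)$ containing $\Sigma$ and closed under the secant and tangent operations; $\mathrm{Span}(P_1,\dots,P_n)$ means $\mathrm{Span}(\{P_1,\dots,P_n\})$. *)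

(* Defs.v *)
From HB Require Import structures.
From mathcomp Require Import all_boot all_order all_algebra.
From mathcomp Require Import mpoly.

Set Implicit Arguments.
Unset Strict Implicit.
Unset Printing Implicit Defensive.

Import GRing.Theory.
Local Open Scope ring_scope.

(* Linear subspaces of P^3 over K are linear subspaces of K^4: points, lines  *)
(* and planes have vector space dimension 1, 2 and 3. Equality of {vspace _}  *)
(* is equality of subspaces. A hypersurface is given by its equation F.       *)
Notation subspace K := {vspace 'rV[K]_4}.

Section Surface.
Variables (K : fieldType) (F : {mpoly K[4]}).

Definition is_line (L : subspace K) : Prop := \dim L = 2%N.

Definition rational_point (P : subspace K) : Prop :=
  \dim P = 1%N /\ forall x, x \in P -> F.@[x 0] = 0.

(* Jacobian criterion at the geometric points; F is tested as well as its     *)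
(* partial derivatives because Euler's formula fails when char K divides      *)
(* deg F.                                                                     *)
Definition smooth : Prop :=
  forall (E : closedFieldType) (f : {rmorphism K -> E}) (x : 'rV[E]_4),
    x != 0 -> (map_mpoly f F).@[x 0] = 0 ->
    exists i : 'I_4, (map_mpoly f F)^`M(i).@[x 0] != 0.

(* The binary form F(s b_0 + t b_1), with s = 'X_0 and t = 'X_1.              *)
Definition restriction (b : 2.-tuple 'rV[K]_4) : {mpoly K[2]} :=
  F \mPo [tuple \sum_(j < 2) (tnth b j) 0 i *: 'X_j | i < 4].

(* Vanishing as a form, i.e. at all geometric points and not only K-points.   *)
Definition line_in_surface (L : subspace K) : Prop :=
  exists2 b : 2.-tuple 'rV[K]_4, basis_of L b & restriction b = 0.

(* If b is a basis of a line and A = [a_0 b_0 + a_1 b_1] a point of it, this  *)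
(* is the linear form a_1 s - a_0 t, whose only zero is A.                    *)
Definition point_form (b : 2.-tuple 'rV[K]_4) (A : subspace K) :
    {mpoly K[2]} :=
  coord b ord_max (vpick A) *: 'X_ord0 - coord b ord0 (vpick A) *: 'X_ord_max.

(* L . S = \sum_(A <- D) A as divisors on the line L: both sides have the     *)
(* same equation up to a nonzero scalar. This does not depend on the basis.   *)
Definition line_section (L : subspace K) (D : seq (subspace K)) : Prop :=
  all (fun A => (A <= L)%VS) D /\
  exists2 b : 2.-tuple 'rV[K]_4, basis_of L b &
    exists2 c : K, c != 0 & restriction b = c *: \prod_(A <- D) point_form b A.

Definition gradient (x : 'rV[K]_4) : 'cV[K]_4 := \col_i F^`M(i).@[x 0].

Definition tangent_plane (P : subspace K) : subspace K :=
  lker (linfun (mulmxr (gradient (vpick P)) : 'rV[K]_4 -> 'rV[K]_1)).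

Definition secant_generated (P Q R : subspace K) : Prop :=
  [/\ rational_point P, rational_point Q, rational_point R & P <> Q] /\
  [/\ ~ line_in_surface (P + Q)%VS, line_section (P + Q)%VS [:: P; Q; R],
      R <> P & R <> Q].

Definition tangent_generated (P R : subspace K) : Prop :=
  [/\ rational_point P, rational_point R & R <> P] /\
  exists L : subspace K,
    [/\ is_line L, (P <= L)%VS, (L <= tangent_plane P)%VS,
        ~ line_in_surface L & line_section L [:: P; P; R]].

Definition closed_under_generation (T : subspace K -> Prop) : Prop :=
  (forall P Q R, T P -> T Q -> secant_generated P Q R -> T R) /\
  (forall P R, T P -> tangent_generated P R -> T R).

(* Meaningful for Sigma included in S(K).                                     *)
Definition Span (Sigma : subspace K -> Prop) (X : subspace K) : Prop :=
  forall T : subspace K -> Prop,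
    (forall Y, T Y -> rational_point Y) ->
    (forall Y, Sigma Y -> T Y) ->
    closed_under_generation T -> T X.

End Surface.

(* Main.v *)
Require Import Defs.
From HB Require Import structures.
From mathcomp Require Import all_boot all_order all_algebra all_field.
From mathcomp Require Import mpoly.
From mathcomp Require Import ring zify.
From Stdlib Require Import ClassicalEpsilon.

Set Implicit Arguments.
Unset Strict Implicit.
Unset Printing Implicit Defensive.

Import GRing.Theory.
Local Open Scope ring_scope.

(* Every plane through the line L of the surface S cuts S in L and a residual conic, and this conic meets  *)
(* L in two points of L, possibly conjugate or equal. Call the plane split, nonsplit or parabolic         *)
(* accordingly.                                                                                            *)
(*                                                                                                         *)
(* Suppose some plane is split, with points X and Y. Secants and tangents inside the split planes show    *)
(* that X generates L, and then tangents at L and secants between conics and L generate all points of S   *)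
(* in split and parabolic planes, except perhaps the vertices of triangles. Let Q be a point that is not  *)
(* generated. Projecting from Q, the line through Q and a generated point meets S again in a point that   *)
(* is not generated; counting both kinds of points plane by plane leaves so little room that no conic of  *)
(* a nonsplit plane with at least two points is partly generated, and very few planes are parabolic,      *)
(* triangles, or nonsplit with at most one point. On the other hand, the residual points of the tangent   *)
(* lines at a generated point of a smooth split plane form a rational curve, parametrized by w; their     *)
(* planes are given by a quotient u(w)/v(w) of quadratic polynomials, and none of them is nonsplit. In    *)
(* odd characteristic the discriminant of the plane is then a square for every w, and Stepanov's method   *)
(* shows that a quartic which is always a square has the shape of a square; comparing two tangent curves  *)
(* yields a geometric plane whose conic is a double line, which is impossible on a smooth surface. In     *)
(* characteristic 2 an absolute trace vanishes for every w, and differentiating the polynomial expressing *)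
(* it makes u and v proportional, which gives a line that is not there. Hence every point in a nonsplit   *)
(* plane with two or more points is generated, and one more count by projection from Q disposes of the    *)
(* rest.                                                                                                   *)
(*                                                                                                         *)
(* If no plane is split then all are parabolic, the characteristic is 2, and the point of L on a smooth   *)
(* conic generates S: a quintic form in the plane decides smoothness, and it has few rational zeros.      *)

(** * Trilinear forms and cubics *)

(** A plane through [L] is a class [p + L]. Its points off [L] are [p + x X + y Y], and the
    vanishing of [cub] on them is the affine equation of the residual conic, with [L] at infinity.
    The quadratic part is the form [Z -> cub1 Z p] on [L]; the plane is split, parabolic or nonsplit
    according as this form has two, one or no rational zeros. Smoothness enters in two ways: the
    form never vanishes identically ([smooth_quadratic]), and no geometric residual conic is a
    double line ([smooth_double_line]).

    If some plane is split, [gen_line_split] generates [L] from one point, and [cover_center],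
    [cover_tangent] and [eckardt_cover_split] reach the points of split and parabolic planes other
    than vertices of triangles. For a point [Q] that is not generated, taking third points on the
    lines through [Q] injects generated points into ungenerated ones ([reflection_count]). Summed
    over the planes this gives [master_inequality]: the total surplus is at most q + 1, less two for
    each parabolic plane. A partly generated nonsplit conic with two points would have surplus 2q,
    so there is none ([not_killed]).

    Against this stands the rational curve [curve] of residual points of the tangent lines at a
    generated point. Its points are generated unless they return to the point of tangency, so it
    misses the nonsplit planes with two points ([curve_avoid]). A quotient of quadratics with such
    restricted values is impossible: by [stepanov], [double_root] and [double_shift] in odd
    characteristic ([odd_kill]), by [trace_wronskian] in characteristic two ([even_kill]). This
    proves [cover_nonsplit]. What could remain is at most one singular point in each plane
    ([uncovered_unique]), and [cover_all] excludes it by one more reflection count.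

    If no plane is split, the form on [L] is a square up to a scalar in every plane and the
    characteristic is two ([insep]); [smooth_pencil] then provides enough smooth conics, and
    [insep_generator] concludes. *)

Section Trilinear.
Variables (R : comNzRingType) (c : 'I_4 -> 'I_4 -> 'I_4 -> R).
Implicit Types x y z : 'rV[R]_4.

(** No symmetry is imposed on [c]: every cubic form is then a diagonal [tri x x x] in any
    characteristic, without dividing by 2 or 3. *)
Definition tri x y z := \sum_i \sum_j \sum_k c i j k * (x 0 i * y 0 j * z 0 k).

Lemma triDl x x' y z : tri (x + x') y z = tri x y z + tri x' y z.
Proof.
rewrite /tri -big_split; apply: eq_bigr => i _ /=; rewrite -big_split.
by apply: eq_bigr => j _ /=; rewrite -big_split; apply: eq_bigr => k _ /=; rewrite !mxE; ring.
Qed.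
Lemma triDm x y y' z : tri x (y + y') z = tri x y z + tri x y' z.
Proof.
rewrite /tri -big_split; apply: eq_bigr => i _ /=; rewrite -big_split.
by apply: eq_bigr => j _ /=; rewrite -big_split; apply: eq_bigr => k _ /=; rewrite !mxE; ring.
Qed.
Lemma triDr x y z z' : tri x y (z + z') = tri x y z + tri x y z'.
Proof.
rewrite /tri -big_split; apply: eq_bigr => i _ /=; rewrite -big_split.
by apply: eq_bigr => j _ /=; rewrite -big_split; apply: eq_bigr => k _ /=; rewrite !mxE; ring.
Qed.
Lemma triZl a x y z : tri (a *: x) y z = a * tri x y z.
Proof.
rewrite /tri mulr_sumr; apply: eq_bigr => i _; rewrite mulr_sumr; apply: eq_bigr => j _.
by rewrite mulr_sumr; apply: eq_bigr => k _; rewrite !mxE; ring.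
Qed.
Lemma triZm a x y z : tri x (a *: y) z = a * tri x y z.
Proof.
rewrite /tri mulr_sumr; apply: eq_bigr => i _; rewrite mulr_sumr; apply: eq_bigr => j _.
by rewrite mulr_sumr; apply: eq_bigr => k _; rewrite !mxE; ring.
Qed.
Lemma triZr a x y z : tri x y (a *: z) = a * tri x y z.
Proof.
rewrite /tri mulr_sumr; apply: eq_bigr => i _; rewrite mulr_sumr; apply: eq_bigr => j _.
by rewrite mulr_sumr; apply: eq_bigr => k _; rewrite !mxE; ring.
Qed.

Definition cub x := tri x x x.
(* [cub1 x y] is the derivative of [cub] at [x] along [y]: it vanishes when [y] is in the tangent plane at [x]. *)
Definition cub1 x y := tri x x y + tri x y x + tri y x x.
Definition polar x y z :=
  tri x y z + tri x z y + tri y x z + tri y z x + tri z x y + tri z y x.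

Lemma cubD x y : cub (x + y) = cub x + cub1 x y + cub1 y x + cub y.
Proof. by rewrite /cub /cub1 !(triDl, triDm, triDr); ring. Qed.
Lemma cubZ a x : cub (a *: x) = a ^+ 3 * cub x.
Proof. by rewrite /cub !(triZl, triZm, triZr); ring. Qed.
Lemma cub1Dl x y z : cub1 (x + y) z = cub1 x z + polar x y z + cub1 y z.
Proof. by rewrite /polar /cub1 !(triDl, triDm, triDr); ring. Qed.
Lemma cub1Zl a x z : cub1 (a *: x) z = a ^+ 2 * cub1 x z.
Proof. by rewrite /cub1 !(triZl, triZm, triZr); ring. Qed.
Lemma cub1Dr x y z : cub1 x (y + z) = cub1 x y + cub1 x z.
Proof. by rewrite /cub1 !(triDl, triDm, triDr); ring. Qed.
Lemma cub1Zr a x z : cub1 x (a *: z) = a * cub1 x z.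
Proof. by rewrite /cub1 !(triZl, triZm, triZr); ring. Qed.
Lemma polarDl x x' y z : polar (x + x') y z = polar x y z + polar x' y z.
Proof. by rewrite /polar !(triDl, triDm, triDr); ring. Qed.
Lemma polarZl a x y z : polar (a *: x) y z = a * polar x y z.
Proof. by rewrite /polar !(triZl, triZm, triZr); ring. Qed.
Lemma polarC x y z : polar x y z = polar y x z.
Proof. by rewrite /polar; ring. Qed.
Lemma polarCr x y z : polar x y z = polar x z y.
Proof. by rewrite /polar; ring. Qed.
Lemma polarDm x y y' z : polar x (y + y') z = polar x y z + polar x y' z.
Proof. by rewrite polarC polarDl !(polarC _ x). Qed.
Lemma polarZm a x y z : polar x (a *: y) z = a * polar x y z.
Proof. by rewrite polarC polarZl (polarC _ x). Qed.
Lemma polarDr x y z z' : polar x y (z + z') = polar x y z + polar x y z'.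
Proof. by rewrite polarCr polarDm !(polarCr x _ y). Qed.
Lemma polarZr a x y z : polar x y (a *: z) = a * polar x y z.
Proof. by rewrite polarCr polarZm (polarCr x _ y). Qed.
Lemma cub1x0 x : cub1 x 0 = 0.
Proof. by rewrite -(scale0r (0 : 'rV[R]_4)) cub1Zr mul0r. Qed.
Lemma polarxx x y : polar x x y = cub1 x y *+ 2.
Proof. by rewrite /polar /cub1; ring. Qed.
Lemma polarxyx x y : polar x y x = cub1 x y *+ 2.
Proof. by rewrite polarCr polarxx. Qed.
Lemma polarxyy x y : polar x y y = cub1 y x *+ 2.
Proof. by rewrite polarC polarxyx. Qed.
Lemma polar_perm x y z : ((polar x z y = polar x y z) * (polar y x z = polar x y z) *
  (polar y z x = polar x y z) * (polar z x y = polar x y z) * (polar z y x = polar x y z))%type.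
Proof. by rewrite /polar; do !split; ring. Qed.
Lemma cub1xx x : cub1 x x = cub x *+ 3.
Proof. by rewrite /cub1 /cub; ring. Qed.

Definition polarE := (polarxx, polarxyx, polarxyy).
Definition cubE := (cubD, cubZ, cub1Dl, cub1Zl, cub1Dr, cub1Zr, polarDl, polarZl,
  polarDm, polarZm, polarDr, polarZr).
End Trilinear.

Section Morph.
Variables (R S : comNzRingType) (h : {rmorphism R -> S}) (c : 'I_4 -> 'I_4 -> 'I_4 -> R).
Notation hc := (fun i j k => h (c i j k)).
Lemma tri_map x y z : tri hc (map_mx h x) (map_mx h y) (map_mx h z) = h (tri c x y z).
Proof.
rewrite /tri rmorph_sum; apply: eq_bigr => i _; rewrite rmorph_sum; apply: eq_bigr => j _.
by rewrite rmorph_sum; apply: eq_bigr => k _; rewrite !mxE !rmorphM.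
Qed.
Lemma cub_map x : cub hc (map_mx h x) = h (cub c x).
Proof. exact: tri_map. Qed.
Lemma cub1_map x y : cub1 hc (map_mx h x) (map_mx h y) = h (cub1 c x y).
Proof. by rewrite /cub1 !tri_map !rmorphD. Qed.
Lemma polar_map x y z :
  polar hc (map_mx h x) (map_mx h y) (map_mx h z) = h (polar c x y z).
Proof. by rewrite /polar !tri_map !rmorphD. Qed.
End Morph.

(** * Polynomials of degree three as diagonals, and their restriction to a line *)

Section Tensor.
Variable (K : fieldType).
Definition tens (c : 'I_4 -> 'I_4 -> 'I_4 -> K) : {mpoly K[4]} :=
  \sum_i \sum_j \sum_k c i j k *: ('X_i * 'X_j * 'X_k).

Lemma tensD c c' : tens c + tens c' = tens (fun i j k => c i j k + c' i j k).
Proof.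
rewrite /tens -big_split; apply: eq_bigr => i _; rewrite -big_split; apply: eq_bigr => j _.
by rewrite -big_split; apply: eq_bigr => k _; rewrite /= scalerDl.
Qed.

Lemma tens_delta a i j k :
  tens (fun i' j' k' => if (i', j', k') == (i, j, k) then a else 0) = a *: ('X_i * 'X_j * 'X_k).
Proof.
rewrite /tens (bigD1 i) //= (bigD1 j) //= (bigD1 k) //= eqxx.
rewrite [X in _ + X]big1 ?addr0 => [|i' ni].
  rewrite [X in _ + X]big1 ?addr0 => [|j' nj].
    rewrite [X in _ + X]big1 ?addr0 => [//|k' nk].
    by rewrite !xpair_eqE (negPf nk) !andbF scale0r.
  by rewrite big1 // => k' _; rewrite !xpair_eqE (negPf nj) andbF andFb scale0r.
by rewrite big1 // => j' _; rewrite big1 // => k' _; rewrite !xpair_eqE (negPf ni) scale0r.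
Qed.

Lemma monomial_factor (m : 'X_{1..4}) d : mdeg m = d.+1 ->
  exists i m', mdeg m' = d /\ ('X_[m] : {mpoly K[4]}) = 'X_i * 'X_[m'].
Proof.
move=> dm; have [i mi] : exists i, m i != 0%N.
  apply/existsP; rewrite -negb_forall; apply/negP => /forallP m0.
  by move: dm; rewrite mdegE big1 // => i _; apply/eqP/m0.
exists i, (m - U_(i))%MM; have le : (U_(i) <= m)%MM by rewrite lep1mP.
rewrite -mpolyXD addmC submK //; split=> //.
by move: dm; rewrite -{1}(submK le) mdegD mdeg1 addn1 => -[].
Qed.

Lemma cubic_tens (F : {mpoly K[4]}) : F \is 3.-homog -> exists c, F = tens c.
Proof.
move=> /dhomogP hF; rewrite [F]mpolyE.
rewrite big_seq; elim/big_rec: _ => [|m p mF [c ->]].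
  exists (fun _ _ _ => 0); rewrite /tens big1 // => i _; rewrite big1 // => j _.
  by rewrite big1 // => k _; rewrite scale0r.
have [i [m1 [d1 ->]]] := monomial_factor (hF _ mF).
have [j [m2 [d2 ->]]] := monomial_factor d1.
have [k [m3 [/eqP]]] := monomial_factor d2.
rewrite mdeg_eq0 => /eqP-> ->; rewrite mpolyX0 mulr1 mulrA -tens_delta tensD.
by eexists.
Qed.

Lemma tens_meval c (x : 'rV[K]_4) : (tens c).@[x 0] = cub c x.
Proof.
rewrite /tens /cub /tri raddf_sum; apply: eq_bigr => i _; rewrite raddf_sum; apply: eq_bigr => j _.
by rewrite raddf_sum; apply: eq_bigr => k _ /=; rewrite mevalZ !mevalM !mevalXU.
Qed.

Lemma tens_map (E : fieldType) (h : {rmorphism K -> E}) c :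
  map_mpoly h (tens c) = \sum_i \sum_j \sum_k h (c i j k) *: ('X_i * 'X_j * 'X_k).
Proof.
rewrite /tens raddf_sum; apply: eq_bigr => i _; rewrite raddf_sum; apply: eq_bigr => j _.
by rewrite raddf_sum; apply: eq_bigr => k _ /=; rewrite map_mpolyZ !rmorphM /= !map_mpolyX.
Qed.
End Tensor.

Lemma tens_mderiv (K : fieldType) (c : 'I_4 -> 'I_4 -> 'I_4 -> K) i (x : 'rV[K]_4) :
  (tens c)^`M(i).@[x 0] = cub1 c x (delta_mx 0 i).
Proof.
have dE (j : 'I_4) : ('X_j : {mpoly K[4]})^`M(i) = ((delta_mx 0 i : 'rV[K]_4) 0 j)%:MP.
  rewrite mderivX mnm1E !mxE eqxx /= eq_sym; case: eqP => [->|_]; last by rewrite !scale0r.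
  by rewrite -[X in (X - _)%MM]add0m addmK mpolyX0 scale1r mpolyC1.
have sumE (I : finType) (G : I -> {mpoly K[4]}) :
    (\sum_a G a)^`M(i).@[x 0] = \sum_a (G a)^`M(i).@[x 0].
  by elim/big_rec2: _ => [|a u p _ <-]; rewrite ?mderiv0 ?meval0 // mderivD mevalD.
rewrite /tens /cub1 /tri -!big_split sumE; apply: eq_bigr => a _ /=.
rewrite -!big_split sumE; apply: eq_bigr => b _ /=.
rewrite -!big_split sumE; apply: eq_bigr => k _ /=.
rewrite mderivZ !mderivM !dE mevalZ !mevalD !mevalM !mevalD !mevalM !mevalC !mevalXU.
by ring.
Qed.

Section Restriction.
Variables (K : fieldType) (c : 'I_4 -> 'I_4 -> 'I_4 -> K).
(** The generic point [s p + t q] is treated as a vector over the ring of polynomials in [s] and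
    [t], so that the trilinear expansion of [cub] applies to it. *)
Lemma tens_restriction (b : 2.-tuple 'rV[K]_4) (p q : 'rV[K]_4) :
  p = tnth b ord0 -> q = tnth b ord_max ->
  restriction (tens c) b =
   cub c p *: 'X_ord0 ^+ 3 + cub1 c p q *: ('X_ord0 ^+ 2 * 'X_ord_max)
   + cub1 c q p *: ('X_ord0 * 'X_ord_max ^+ 2) + cub c q *: 'X_ord_max ^+ 3.
Proof.
move=> -> ->.
pose h : {rmorphism K -> {mpoly K[2]}} := @mpolyC 2 K.
pose v := 'X_ord0 *: map_mx h (tnth b ord0) + 'X_ord_max *: map_mx h (tnth b ord_max).
have vE i : tnth [tuple \sum_(j < 2) (tnth b j) 0 i *: ('X_j : {mpoly K[2]}) | i < 4] i = v 0 i.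
  rewrite tnth_mktuple big_ord_recl big_ord1 !mxE.
  have -> : lift ord0 ord0 = ord_max :> 'I_2 by apply/val_inj.
  by rewrite /h /= !(mulrC 'X_ _) !mul_mpolyC.
have -> : restriction (tens c) b = cub (fun i j k => h (c i j k)) v.
  rewrite /restriction /tens /cub /tri raddf_sum; apply: eq_bigr => i _.
  rewrite raddf_sum; apply: eq_bigr => j _; rewrite raddf_sum; apply: eq_bigr => k _.
  by rewrite /= comp_mpolyZ !rmorphM /= !comp_mpolyXU -!tnth_nth !vE mul_mpolyC.
rewrite /v !cubE !cub_map !cub1_map -!mul_mpolyC /h /=.
by ring.
Qed.
End Restriction.

(** * The secant and tangent operations on vectors *)

Section Closed.
Variables (K : fieldType) (c : 'I_4 -> 'I_4 -> 'I_4 -> K).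

(** A set of points becomes a set of nonzero vectors stable under scaling. In [cl_tangent] the cubic
    restricts to [s t^2 (cub1 r p)] at [s p + t r], which is the divisor 2P + R. In [cl_secant] it
    restricts to [s t (s cub1 p q + t cub1 q p)], and nonzero [a], [b] keep the third point apart
    from the first two. *)
Record sigma_closed (S : 'rV[K]_4 -> Prop) : Prop := SigmaClosed {
  cl_on : forall p, S p -> p != 0 /\ cub c p = 0;
  cl_scale : forall p k, S p -> k != 0 -> S (k *: p);
  cl_tangent : forall p r, S p -> cub c r = 0 -> cub1 c p r = 0 -> cub1 c r p != 0 -> S r;
  cl_secant : forall p q a b, S p -> S q -> a != 0 -> b != 0 ->
     cub c (a *: p + b *: q) = 0 -> cub1 c p q != 0 -> S (a *: p + b *: q) }.

Definition csmooth : Prop :=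
  forall (E : closedFieldType) (h : {rmorphism K -> E}) (x : 'rV[E]_4), x != 0 ->
    cub (fun i j k => h (c i j k)) x = 0 ->
    exists i, cub1 (fun i j k => h (c i j k)) x (delta_mx 0 i) != 0.

Lemma smooth_tens : smooth (tens c) -> csmooth.
Proof.
move=> sm E h x x0 fx.
have eqF : map_mpoly h (tens c) = tens (fun i j k => h (c i j k)) by exact: tens_map.
have [|i] := sm E h x x0; first by rewrite eqF tens_meval.
by rewrite eqF tens_mderiv; exists i.
Qed.

Notation F := (tens c).

Lemma binary_cubic_eq0 (s t u v : K) :
  s *: 'X_ord0 ^+ 3 + t *: ('X_ord0 ^+ 2 * 'X_ord_max) + u *: ('X_ord0 * 'X_ord_max ^+ 2)
   + v *: 'X_ord_max ^+ 3 = 0 :> {mpoly K[2]} -> [/\ s = 0, t = 0, u = 0 & v = 0].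
Proof.
have xE i j : 'X_ord0 ^+ i * 'X_ord_max ^+ j = 'X_[U_(ord0) *+ i + U_(ord_max) *+ j] :> {mpoly K[2]}.
  by rewrite mpolyXD !mpolyXn.
move=> /(congr1 (fun p => (p@_(U_(ord0) *+ 3 + U_(ord_max) *+ 0), p@_(U_(ord0) *+ 2 + U_(ord_max) *+ 1),
  p@_(U_(ord0) *+ 1 + U_(ord_max) *+ 2), p@_(U_(ord0) *+ 0 + U_(ord_max) *+ 3)))).
rewrite -['X_ord0 ^+ 3]mulr1 -(expr0 'X_ord_max) -['X_ord_max ^+ 3]mul1r -(expr0 'X_ord0).
have -> : 'X_ord0 ^+ 2 * 'X_ord_max = 'X_ord0 ^+ 2 * 'X_ord_max ^+ 1 :> {mpoly K[2]} by [].
have -> : 'X_ord0 * 'X_ord_max ^+ 2 = 'X_ord0 ^+ 1 * 'X_ord_max ^+ 2 :> {mpoly K[2]} by [].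
rewrite !xE !mcoeffD !mcoeffZ !mcoeffX !mcoeff0.
have E i j i' j' : (U_(ord0) *+ i + U_(ord_max) *+ j == U_(ord0) *+ i' + U_(ord_max) *+ j' :> 'X_{1..2})%MM
    = (i == i') && (j == j').
  apply/eqP/andP => [/mnmP e|[/eqP-> /eqP->] //].
  move: (e ord0) (e ord_max); rewrite !mnmE !mulmnE !mnm1E /=; lia.
by rewrite !E /= !mulr0 !mulr1 !addr0 !add0r => -[-> -> -> ->].
Qed.

Lemma line_in_surface_vanish (L : {vspace 'rV[K]_4}) : line_in_surface F L ->
  forall p q, p \in L -> q \in L -> cub c p = 0 /\ cub1 c p q = 0.
Proof.
case=> b bL /eqP; rewrite (tens_restriction c (erefl (tnth b ord0)) (erefl (tnth b ord_max))).
move=> /eqP /binary_cubic_eq0 [s0 t0 u0 v0] p q.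
have sp x : x \in L -> exists a a', x = a *: tnth b ord0 + a' *: tnth b ord_max.
  move=> xL; exists (coord b ord0 x), (coord b ord_max x).
  rewrite {1}(coord_basis bL xL) big_ord_recl big_ord1 !(tnth_nth 0).
  by have -> : lift ord0 ord0 = ord_max :> 'I_2 by apply/val_inj.
move=> /sp[a [a' ->]] /sp[d [d' ->]].
by rewrite !cubE !polarE !cub1xx s0 t0 u0 v0; split; ring.
Qed.
End Closed.

Section Generation.
Variables (K : fieldType) (c : 'I_4 -> 'I_4 -> 'I_4 -> K).
Notation F := (tens c).
Implicit Types p q r : 'rV[K]_4.

Lemma rational_point_vline p : p != 0 -> cub c p = 0 -> rational_point F <[p]>%VS.
Proof.
move=> p0 fp; split; first by rewrite dim_vline p0.
by move=> x /vlineP[k ->]; rewrite tens_meval cubZ fp mulr0.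
Qed.

Lemma rational_pointP (X : {vspace 'rV[K]_4}) : rational_point F X ->
  exists p, [/\ p != 0, cub c p = 0 & X = <[p]>%VS].
Proof.
case=> dX fX; have X0 : X != 0%VS by rewrite -dimv_eq0 dX.
have pX := memv_pick X; exists (vpick X); split; first by rewrite vpick0.
  by rewrite -tens_meval fX.
apply/eqP; rewrite eq_sym eqEdim dX dim_vline vpick0 X0 leqnn andbT.
by rewrite -memvE.
Qed.

Lemma vpick_vline p : p != 0 -> exists2 k, k != 0 & vpick <[p]>%VS = k *: p.
Proof.
move=> p0; have /vlineP[k e] := memv_pick <[p]>%VS; exists k => //.
apply: contraNneq p0 => k0; move/eqP: e; rewrite k0 scale0r vpick0 => /eqP e.
by have := memv_line p; rewrite e memv0.
Qed.

Lemma cub1_free p r : cub c p = 0 -> cub1 c r p != 0 -> cub c r = 0 -> free [:: p; r].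
Proof.
move=> fp upr fr; rewrite free_cons seq1_free span_seq1; apply/andP; split.
  apply: contraNN upr => /vlineP[k e].
  by rewrite e cub1Zr cub1xx fr mul0rn mulr0.
by apply: contraNneq upr => ->; rewrite -[0](scale0r 0) cub1Zl expr0n mul0r.
Qed.

Section Pair.
Variables p r : 'rV[K]_4.
Hypothesis fpr : free [:: p; r].
Notation b := [tuple p; r].
Notation L := (<[p]> + <[r]>)%VS.

Let p0 : p != 0. Proof. by apply: (free_not0 fpr); rewrite inE eqxx. Qed.
Let r0 : r != 0. Proof. by apply: (free_not0 fpr); rewrite !inE eqxx orbT. Qed.

Lemma pair_basis : basis_of L b.
Proof. by rewrite /basis_of span_cons span_seq1 eqxx. Qed.

Lemma dim_pair : \dim L = 2%N.
Proof. by rewrite -(span_basis pair_basis) (eqP fpr). Qed.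

Lemma coord_pair (i : 'I_2) x y : coord b i (x *: p + y *: r) = if i == ord0 then x else y.
Proof.
rewrite linearD !linearZ /=.
have -> : coord b i p = (i == ord0)%:R by have := coord_free ord0 i fpr; rewrite [_ == i]eq_sym.
have -> : coord b i r = (i == ord_max)%:R by have := coord_free ord_max i fpr; rewrite [_ == i]eq_sym.
rewrite -!val_eqE /=.
by case: i => -[|[|//]] /=; rewrite ?mulr0 ?mulr1 ?addr0 ?add0r.
Qed.

Lemma point_form_pair x y : (x != 0) || (y != 0) ->
  exists2 k, k != 0 & point_form b <[x *: p + y *: r]>%VS
     = k *: (y *: 'X_ord0 - x *: 'X_ord_max).
Proof.
move=> xy; have [|k k0 e] := @vpick_vline (x *: p + y *: r).
  apply: contraTneq xy => e; rewrite negb_or !negbK.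
  have := coord_pair ord0 x y; have := coord_pair ord_max x y; rewrite e !linear0 /=.
  by move=> <- <-; rewrite eqxx.
exists k => //; rewrite /point_form e scalerDr !scalerA !coord_pair /=.
by rewrite scalerBr !scalerA.
Qed.

Lemma pair_notin_surface : cub1 c p r != 0 \/ cub1 c r p != 0 -> ~ line_in_surface F L.
Proof.
move=> ne /line_in_surface_vanish h.
have pL : p \in L by rewrite memvE addvSl.
have rL : r \in L by rewrite memvE addvSr.
by case: ne; rewrite ?(proj2 (h _ _ pL rL)) ?(proj2 (h _ _ rL pL)) eqxx.
Qed.
End Pair.

Lemma tangent_vline p r : cub c p = 0 -> cub c r = 0 -> cub1 c p r = 0 -> cub1 c r p != 0 ->
  tangent_generated F <[p]> <[r]>.
Proof.
move=> fp fr upr urp; have fre := cub1_free fp urp fr.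
have p0 : p != 0 by apply: (free_not0 fre); rewrite inE eqxx.
have r0 : r != 0 by apply: (free_not0 fre); rewrite !inE eqxx orbT.
split.
  split; [exact: rational_point_vline|exact: rational_point_vline|].
  move=> e; move: fre; rewrite free_cons span_seq1 e.
  by rewrite memv_line.
exists (<[p]> + <[r]>)%VS; split.
- exact: dim_pair.
- exact: addvSl.
- have [k k0 e] := vpick_vline p0.
  have tan v : cub1 c p v = 0 -> v \in tangent_plane F <[p]>%VS.
    move=> uv; rewrite memv_ker lfunE /=; apply/eqP/rowP=> j; rewrite !mxE.
    under eq_bigr => i _ do rewrite mxE e tens_mderiv cub1Zl.
    transitivity (k ^+ 2 * cub1 c p v); last by rewrite uv mulr0.
    rewrite [in RHS](row_sum_delta v).
    elim/big_rec2: _ => [|i y z _ ->].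
      by rewrite cub1x0 mulr0.
    by rewrite cub1Dr cub1Zr; ring.
  by rewrite subv_add -!memvE !tan // cub1xx fp mul0rn.
- by apply: pair_notin_surface => //; right.
split; first by rewrite /= addvSl addvSr.
exists [tuple p; r]; first exact: pair_basis.
have [k1 k10 e1] := point_form_pair fre (x := 1) (y := 0) ltac:(by rewrite oner_eq0).
have [k2 k20 e2] := point_form_pair fre (x := 0) (y := 1) ltac:(by rewrite oner_eq0 orbT).
move: e1 e2; rewrite !scale0r !scale1r !(addr0, add0r, oppr0) => e1 e2.
(* [k1] and [k2] are the scalars by which [vpick] differs from [p] and [r]. *)
exists (cub1 c r p / (k1 ^+ 2 * k2)).
  by rewrite mulf_neq0 // invr_eq0 mulf_neq0 // expf_neq0.
rewrite (tens_restriction c (p := p) (q := r)) // fp fr upr !scale0r !add0r addr0.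
rewrite !big_cons big_nil !e1 e2 mulr1 -!mul_mpolyC.
have {1}-> : cub1 c r p = cub1 c r p / (k1 ^+ 2 * k2) * k1 ^+ 2 * k2 by field; rewrite k10 k20.
rewrite !mpolyCM; ring.
Qed.

Lemma secant_vline p q a b : cub c p = 0 -> cub c q = 0 -> a != 0 -> b != 0 ->
  cub c (a *: p + b *: q) = 0 -> cub1 c p q != 0 ->
  secant_generated F <[p]> <[q]> <[a *: p + b *: q]>.
Proof.
move=> fp fq a0 b0 fr upq.
have fre : free [:: p; q].
  have := cub1_free fq upq fp; rewrite !(perm_free (_ : perm_eq [:: q; p] [:: p; q])) //.
  by apply/permP => x /=; lia.
have p0 : p != 0 by apply: (free_not0 fre); rewrite inE eqxx.
have q0 : q != 0 by apply: (free_not0 fre); rewrite !inE eqxx orbT.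
have e : cub1 c q p = - (cub1 c p q * a / b).
  move: fr; rewrite !cubE fp fq !mulr0 add0r addr0 => fr.
  have : a * b * (a * cub1 c p q + b * cub1 c q p) = 0 by rewrite -[RHS]fr; ring.
  move/eqP; rewrite !mulf_eq0 (negPf a0) (negPf b0) /= => /eqP h.
  by apply: (mulfI b0); apply/eqP; rewrite -subr_eq0 -[X in _ == X]h; apply/eqP; field.
pose r := a *: p + b *: q.
have co := coord_pair fre.
have r0 : r != 0.
  by apply: contraNneq a0 => r0; have := co ord0 a b; rewrite -/r r0 linear0 /= => <-.
have rp : <[r]>%VS <> <[p]>%VS.
  move=> h; have /vlineP[k] : r \in <[p]>%VS by rewrite -h memv_line.
  move=> /(congr1 (coord [tuple p; q] ord_max)); rewrite co /=.
  by rewrite -[k *: p]addr0 -(scale0r q) co /= => /eqP; rewrite (negPf b0).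
have rq : <[r]>%VS <> <[q]>%VS.
  move=> h; have /vlineP[k] : r \in <[q]>%VS by rewrite -h memv_line.
  move=> /(congr1 (coord [tuple p; q] ord0)); rewrite co /=.
  by rewrite -[k *: q]add0r -(scale0r p) co /= => /eqP; rewrite (negPf a0).
split.
  split; try exact: rational_point_vline.
  by move=> h; move: fre; rewrite free_cons span_seq1 -h memv_line.
split=> //; first by apply: pair_notin_surface => //; left.
split.
  rewrite /= addvSl addvSr -memvE memvD ?memvZ // memvE; [exact: addvSl|exact: addvSr].
exists [tuple p; q]; first exact: pair_basis.
have [k1 k10 e1] := point_form_pair fre (x := 1) (y := 0) ltac:(by rewrite oner_eq0).
have [k2 k20 e2] := point_form_pair fre (x := 0) (y := 1) ltac:(by rewrite oner_eq0 orbT).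
have [k3 k30 e3] := point_form_pair fre (x := a) (y := b) ltac:(by rewrite a0).
move: e1 e2; rewrite !scale0r !scale1r !(addr0, add0r, oppr0) => e1 e2.
exists (- cub1 c p q / (k1 * k2 * k3 * b)).
  by rewrite mulf_neq0 ?oppr_eq0 // invr_eq0 !mulf_neq0.
rewrite (tens_restriction c (p := p) (q := q)) // fp fq e !scale0r !add0r addr0.
rewrite !big_cons big_nil !e1 e2 e3 mulr1 -!mul_mpolyC.
have : cub1 c p q = - (- cub1 c p q / (k1 * k2 * k3 * b) * (k1 * k2 * k3 * b)).
  by rewrite divfK ?opprK // !mulf_neq0.
move: (- cub1 c p q / _) => d ->.
have -> : - (- (d * (k1 * k2 * k3 * b)) * a / b) = d * k1 * k2 * k3 * a by field.
rewrite !(mpolyCM, mpolyCN); ring.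
Qed.

Lemma closed_sigma (T : {vspace 'rV[K]_4} -> Prop) :
  (forall Y, T Y -> rational_point F Y) -> closed_under_generation F T ->
  sigma_closed c (fun v => v != 0 /\ T <[v]>%VS).
Proof.
move=> Trat [Tsec Ttan].
have on v : v != 0 /\ T <[v]>%VS -> v != 0 /\ cub c v = 0.
  case=> v0 Tv; split=> //; have [_ h] := Trat _ Tv.
  by rewrite -tens_meval h // memv_line.
split=> //.
- move=> p k [p0 Tp] k0; split; first by rewrite scaler_eq0 (negPf k0) (negPf p0).
  suff -> : <[k *: p]>%VS = <[p]>%VS by [].
  apply/eqP; rewrite eqEsubv -!memvE memvZ ?memv_line //=.
  by apply/vlineP; exists k^-1; rewrite scalerA mulVf // scale1r.
- move=> p r Sp fr upr urp; have [p0 fp] := on _ Sp.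
  have g := tangent_vline fp fr upr urp; split; last by apply: Ttan g; case: Sp.
  by have := cub1_free fp urp fr => /free_not0; apply; rewrite !inE eqxx orbT.
move=> p q a b Sp Sq a0 b0 fr upq; have [p0 fp] := on _ Sp; have [q0 fq] := on _ Sq.
have g := secant_vline fp fq a0 b0 fr upq; split; last by apply: Tsec g; [case: Sp|case: Sq].
by have [[_ _ [+ _] _] _] := g; rewrite dim_vline; case: eqP.
Qed.

Theorem span_of_sigma p : p != 0 -> cub c p = 0 ->
  (forall S, sigma_closed c S -> S p -> forall r, r != 0 -> cub c r = 0 -> S r) ->
  forall X, Span F (fun Y => Y = <[p]>%VS) X <-> rational_point F X.
Proof.
move=> p0 fp gen X; split=> [|/rational_pointP[r [r0 fr ->]] T Trat TP Tcl].
  apply=> // [Y ->|]; first exact: rational_point_vline.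
  by split=> [P Q R _ _ [[]]|P R _ [[]]].
have [|_] := gen _ (closed_sigma Trat Tcl) _ r r0 fr; last by [].
by split=> //; exact: TP.
Qed.
End Generation.

(** * Lines on the surface and the planes through them *)

Lemma fin_closure (K : finFieldType) : exists (E : closedFieldType) (h : {rmorphism K -> E}), True.
Proof. by have [E [h _]] := countable_algebraic_closure K; exists E, h. Qed.

Section Coordinates.
Variables (K : fieldType) (c : 'I_4 -> 'I_4 -> 'I_4 -> K).
Notation V := 'rV[K]_4.
Hypothesis sm : csmooth c.

Definition spans4 (e0 e1 e2 e3 : V) : Prop :=
  forall r, exists x y m n, r = x *: e0 + y *: e1 + m *: e2 + n *: e3.

(** The Jacobian criterion in an arbitrary rational basis: the base change matrix is invertible, so
    the point is nonzero and the partial derivatives are combinations of the four given ones. *)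
Lemma smooth_coords e0 e1 e2 e3 (E : closedFieldType) (h : {rmorphism K -> E}) x y m n :
  spans4 e0 e1 e2 e3 -> [|| x != 0, y != 0, m != 0 | n != 0] ->
  let hc := fun i j k => h (c i j k) in
  let v := x *: map_mx h e0 + y *: map_mx h e1 + m *: map_mx h e2 + n *: map_mx h e3 in
  cub1 hc v (map_mx h e0) = 0 -> cub1 hc v (map_mx h e1) = 0 ->
  cub1 hc v (map_mx h e2) = 0 -> cub1 hc v (map_mx h e3) = 0 -> cub hc v <> 0.
Proof.
move=> sp xymn hc v v0 v1 v2 v3 fv.
pose e := [tuple e0; e1; e2; e3]; pose z := [tuple x; y; m; n].
have vE : v = \sum_(i < 4) z`_i *: map_mx h e`_i.
  by rewrite !big_ord_recl big_ord0 /= addr0 !addrA.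
pose M := \matrix_(i < 4, j < 4) e`_i 0 j.
have dE r : exists w : 'rV_4, r = w *m M.
  have [a [b [d [g ->]]]] := sp r; pose w := [tuple a; b; d; g].
  exists (\row_i w`_i); apply/rowP => j; rewrite !mxE !big_ord_recl big_ord0 !mxE /=.
  by rewrite addr0 !addrA.
have uM : M \in unitmx.
  rewrite -row_full_unit -sub1mx; apply/row_subP => i.
  by have [w ->] := dE (row i 1%:M); exact: submxMl.
have vM : v = (\row_i z`_i) *m map_mx h M.
  by rewrite vE; apply/rowP => j; rewrite summxE !mxE; apply: eq_bigr => i _; rewrite !mxE.
have vn0 : v != 0.
  apply: contraTneq xymn => vv0.
  have : \row_i z`_i = v *m invmx (map_mx h M) by rewrite vM mulmxK // map_unitmx.
  rewrite vv0 mul0mx => /rowP zz; rewrite !negb_or !negbK.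
  have := zz (inord 0); have := zz (inord 1); have := zz (inord 2); have := zz (inord 3).
  by rewrite !mxE !inordK //= => -> -> -> ->; rewrite !eqxx.
have [i] := sm vn0 fv; rewrite (_ : delta_mx 0 i = map_mx h (delta_mx 0 i)); last first.
  by apply/rowP=> j; rewrite !mxE rmorph_nat.
have [a [b [d [g ->]]]] := sp (delta_mx 0 i).
by rewrite -/hc !map_mxD !map_mxZ !cub1Dr !cub1Zr v0 v1 v2 v3 !mulr0 !addr0 eqxx.
Qed.
End Coordinates.

(** Asking for [cub1 c p q = 0] too makes all coefficients of the restricted cubic vanish, so the
    containment holds geometrically and not only at rational points. *)
Record surface_line (K : fieldType) (c : 'I_4 -> 'I_4 -> 'I_4 -> K) (L : {vspace 'rV[K]_4}) : Prop :=
  SurfaceLine { line_dim : \dim L = 2%N;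
    line_vanish : forall p q, p \in L -> q \in L -> cub c p = 0 /\ cub1 c p q = 0 }.

Section Line.
Variables (K : finFieldType) (c : 'I_4 -> 'I_4 -> 'I_4 -> K).
Notation V := 'rV[K]_4.
Hypothesis sm : csmooth c.
Variable L : {vspace V}.
Hypothesis SL : surface_line c L.
Let dL : \dim L = 2%N := line_dim SL.
Let LF := line_vanish SL.
Notation f := (cub c).
Notation f1 := (cub1 c).
Notation pl := (polar c).
Implicit Types X Y p q r : V.

Definition lbasis X Y := basis_of L [:: X; Y].

Lemma lbasisL X Y : lbasis X Y -> X \in L.
Proof. by move=> b; apply: (basis_mem b); rewrite inE eqxx. Qed.
Lemma lbasisR X Y : lbasis X Y -> Y \in L.
Proof. by move=> b; apply: (basis_mem b); rewrite !inE eqxx orbT. Qed.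
Lemma lbasisC X Y : lbasis X Y -> lbasis Y X.
Proof. by rewrite /lbasis; rewrite (@perm_basis _ _ [:: X; Y] [:: Y; X] L) // (perm_catC [:: X] [:: Y]). Qed.
Lemma lbasisP X Y : lbasis X Y -> forall Z, Z \in L -> exists x y, Z = x *: X + y *: Y.
Proof.
move=> b Z ZL; move: ZL; rewrite -(span_basis b) span_cons span_seq1.
by case/memv_addP => _ /vlineP[x ->] [_ /vlineP[y ->] ->]; exists x, y.
Qed.
Lemma lbasis_free X Y : X \in L -> Y \in L -> X != 0 -> Y \notin <[X]>%VS -> lbasis X Y.
Proof.
move=> XL YL X0 YX; apply: lbasisC; rewrite /lbasis basisEfree free_cons seq1_free X0 span_seq1 YX /=.
by rewrite dL /= leqnn andbT; apply/span_subvP => z; rewrite !inE => /orP[]/eqP->.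
Qed.
Lemma lbasis_ex : exists X Y, lbasis X Y.
Proof.
have := vbasisP L; case: (vbasis L) => s; rewrite dL /=; case: s => [|X [|Y [|]]] // _ b.
by exists X, Y.
Qed.
Lemma lbasis_comb X Y x y : lbasis X Y -> x *: X + y *: Y = 0 -> x = 0 /\ y = 0.
Proof.
move=> b e; have fr := basis_free b.
have co := coord_pair fr; have := co ord0 x y; have := co ord_max x y.
by rewrite e !linear0 /= => <- <-.
Qed.
Lemma lbasis_neq0 X Y : lbasis X Y -> X != 0.
Proof. by move=> b; apply: (free_not0 (basis_free b)); rewrite inE eqxx. Qed.

Lemma lbasis_change X Y a b d e : lbasis X Y -> a * e - b * d != 0 ->
  lbasis (a *: X + b *: Y) (d *: X + e *: Y).
Proof.
move=> bXY det; have [XL YL] := (lbasisL bXY, lbasisR bXY).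
apply: lbasis_free.
- by apply: memvD; apply: memvZ.
- by apply: memvD; apply: memvZ.
- by apply: contraNneq det => /(lbasis_comb bXY)[-> ->]; rewrite !mul0r subrr.
apply: contraNN det => /vlineP[k h].
have : (d - k * a) *: X + (e - k * b) *: Y = 0.
  rewrite !scalerBl addrACA -opprD -!scalerA -scalerDr h subrr //.
by case/(lbasis_comb bXY) => /eqP; rewrite subr_eq0 => /eqP-> /eqP; rewrite subr_eq0 => /eqP->; apply/eqP; ring.
Qed.

Lemma lbasis_shear X Y t : lbasis X Y -> lbasis X (t *: X + 1 *: Y).
Proof.
move=> b; have := @lbasis_change X Y 1 0 t 1 b.
by rewrite scale1r scale0r addr0 mulr1 mul0r subr0 oner_eq0; apply.
Qed.

Lemma lbasis_spans X Y p q : lbasis X Y -> p \notin L -> q \notin (L + <[p]>)%VS ->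
  spans4 X Y p q.
Proof.
move=> b pL qL r.
have fr : free [:: q; p; X; Y].
  rewrite free_cons free_cons (basis_free b) andbT span_cons (span_basis b) pL andbT.
  by rewrite addvC.
have : r \in <<[:: q; p; X; Y]>>%VS.
  suff -> : <<[:: q; p; X; Y]>>%VS = fullv by rewrite memvf.
  by apply/eqP; rewrite eqEdim subvf /= dimvf /dim /= (eqP fr).
rewrite !span_cons span_nil addv0.
case/memv_addP => _ /vlineP[n ->] [s /memv_addP[_ /vlineP[m ->] [t]] + ->].
case/memv_addP => _ /vlineP[x ->] [_ /vlineP[y ->] ->] ->.
by exists x, y, m, n; rewrite [LHS]addrC; congr (_ + _); rewrite addrC.
Qed.


Lemma line_cub X : X \in L -> f X = 0.
Proof. by move=> XL; case: (LF XL XL). Qed.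
Lemma line_cub1 X Y : X \in L -> Y \in L -> f1 X Y = 0.
Proof. by move=> XL YL; case: (LF XL YL). Qed.

Lemma lineE X Y : lbasis X Y -> ((f X = 0) * (f Y = 0) * (f1 X Y = 0) * (f1 Y X = 0) *
  (f1 X X = 0) * (f1 Y Y = 0))%type.
Proof. by move=> b; rewrite !line_cub ?line_cub1 //; first [exact: lbasisL b|exact: lbasisR b]. Qed.

Lemma off_plane p : exists q, q \notin (L + <[p]>)%VS.
Proof.
have : ~~ (fullv <= L + <[p]>)%VS.
  apply/negP => /dimvS; rewrite dimvf /dim /= => le4.
  have := leq_trans le4 (dimv_add_leqif L <[p]>%VS); rewrite dL dim_vline.
  by case: eqP.
by case/subvPn => q _ ?; exists q.
Qed.

Lemma lbasis_l X : X \in L -> X != 0 -> exists Y, lbasis X Y.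
Proof.
move=> XL X0; have : ~~ (L <= <[X]>)%VS.
  by apply/negP => /dimvS; rewrite dL dim_vline X0.
by case/subvPn => Y YL ?; exists Y; apply: lbasis_free.
Qed.

(** The derivatives at [X] along [L] vanish, so two different planes through [L] tangent at [X]
    would make [X] singular. *)
Lemma smooth_at_line X p q : X \in L -> X != 0 -> p \notin L -> q \notin (L + <[p]>)%VS ->
  f1 X p = 0 -> f1 X q != 0.
Proof.
move=> XL X0 pL qL Xp; apply/eqP => Xq.
have [Y b] := lbasis_l XL X0; have [E [h _]] := fin_closure K.
have := @smooth_coords _ _ sm X Y p q E h 1 0 0 0 (lbasis_spans b pL qL).
rewrite oner_eq0 /= !scale0r !addr0 scale1r !cub1_map cub_map.
have YL := lbasisR b.
by rewrite (line_cub XL) (line_cub1 XL XL) (line_cub1 XL YL) Xp Xq rmorph0; apply.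
Qed.

Lemma closed_binary_quadratic (E : closedFieldType) (a b d : E) :
  exists x y, ((x != 0) || (y != 0)) /\ a * x ^+ 2 + b * x * y + d * y ^+ 2 = 0.
Proof.
have [->|a0] := eqVneq a 0; first by exists 1, 0; rewrite oner_eq0; split=> //; ring.
have [x xE] := @solve_monicpoly E 2 (fun i => if i is 0 then - d / a else - b / a) isT.
exists x, 1; rewrite oner_eq0 orbT; split=> //.
by rewrite xE !big_ord_recl big_ord0 /=; field.
Qed.

(** Otherwise [Z -> cub1 Z p] is zero on [L], and a geometric zero on [L] of the form
    [Z -> cub1 Z q], for [q] off the plane, is a singular point. *)
Lemma smooth_quadratic X Y p : lbasis X Y -> p \notin L ->
  f1 X p = 0 -> f1 Y p = 0 -> pl X Y p != 0.
Proof.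
move=> b pL Xp Yp; apply/eqP => XYp.
have [XL YL] := (lbasisL b, lbasisR b).
have [q qL] := off_plane p; have [E [h _]] := fin_closure K.
have [x [y [xy0 e]]] := closed_binary_quadratic (h (f1 X q)) (h (pl X Y q)) (h (f1 Y q)).
have := @smooth_coords _ _ sm X Y p q E h x y 0 0 (lbasis_spans b pL qL).
rewrite !eqxx /= !orbF !scale0r !addr0 !cubE !polarE !(cub1_map, cub_map, polar_map).
rewrite !(lineE b) Xp Yp XYp !rmorph0 => H; apply: H => //; try ring.
by rewrite -[RHS]e; ring.
Qed.

(** The hypotheses say that the residual conic of the plane [L + P] is [k (a x + b y + g)^2]. Along
    a double line the derivatives inside the plane vanish, and the derivative toward [p] is a
    quadratic form there; it has a geometric zero. *)
Lemma smooth_double_line X Y p q (E : closedFieldType) (h : {rmorphism K -> E}) (t a b g k : E) :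
  lbasis X Y -> p \notin L -> q \notin (L + <[p]>)%VS ->
  let hc := fun i j k => h (c i j k) in
  let P := t *: map_mx h p + map_mx h q in
  (a != 0) || (b != 0) ->
  cub hc P = k * g ^+ 2 ->
  cub1 hc P (map_mx h X) = k * a * g *+ 2 -> cub1 hc P (map_mx h Y) = k * b * g *+ 2 ->
  cub1 hc (map_mx h X) P = k * a ^+ 2 -> cub1 hc (map_mx h Y) P = k * b ^+ 2 ->
  polar hc (map_mx h X) (map_mx h Y) P = k * a * b *+ 2 -> False.
Proof.
move=> bXY pL qL hc P ab fP PX PY XP YP XYP.
have [XL YL] := (lbasisL bXY, lbasisR bXY).
set X' := map_mx h X in PX PY XP YP XYP *; set Y' := map_mx h Y in PX PY XP YP XYP *.
set p' := map_mx h p in P fP PX PY XP YP XYP *.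
have X0 : cub hc X' = 0 by rewrite cub_map line_cub ?rmorph0.
have Y0 : cub hc Y' = 0 by rewrite cub_map line_cub ?rmorph0.
have XY0 : cub1 hc X' Y' = 0 by rewrite cub1_map line_cub1 ?rmorph0.
have YX0 : cub1 hc Y' X' = 0 by rewrite cub1_map line_cub1 ?rmorph0.
pose ok (x y m n : E) := [|| x != 0, y != 0, m != 0 | n != 0].
have sing x y z m : ok x y (z * t + m) z ->
    let v := x *: X' + y *: Y' + z *: P + m *: p' in
    cub1 hc v X' = 0 -> cub1 hc v Y' = 0 -> cub1 hc v P = 0 -> cub1 hc v p' = 0 -> cub hc v = 0 -> False.
  move=> nz v vX vY vP vp vf.
  have := @smooth_coords _ _ sm X Y p q E h x y (z * t + m) z (lbasis_spans bXY pL qL) nz.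
  cbv zeta; rewrite -/hc -/X' -/Y' -/p'.
  have -> : x *: X' + y *: Y' + (z * t + m) *: p' + z *: map_mx h q = v.
    by apply/rowP=> i; rewrite /v /P !mxE; ring.
  rewrite vX vY vp vf => h3; apply: h3 => //.
  move: vP; rewrite /P cub1Dr cub1Zr vp mulr0 add0r //.
clearbody P; pose A := cub1 hc X' p'; pose B := polar hc X' Y' p'; pose C := cub1 hc Y' p'.
(* The double line meets [L] at [b X' - a Y']; the quantity tested is the derivative toward [p] at
   that point. *)
have [l0|ln0] := eqVneq (A * b ^+ 2 - B * a * b + C * a ^+ 2) 0.
  apply: (@sing b (- a) 0 0).
  - by rewrite /ok oppr_eq0 orbA [(b != 0) || _]orbC ab.
  - by rewrite !scale0r !addr0 !cubE ?polarE ?cub1xx ?X0 ?Y0 ?XY0 ?YX0; ring.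
  - by rewrite !scale0r !addr0 !cubE ?polarE ?cub1xx ?X0 ?Y0 ?XY0 ?YX0; ring.
  - by rewrite !scale0r !addr0 !cubE ?polarE ?XP ?YP ?XYP; ring.
  - by rewrite !scale0r !addr0 !cubE -/A -/B -/C -[RHS]l0; ring.
  - by rewrite !scale0r !addr0 !cubE ?X0 ?Y0 ?XY0 ?YX0; ring.
(* a singular point: on the double line, where the derivative in the direction [p] vanishes *)
have [x0 [y0 e0]] : exists x0 y0, a * x0 + b * y0 + g = 0.
  case: (altP (a =P 0)) ab => [-> /= b0|a0 _].
    by exists 0, (- g / b); field.
  by exists (- g / a), 0; field.
pose D := cub1 hc (x0 *: X' + y0 *: Y' + P) p'.
pose D1 := polar hc (x0 *: X' + y0 *: Y' + P) (b *: X' - a *: Y') p'.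
have [s se] : exists s, (A * b ^+ 2 - B * a * b + C * a ^+ 2) * s ^+ 2 + D1 * s + D = 0.
  have [s sE] := @solve_monicpoly E 2 (fun i => if i is 0 then - D / (A * b ^+ 2 - B * a * b + C * a ^+ 2)
    else - D1 / (A * b ^+ 2 - B * a * b + C * a ^+ 2)) isT.
  by exists s; rewrite sE !big_ord_recl big_ord0 /=; field.
pose v := (x0 + s * b) *: X' + (y0 - s * a) *: Y' + 1 *: P + 0 *: p'.
have vE : v = (x0 *: X' + y0 *: Y' + P) + s *: (b *: X' - a *: Y').
  apply/rowP=> i; rewrite !mxE; ring.
have vX : cub1 hc v X' = 0.
  rewrite /v !scale0r !addr0 scale1r !cubE ?polarE ?cub1xx ?X0 ?Y0 ?XY0 ?YX0 ?PX ?XP.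
  rewrite ?(polar_perm hc X' Y' P) XYP.
  transitivity (2%:R * k * a * (a * x0 + b * y0 + g)); first by ring.
  by rewrite e0 mulr0.
have vY : cub1 hc v Y' = 0.
  rewrite /v !scale0r !addr0 scale1r !cubE ?polarE ?cub1xx ?X0 ?Y0 ?XY0 ?YX0 ?PY ?YP.
  rewrite ?(polar_perm hc X' Y' P) XYP.
  transitivity (2%:R * k * b * (a * x0 + b * y0 + g)); first by ring.
  by rewrite e0 mulr0.
have vf : cub hc v = 0.
  rewrite /v !scale0r !addr0 scale1r !cubE ?polarE ?X0 ?Y0 ?XY0 ?YX0 ?PX ?PY ?XP ?YP ?fP ?XYP.
  transitivity (k * (a * x0 + b * y0 + g) ^+ 2); first by ring.
  by rewrite e0 expr0n mulr0.
apply: (@sing (x0 + s * b) (y0 - s * a) 1 0); first by rewrite /ok oner_eq0 !orbT.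
- by rewrite -/v vX.
- by rewrite -/v vY.
- rewrite -/v; have := cub1xx hc v; rewrite vf mul0rn {2}/v !cub1Dr !cub1Zr vX vY.
  by rewrite !mulr0 mul0r !add0r addr0 mul1r.
- rewrite -/v vE cub1Dl cub1Zl polarZm -/D -/D1.
  have -> : cub1 hc (b *: X' - a *: Y') p' = A * b ^+ 2 - B * a * b + C * a ^+ 2.
    by rewrite -scaleNr !cubE -/A -/B -/C; ring.
  by rewrite -[RHS]se; ring.
by rewrite -/v vf.
Qed.

End Line.

Lemma exists_nonroot (K : finFieldType) (P : {poly K}) : P != 0 -> (size P <= #|K|)%N ->
  exists x, P.[x] != 0.
Proof.
move=> P0 sP; case: (pickP (fun x => P.[x] != 0)) => [x ?|all0]; first by exists x.
suff : (#|K| < size P)%N by rewrite ltnNge sP.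
rewrite cardE; apply: max_poly_roots => //; last exact: enum_uniq.
by apply/allP => x _; rewrite rootE; have := all0 x => /negbFE.
Qed.

Lemma exists_sqr_neq (K : finFieldType) (a : K) : (4 <= #|K|)%N ->
  exists x, x != 0 /\ x ^+ 2 != a.
Proof.
move=> q4; pose P : {poly K} := 'X * ('X ^+ 2 - a%:P).
have sP : size P = 4%N by rewrite /P mulrC size_mulX ?size_XnsubC // -size_poly_eq0 size_XnsubC.
have [||x] := @exists_nonroot _ P; rewrite ?sP //; first by rewrite -size_poly_eq0 sP.
rewrite /P !hornerE mulf_eq0 negb_or subr_eq0 => /andP[x0 xa].
by exists x.
Qed.

(** * From one point in a split plane to the whole line *)

Section Line.
Variables (K : finFieldType) (c : 'I_4 -> 'I_4 -> 'I_4 -> K).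
Notation V := 'rV[K]_4.
Hypothesis sm : csmooth c.
Notation f := (cub c).
Notation f1 := (cub1 c).
Notation pl := (polar c).

Section OneLine.
Variable L : {vspace V}.
Hypothesis SL : surface_line c L.
Implicit Types X Y p q r : V.

Lemma notin_add p X : p \notin L -> X \in L -> p + X \notin L.
Proof. by move=> pL XL; apply: contraNN pL => /memvB/(_ XL); rewrite addrK. Qed.

Lemma notin_comb X Y p x y : lbasis L X Y -> p \notin L -> p + x *: X + y *: Y \notin L.
Proof.
move=> b pL; rewrite -addrA notin_add // memvD // memvZ //; [exact: lbasisL b|exact: lbasisR b].
Qed.

Lemma notin_neq0 p : p \notin L -> p != 0.
Proof. by apply: contraNneq => ->; exact: mem0v. Qed.

(** As [cub] vanishes on [L], no cubic terms are left: this is the affine equation of the residual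
    conic. *)
Lemma conicE X Y p x y : lbasis L X Y ->
  f (p + x *: X + y *: Y) = f p + x * f1 p X + y * f1 p Y + x ^+ 2 * f1 X p
     + x * y * pl X Y p + y ^+ 2 * f1 Y p.
Proof. by move=> b; rewrite !cubE ?polarE ?(polar_perm c X Y p) !(lineE SL b); ring. Qed.

Lemma conic1E X Y p x y : lbasis L X Y ->
  f1 (p + x *: X + y *: Y) X = f1 p X + x * f1 X p *+ 2 + y * pl X Y p.
Proof. by move=> b; rewrite !cubE ?polarE ?(polar_perm c X Y p) !(lineE SL b); ring. Qed.

Lemma conic2E X Y p x y : lbasis L X Y ->
  f1 (p + x *: X + y *: Y) Y = f1 p Y + x * pl X Y p + y * f1 Y p *+ 2.
Proof. by move=> b; rewrite !cubE ?polarE ?(polar_perm c X Y p) !(lineE SL b); ring. Qed.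

Lemma line_conicE X Y p x y Z : lbasis L X Y -> Z \in L -> f1 Z (p + x *: X + y *: Y) = f1 Z p.
Proof.
move=> b ZL; rewrite !cubE (line_cub1 SL ZL (lbasisL b)) (line_cub1 SL ZL (lbasisR b)); ring.
Qed.

(* [p] is the centre of the conic cut out by the plane [L + p], which meets [L] in [X] and [Y]; *)
(* its equation is [f p + s t (polar X Y p)] at [p + s X + t Y], so it is reducible when [f p = 0]. *)
Record center X Y p : Prop := Center {
  center_basis : lbasis L X Y; center_notin : p \notin L;
  center_qX : f1 X p = 0; center_qY : f1 Y p = 0;
  center_dX : f1 p X = 0; center_dY : f1 p Y = 0 }.

Lemma centerC X Y p : center X Y p -> center Y X p.
Proof. by case=> b pL Xp Yp pX pY; split=> //; apply: lbasisC. Qed.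

Lemma center_dir0 X Y p Z : center X Y p -> Z \in L -> f1 p Z = 0.
Proof.
move=> C /(lbasisP (center_basis C))[x [y ->]].
by rewrite cub1Dr !cub1Zr (center_dX C) (center_dY C) !mulr0 addr0.
Qed.

Lemma center_polar X Y p : center X Y p -> pl X Y p != 0.
Proof. by case=> b pL Xp Yp _ _; exact: (smooth_quadratic sm SL b pL Xp Yp). Qed.

(** The quadratic part is a nonzero multiple of [x y], so a translation along [L] removes the linear
    terms, in characteristic two as well. *)
Lemma center_ex X Y p : lbasis L X Y -> p \notin L -> f1 X p = 0 -> f1 Y p = 0 ->
  exists x y, center X Y (p + x *: X + y *: Y).
Proof.
move=> b pL Xp Yp; have k0 := smooth_quadratic sm SL b pL Xp Yp.
exists (- f1 p Y / pl X Y p), (- f1 p X / pl X Y p); split=> //.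
- exact: notin_comb.
- by rewrite (line_conicE _ _ _ b) // (lbasisL b).
- by rewrite (line_conicE _ _ _ b) // (lbasisR b).
- by rewrite conic1E // Xp; field.
- by rewrite conic2E // Yp; field.
Qed.

Lemma center_cub X Y p s t : center X Y p ->
  f (p + s *: X + t *: Y) = f p + s * t * pl X Y p.
Proof. by case=> b pL Xp Yp pX pY; rewrite conicE // Xp Yp pX pY; ring. Qed.

Lemma center_dirX X Y p s t : center X Y p -> f1 (p + s *: X + t *: Y) X = t * pl X Y p.
Proof. by case=> b pL Xp Yp pX pY; rewrite conic1E // Xp pX; ring. Qed.

Lemma center_dirY X Y p s t : center X Y p -> f1 (p + s *: X + t *: Y) Y = s * pl X Y p.
Proof. by case=> b pL Xp Yp pX pY; rewrite conic2E // Yp pY; ring. Qed.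

(* The two points of [L] on the conic of a plane correspond under an involution of [L]. *)
Lemma involution_plane X Y p q (r : K) : lbasis L X Y -> p \notin L -> q \notin (L + <[p]>)%VS ->
  f1 X p = 0 -> f1 Y p = 0 -> r != 0 -> r ^+ 2 != f1 X q / f1 Y q ->
  exists (r' : K) p', [/\ r' != 0, r' != r, r * r' = f1 X q / f1 Y q, lbasis L (X + r *: Y) (X + r' *: Y)
    & center (X + r *: Y) (X + r' *: Y) p'].
Proof.
move=> b pL qL Xp Yp r0 rn.
have [X0 Y0] := (lbasis_neq0 b, lbasis_neq0 (lbasisC b)).
have [XL YL] := (lbasisL b, lbasisR b).
have Xq := smooth_at_line sm SL XL X0 pL qL Xp.
have Yq := smooth_at_line sm SL YL Y0 pL qL Yp.
have k0 := smooth_quadratic sm SL b pL Xp Yp.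
(* In every plane spanned by [L] and a combination of [p] and [q], only [q] contributes to the outer
   coefficients of the form on [L]; the product of its two roots is therefore constant. *)
pose r' := f1 X q / (f1 Y q * r).
have r'0 : r' != 0 by rewrite mulf_neq0 // invr_eq0 mulf_neq0.
have r'r : r' != r.
  apply: contraNneq rn => e; rewrite expr2 -{1}e /r'; apply/eqP; field.
  by rewrite Yq r0.
exists r'; have rr' : r * r' = f1 X q / f1 Y q by rewrite /r'; field; rewrite Yq r0.
have bA : lbasis L (X + r *: Y) (X + r' *: Y).
  rewrite -[X in X + r *: _]scale1r -[X in X + r' *: _]scale1r; apply: (lbasis_change SL b).
  by rewrite mul1r mulr1 subr_eq0.
(* The combination of [q] and [p] at which the form of the plane vanishes on [X + r Y]. *)
pose p' := (r * pl X Y p) *: q - (f1 X q + r * pl X Y q + r ^+ 2 * f1 Y q) *: p.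
have p'L : p' \notin L.
  apply: contraNN qL => p'L; have -> : q = (r * pl X Y p)^-1 *: p' +
    ((r * pl X Y p)^-1 * (f1 X q + r * pl X Y q + r ^+ 2 * f1 Y q)) *: p.
    rewrite /p' scalerBr !scalerA mulVf ?mulf_neq0 // scale1r subrK //.
  by rewrite memv_add ?memvZ ?memv_line.
have [||x [y cp]] := center_ex bA p'L; last by exists (p' + x *: (X + r *: Y) + y *: (X + r' *: Y)).
- by rewrite /p' -scaleNr !cubE ?polarE ?Xp ?Yp; ring.
- rewrite /p' -scaleNr !cubE ?polarE ?Xp ?Yp /r'; field.
  by rewrite Yq r0.
Qed.

Section Gen.
Variable S : V -> Prop.
Hypothesis HS : sigma_closed c S.

Lemma gen_tangent Z r : Z \in L -> S Z -> f r = 0 -> f1 Z r = 0 -> f1 r Z != 0 -> S r.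
Proof. by move=> ZL SZ fr Zr rZ; exact: (cl_tangent HS SZ fr Zr rZ). Qed.

Lemma gen_dir r Z s : Z \in L -> s != 0 -> S r -> S (r + s *: Z) -> f1 r Z != 0 -> S Z.
Proof.
move=> ZL s0 Sr Sr' rZ; have [_ fr] := cl_on HS Sr.
have eZ : Z = (- s^-1) *: r + s^-1 *: (r + s *: Z).
  by apply/rowP=> i; rewrite !mxE; field.
rewrite eZ; apply: (cl_secant HS) => //; rewrite ?oppr_eq0 ?invr_eq0 //.
  by rewrite -eZ (line_cub SL ZL).
by rewrite !cubE cub1xx fr mul0rn add0r mulf_neq0.
Qed.

Lemma gen_pt r Z s : Z \in L -> s != 0 -> S r -> S Z -> f (r + s *: Z) = 0 -> f1 r Z != 0 ->
  S (r + s *: Z).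
Proof.
move=> ZL s0 Sr SZ fr' rZ; rewrite -[r]scale1r; apply: (cl_secant HS) => //.
  exact: oner_neq0.
by rewrite scale1r.
Qed.

(** The plane is tangent to the surface at [X], so every line of it through [X] is a tangent line
    and leads to the second point of the conic on it. *)
Lemma gen_conic X Y p s t : center X Y p -> S X -> t != 0 -> f (p + s *: X + t *: Y) = 0 ->
  S (p + s *: X + t *: Y).
Proof.
move=> C SX t0 fr; have b := center_basis C; have XL := lbasisL b.
apply: (gen_tangent XL) => //; first by rewrite (line_conicE _ _ _ b) // (center_qX C).
by rewrite (center_dirX _ _ C) mulf_neq0 // (center_polar C).
Qed.

Hypothesis q4 : (4 <= #|K|)%N.

(** All points of the conic off [L] come from [X]. A line through [Z] that meets the conic in two of
    them gives [Z] as third point; lines through [Y] have only one such point. *)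
Lemma gen_smooth X Y p Z : center X Y p -> f p != 0 -> S X -> Z \in L -> Z \notin <[Y]>%VS -> S Z.
Proof.
move=> C fp SX ZL ZY; have b := center_basis C; have k0 := center_polar C.
have [x [y eZ]] := lbasisP b ZL.
have x0 : x != 0.
  by apply: contraNneq ZY => x0; rewrite eZ x0 scale0r add0r memvZ // memv_line.
have [y0|y0] := eqVneq y 0; first by rewrite eZ y0 scale0r addr0; apply: (cl_scale HS).
(* The lines through [Z] pair the parameters [s] and [s'] of the conic; the excluded square is the
   case of tangency. *)
have [s [s0 sn]] := exists_sqr_neq (x * f p / (y * pl X Y p)) q4.
pose s' := x * f p / (y * pl X Y p * s).
have s'0 : s' != 0 by rewrite !mulf_neq0 // invr_eq0 !mulf_neq0.
have s's : s' - s != 0.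
  apply: contraNneq sn => /eqP; rewrite subr_eq0 => /eqP e.
  by rewrite expr2 -{1}e /s'; apply/eqP; field; rewrite k0 y0 s0.
pose t u := - f p / (pl X Y p * u).
have onC u : u != 0 -> S (p + u *: X + t u *: Y).
  move=> u0; apply: (gen_conic C SX); first by rewrite mulf_neq0 ?oppr_eq0 // invr_eq0 mulf_neq0.
  by rewrite (center_cub _ _ C) /t; field; rewrite k0 u0.
apply: (@gen_dir (p + s *: X + t s *: Y) Z ((s' - s) / x)) => //.
- by rewrite mulf_neq0 // invr_eq0.
- exact: onC.
- rewrite (_ : _ + _ *: Z = p + s' *: X + t s' *: Y); first exact: onC.
  have e : t s' = t s + (s' - s) / x * y by rewrite /t /s'; field; rewrite fp k0 x0 y0 s0.
  by rewrite e eZ; apply/rowP=> i; rewrite !mxE; field.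
rewrite eZ cub1Dr !cub1Zr (center_dirX _ _ C) (center_dirY _ _ C).
have -> : x * (t s * pl X Y p) + y * (s * pl X Y p) = y * pl X Y p / s * (s ^+ 2 - x * f p / (y * pl X Y p)).
  by rewrite /t; field; rewrite k0 s0 y0.
by rewrite mulf_neq0 ?subr_eq0 // mulf_neq0 ?invr_eq0 // mulf_neq0.
Qed.

(** Each of [X] and [Y] generates the side through the other one, and a line through [Z] meets both
    sides. *)
Lemma gen_triangle X Y p Z : center X Y p -> f p = 0 -> S X -> S Y -> Z \in L -> Z != 0 -> S Z.
Proof.
move=> C fp SX SY ZL Z0; have b := center_basis C; have k0 := center_polar C.
have [x [y eZ]] := lbasisP b ZL.
have [y0|y0] := eqVneq y 0.
  rewrite eZ y0 scale0r addr0; apply: (cl_scale HS) => //.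
  by apply: contraNneq Z0 => x0; rewrite eZ x0 y0 !scale0r addr0.
have [x0|x0] := eqVneq x 0; first by rewrite eZ x0 scale0r add0r; apply: (cl_scale HS).
have Sx : S (p + (- x) *: X).
  have <- : p + 0 *: Y + (- x) *: X = p + (- x) *: X by rewrite scale0r addr0.
  apply: (gen_conic (centerC C) SY); first by rewrite oppr_eq0.
  by rewrite (center_cub _ _ (centerC C)) fp; ring.
apply: (@gen_dir (p + (- x) *: X) Z 1) => //; first exact: oner_neq0.
  have -> : p + (- x) *: X + 1 *: Z = p + 0 *: X + y *: Y by rewrite eZ; apply/rowP=> i; rewrite !mxE; ring.
  by apply: (gen_conic C SX) => //; rewrite (center_cub _ _ C) fp; ring.
have -> : p + (- x) *: X = p + (- x) *: X + 0 *: Y by rewrite scale0r addr0.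
rewrite eZ cub1Dr !cub1Zr (center_dirX _ _ C) (center_dirY _ _ C) mul0r mulr0 add0r.
by rewrite !mulf_neq0 ?oppr_eq0.
Qed.
End Gen.
End OneLine.

Lemma triangle_line L X Y p : surface_line c L -> center L X Y p -> f p = 0 ->
  [/\ surface_line c (<[p]> + <[Y]>)%VS, lbasis (<[p]> + <[Y]>)%VS p Y & X \notin (<[p]> + <[Y]>)%VS].
Proof.
move=> SL C fp; have b := center_basis C; have pL := center_notin C.
have fr : free [:: p; Y].
  rewrite free_cons seq1_free span_seq1 (lbasis_neq0 (lbasisC b)) andbT.
  by apply: contraNN pL => /vlineP[k ->]; rewrite memvZ // (lbasisR b).
have bpY : lbasis (<[p]> + <[Y]>)%VS p Y by exact: pair_basis.
split=> //.
  split; first exact: dim_pair.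
  move=> r r' /(lbasisP bpY)[x [y ->]] /(lbasisP bpY)[x' [y' ->]].
  rewrite !cubE !polarE !cub1xx !(lineE SL b) fp (center_dY C) (center_qY C).
  by split; ring.
apply/negP => /(lbasisP bpY)[x [y e]].
have [x0|x0] := eqVneq x 0.
  have := @lbasis_comb _ _ _ _ (1) (- y) b; rewrite scale1r scaleNr e x0 scale0r add0r subrr.
  by case=> // /eqP; rewrite oner_eq0.
case/negP: pL; have -> : p = x^-1 *: (X - y *: Y).
  by rewrite e addrK scalerA mulVf // scale1r.
by rewrite memvZ // memvB ?memvZ ?(lbasisL b) ?(lbasisR b).
Qed.

Section Span.
Variable S : V -> Prop.
Hypothesis HS : sigma_closed c S.
Hypothesis q4 : (4 <= #|K|)%N.
Variable L : {vspace V}.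
Hypothesis SL : surface_line c L.
Implicit Types X Y p q r : V.

(** From [X] come the points [p + t Y] of the side [p Y]. The involution on that side gives another
    split plane through it with two such points, and these generate [Y]. *)
Lemma gen_vertex X Y p : center L X Y p -> f p = 0 -> S X -> S Y.
Proof.
move=> C fp SX; have b := center_basis C; have pL := center_notin C.
have [SL' bpY XL'] := triangle_line SL C fp.
have k0 := center_polar SL C.
have [q qL] := off_plane SL p.
have qL' : q \notin (<[p]> + <[Y]> + <[X]>)%VS.
  apply: contraNN qL; rewrite -(span_basis b) span_cons span_seq1.
  by rewrite -addvA addvC [(<[Y]> + _)%VS]addvC.
have [r [r0 rn]] := exists_sqr_neq (f1 p q / f1 Y q) q4.
have [r' [p' [r'0 r'r _ bA CA]]] := involution_plane SL' bpY XL' qL' (center_dX C) (line_cub1 SL (lbasisR b) (lbasisL b)) r0 rn.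
have Sr t : t != 0 -> S (p + t *: Y).
  move=> t0; have -> : p + t *: Y = p + 0 *: X + t *: Y by rewrite scale0r addr0.
  by apply: (gen_conic SL HS C SX t0); rewrite (center_cub SL _ _ C) fp; ring.
have YL' := lbasisR bpY; have Y0 := lbasis_neq0 (lbasisC bpY).
have [p'0|p'n0] := eqVneq (f p') 0.
  exact: (gen_triangle SL' HS CA p'0 (Sr _ r0) (Sr _ r'0) YL' Y0).
apply: (gen_smooth SL' HS q4 CA p'n0 (Sr _ r0) YL').
apply/negP => /vlineP[k e].
have : k *: p + (k * r' - 1) *: Y = 0.
  by rewrite scalerBl scale1r -scalerA addrA -scalerDr -e subrr.
case/(lbasis_comb bpY) => -> /eqP; rewrite mul0r sub0r oppr_eq0 oner_eq0 //.
Qed.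

(** Only [Y] escapes [gen_smooth]; a second split plane, supplied by the involution, reaches it. *)
Lemma gen_line_split X Y p Z : center L X Y p -> S X -> Z \in L -> Z != 0 -> S Z.
Proof.
move=> C SX ZL Z0; have b := center_basis C; have pL := center_notin C.
have k0 := center_polar SL C.
have [p0|pn0] := eqVneq (f p) 0.
  exact: (gen_triangle SL HS C p0 SX (gen_vertex C p0 SX) ZL Z0).
have [ZY|] := boolP (Z \in <[Y]>%VS); last exact: (gen_smooth SL HS q4 C pn0 SX).
suff SY : S Y.
  case/vlineP: ZY => k e; rewrite e; apply: (cl_scale HS) => //.
  by apply: contraNneq Z0 => k0'; rewrite e k0' scale0r.
have [q qL] := off_plane SL p.
have [r [r0 rn]] := exists_sqr_neq (f1 X q / f1 Y q) q4.
have [r' [p' [r'0 r'r _ bA CA]]] := involution_plane SL b pL qL (center_qX C) (center_qY C) r0 rn.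
have SA t : S (X + t *: Y).
  apply: (gen_smooth SL HS q4 C pn0 SX).
    by rewrite memvD ?memvZ ?(lbasisL b) ?(lbasisR b).
  apply/negP => /vlineP[k e]; have : 1 *: X + (t - k) *: Y = 0.
    by rewrite scale1r scalerBl addrA e subrr.
  by case/(lbasis_comb b) => /eqP; rewrite oner_eq0.
have YL := lbasisR b; have Y0 := lbasis_neq0 (lbasisC b).
have [p'0|p'n0] := eqVneq (f p') 0.
  exact: (gen_triangle SL HS CA p'0 (SA _) (SA _) YL Y0).
apply: (gen_smooth SL HS q4 CA p'n0 (SA _) YL).
apply/negP => /vlineP[k e]; have : k *: X + (k * r' - 1) *: Y = 0.
  by rewrite scalerBl scale1r -scalerA addrA -scalerDr -e subrr.
by case/(lbasis_comb b) => -> /eqP; rewrite mul0r sub0r oppr_eq0 oner_eq0.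
Qed.
End Span.
End Line.

(** * Points of split and parabolic planes, once the line is generated *)

Section Cover.
Variables (K : finFieldType) (c : 'I_4 -> 'I_4 -> 'I_4 -> K).
Notation V := 'rV[K]_4.
Hypothesis sm : csmooth c.
Notation f := (cub c).
Notation f1 := (cub1 c).
Notation pl := (polar c).
Variable L : {vspace V}.
Hypothesis SL : surface_line c L.
Variable S : V -> Prop.
Hypothesis HS : sigma_closed c S.
Hypothesis HL : forall Z, Z \in L -> Z != 0 -> S Z.
Implicit Types X Y Z p q r : V.

Lemma sub_cub r r' : f r = 0 -> f r' = 0 -> f (r' - r) = 0 -> f1 r r' = f1 r' r.
Proof.
move=> fr fr'; rewrite -scaleN1r !cubE fr fr' => h.
by apply/eqP; rewrite -subr_eq0 -[X in _ == X]h; apply/eqP; ring.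
Qed.

Lemma cover_tangent X r : X \in L -> X != 0 -> f r = 0 -> f1 X r = 0 -> f1 r X != 0 -> S r.
Proof. by move=> XL X0 fr Xr rX; exact: (gen_tangent HS XL (HL XL X0)). Qed.

(* The conic of the plane [L + r] is singular at the point [X] of [L]. *)
Definition eckardt X r := [/\ X \in L, X != 0, r \notin L, f r = 0 & f1 X r = 0]
   /\ (f1 r X = 0 /\ forall Y, Y \in L -> pl X Y r = 0).

(** The conic is a pair of lines through [X], with equation [y f1 r B + y^2 f1 B r]; were they
    equal, it would be a double line. *)
Lemma double_line_free X B r : eckardt X r -> lbasis L X B -> f1 B r != 0 /\ f1 r B != 0.
Proof.
move=> [[XL X0 rL fr Xr] [rX par]] b; have BL := lbasisR b.
have Br : f1 B r != 0.
  apply/eqP=> Br; have := smooth_quadratic sm SL b rL Xr Br.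
  by rewrite par ?eqxx.
split=> //; apply/eqP => rB.
have [q qL] := off_plane SL r.
have pL : q \notin L by apply: contraNN qL; apply: (subvP (addvSl _ _)).
have rqL : r \notin (L + <[q]>)%VS.
  apply: contraNN qL => /memv_addP[u uL [v /vlineP[k ->] e]].
  have k0 : k != 0 by apply: contraNneq rL => k0; rewrite e k0 scale0r addr0.
  have -> : q = - k^-1 *: u + k^-1 *: r by rewrite e; apply/rowP=> i; rewrite !mxE; field.
  by rewrite memv_add ?memvZ ?memv_line.
have [E [h _]] := fin_closure K.
have := @smooth_double_line _ _ sm L SL X B q r E h 0 0 1 0 (h (f1 B r)) b pL rqL.
cbv zeta; rewrite scale0r add0r !(cub1_map, cub_map, polar_map) rX rB fr Xr par // !rmorph0.
rewrite oner_eq0 orbT; apply=> //; ring.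
Qed.

(** A secant through [B] leads from the line [r X] to the other line of the plane through [X], and a
    secant through a suitable point [Z] of [L] leads back to [r]. *)
Lemma eckardt_spread X r x : eckardt X r -> S (r + x *: X) -> S r.
Proof.
move=> ek Sr1; have [[XL X0 rL fr Xr] [rX par]] := ek.
have [B b] := lbasis_l SL XL X0; have BL := lbasisR b.
have [Br rB] := double_line_free ek b.
pose e := f1 r B / f1 B r; pose Z := e *: B - x *: X.
have e0 : e != 0 by rewrite mulf_neq0 ?invr_eq0.
have B0 := lbasis_neq0 (lbasisC b).
have ZL : Z \in L by rewrite memvB ?memvZ.
have Z0 : Z != 0.
  apply: contraNneq e0 => Z0; have : (- x) *: X + e *: B = 0 by rewrite -Z0 scaleNr addrC.
  by case/(lbasis_comb b) => _ ->.
have S2 : S (r + x *: X + (- e) *: B).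
  apply: (gen_pt HS BL) => //; first by rewrite oppr_eq0.
  - exact: HL.
  - by rewrite (conicE SL _ _ _ b) fr rX Xr par // /e; field.
  - rewrite -[r + _]addr0 -(scale0r B) (conic2E SL _ _ _ b) par //.
    by rewrite mulr0 mul0r mul0rn !addr0.
have eZ : r = r + x *: X + (- e) *: B + 1 *: Z.
  by apply/rowP=> i; rewrite !mxE; ring.
rewrite eZ; apply: (gen_pt HS ZL) => //; rewrite -?eZ //; first exact: oner_neq0.
  exact: HL.
rewrite /Z -scaleNr cub1Dr !cub1Zr (conic2E SL _ _ _ b) (conic1E SL _ _ _ b) rX Xr par //.
have -> : e * (f1 r B + x * 0 + - e * f1 B r *+ 2) + - x * (0 + x * 0 *+ 2 + - e * 0) = - (f1 r B * e).
  by rewrite /e; field.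
by rewrite oppr_eq0 mulf_neq0.
Qed.

(** By [eckardt_spread] it is enough to reach one point of the line [r X]. The tangent planes at [Y]
    and at the other point [Y'] of the line [Y X] are used; the last hypothesis serves the case
    where a line of the surface gets in the way. *)
Lemma eckardt_cover X r Y : eckardt X r -> S Y -> f1 Y X != 0 -> f1 X Y != 0 ->
  (forall a, exists2 n, n != 0 & n != a /\
     forall R, R - (Y + n *: r) \in L -> f R = 0 -> f1 R X != 0 -> S R) -> S r.
Proof.
move=> ek SY YX XY cov; have [[XL X0 rL fr Xr] [rX par]] := ek.
have [_ fY] := cl_on HS SY.
have fl x : f (r + x *: X) = 0 by rewrite !cubE fr rX Xr (line_cub SL XL); ring.
pose y := f1 Y X / f1 X Y; have [Y' Y'E] : exists Y', Y' = Y + (- y) *: X by eexists.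
have y0 : y != 0 by rewrite mulf_neq0 ?invr_eq0.
have fY' : f Y' = 0 by rewrite Y'E !cubE fY (line_cub SL XL) /y; field.
have Y'X : f1 Y' X = - f1 Y X.
  by rewrite Y'E !cubE !polarE cub1xx (line_cub SL XL) /y; field.
have SY' : S Y'.
  rewrite Y'E; apply: (gen_pt HS XL); rewrite ?oppr_eq0 -?Y'E //.
  exact: HL.
have tan W : S W -> f1 W X != 0 -> let w := - f1 W r / f1 W X in
   f1 (r + w *: X) W != 0 -> S r.
  move=> SW WX w wn; apply: (@eckardt_spread X r w) => //.
  apply: (cl_tangent HS SW) => //.
  by rewrite !cubE /w; field.
have Y'X0 : f1 Y' X != 0 by rewrite Y'X oppr_eq0.
pose w := - f1 Y' r / f1 Y' X; have [Q QE] : exists Q, Q = r + w *: X by eexists.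
(* [Q] is the point of the line [r X] in the tangent plane at [Y']. The tangent operation reaches
   that line unless the line [Y' Q] is contained in the surface. *)
have [QY'|] := eqVneq (f1 Q Y') 0; last by rewrite QE; exact: (tan _ SY').
have Y'Q : f1 Y' Q = 0 by rewrite QE !cubE /w; field.
have fQ : f Q = 0 by rewrite QE fl.
have QX : f1 Q X = 0 by rewrite QE !cubE !polarE cub1xx (line_cub SL XL) rX Xr; ring.
have [n n0 [na nc]] := cov (- f1 Y' X / pl Y' Q X).
pose R := Y' + n *: Q.
have fR : f R = 0 by rewrite /R !cubE fY' Y'Q QY' fQ; ring.
have RX : f1 R X != 0.
  rewrite /R !cubE QX mulr0 addr0; apply: contraNneq na => h.
  have P0 : pl Y' Q X != 0.
    by apply: contraNneq Y'X0 => P0; move: h; rewrite P0 mulr0 addr0 => ->.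
  by apply/eqP; apply: (mulIf P0); rewrite divfK //; apply/eqP; rewrite -addr_eq0 addrC h.
have SR : S R.
  apply: nc => //; rewrite (_ : _ - _ = (- y + n * w) *: X) ?memvZ //.
  by rewrite /R Y'E QE; apply/rowP=> i; rewrite !mxE; ring.
(* The secant through [Y] and the generated point [R] of the line [Y' Q] meets the line [r X] in
   [T]. *)
pose T := n *: Q + (- y) *: X.
have TE : R - Y = T by rewrite /R /T Y'E; apply/rowP=> i; rewrite !mxE; ring.
have fT : f T = 0.
  have -> : T = n *: (r + (w - y / n) *: X) by rewrite /T QE; apply/rowP=> i; rewrite !mxE; field.
  by rewrite cubZ fl mulr0.
have RY : f1 R Y != 0.
  have -> : f1 R Y = y * f1 R X.
    have -> : Y = Y' + y *: X by rewrite Y'E scaleNr subrK.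
    rewrite cub1Dr cub1Zr (_ : f1 R Y' = 0) ?add0r //.
    by rewrite /R !cubE !polarE !cub1xx fY' Y'Q QY'; ring.
  by rewrite mulf_neq0.
have ST : S T.
  have -> : T = (-1) *: Y + 1 *: R by rewrite -TE scale1r scaleN1r addrC.
  apply: (cl_secant HS) => //; rewrite ?oppr_eq0 ?oner_eq0 //.
    by rewrite scale1r scaleN1r addrC TE.
  by rewrite (sub_cub fY fR) // TE.
apply: (@eckardt_spread X r (w - y / n)) => //.
have -> : r + (w - y / n) *: X = n^-1 *: T by rewrite /T QE; apply/rowP=> i; rewrite !mxE; field.
by apply: (cl_scale HS) => //; rewrite invr_eq0.
Qed.

Lemma cover_split X Y Z r : lbasis L X Y -> f r = 0 -> f1 X r = 0 -> f1 Y r = 0 ->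
  Z \in L -> f1 r Z != 0 -> S r.
Proof.
move=> b fr Xr Yr ZL rZ; have [rX|] := eqVneq (f1 r X) 0; last first.
  exact: (cover_tangent (lbasisL b) (lbasis_neq0 b)).
have [rY|] := eqVneq (f1 r Y) 0; last first.
  exact: (cover_tangent (lbasisR b) (lbasis_neq0 (lbasisC b))).
by have [x [y e]] := lbasisP b ZL; move: rZ; rewrite e cub1Dr !cub1Zr rX rY !mulr0 addr0 eqxx.
Qed.

Lemma cover_center X Y p s t : center c L X Y p -> (s != 0) || (t != 0) ->
  f (p + s *: X + t *: Y) = 0 -> S (p + s *: X + t *: Y).
Proof.
move=> C st fr; have b := center_basis C; case/orP: st => ne.
  rewrite addrAC; apply: (gen_conic sm SL HS (centerC C)) => //; last by rewrite addrAC.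
  exact: HL (lbasisR b) (lbasis_neq0 (lbasisC b)).
apply: (gen_conic sm SL HS C) => //; exact: HL (lbasisL b) (lbasis_neq0 b).
Qed.

Hypothesis q8 : (8 <= #|K|)%N.

Lemma point_off_tangent A B p X : center c L A B p -> X \in L -> f1 X p != 0 ->
  exists s t, [/\ f (p + s *: A + t *: B) = 0, (s != 0) || (t != 0) & f1 (p + s *: A + t *: B) X != 0].
Proof.
move=> C XL Xp; have b := center_basis C; have [a [a' eX]] := lbasisP b XL.
have k0 := center_polar sm SL C.
have [a0 a'0] : a != 0 /\ a' != 0.
  by split; apply: contraNneq Xp => e; rewrite eX e !cubE (center_qX C) (center_qY C) ?polarE; apply/eqP; ring.
have dX s t : f1 (p + s *: A + t *: B) X = pl A B p * (a * t + a' * s).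
  by rewrite eX cub1Dr !cub1Zr (center_dirX SL _ _ C) (center_dirY SL _ _ C); ring.
have [p0|p0] := eqVneq (f p) 0.
  exists 1, 0; rewrite dX (center_cub SL _ _ C) p0 oner_eq0; split=> //; first by ring.
  by rewrite mulr0 add0r mulr1 mulf_neq0.
have [s [s0 sn]] := exists_sqr_neq (a * f p / (a' * pl A B p)) (ltac:(lia) : (4 <= #|K|)%N).
exists s, (- f p / (pl A B p * s)); rewrite s0 dX (center_cub SL _ _ C); split=> //.
  by field; rewrite ?k0 ?s0.
have -> : a * (- f p / (pl A B p * s)) + a' * s = a' / s * (s ^+ 2 - a * f p / (a' * pl A B p)).
  by field; rewrite k0 a'0 s0.
by rewrite !mulf_neq0 ?invr_eq0 // subr_eq0.
Qed.

(** The involution defined by the given split plane produces the further split planes that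
    [eckardt_cover] asks for, indexed by a root [A + w B]. *)
Lemma eckardt_cover_split A B p X r : center c L A B p -> eckardt X r -> S r.
Proof.
move=> C ek; have [[XL X0 rL fr Xr] [rX par]] := ek; have b := center_basis C.
have pL := center_notin C; have k0 := center_polar sm SL C.
have rpL : r \notin (L + <[p]>)%VS.
  apply: contraNN k0 => /memv_addP[u uL [v /vlineP[k ->] e]].
  have k1 : k != 0 by apply: contraNneq rL => k1; rewrite e k1 scale0r addr0.
  have Y0 Y : Y \in L -> pl A B r = k * pl A B p.
    move=> YL; rewrite e !cubE; have [x [y ->]] := lbasisP b uL.
    by rewrite !cubE !polarE !(lineE SL b); ring.
  have [a [a' eX]] := lbasisP b XL.
  have := par _ (lbasisL b); have := par _ (lbasisR b).
  rewrite eX !cubE !polarE.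
  have lA : f1 A r = 0.
    by rewrite e cub1Dr cub1Zr (center_qX C) (line_cub1 SL (lbasisL b) uL); ring.
  have lB : f1 B r = 0.
    by rewrite e cub1Dr cub1Zr (center_qY C) (line_cub1 SL (lbasisR b) uL); ring.
  rewrite lA lB !(polar_perm c A B r) (Y0 A (lbasisL b)) !mul0rn !mulr0 ?addr0 ?add0r.
  move=> /eqP h1 /eqP h2; move: h1 h2; rewrite !mulf_eq0 (negPf k1) /= => /orP[/eqP a0|//].
  case/orP=> [/eqP a'0|//]; by move: X0; rewrite eX a0 a'0 !scale0r addr0 eqxx.
have Xp : f1 X p != 0.
  apply: contraTneq isT => Xp; have := smooth_at_line sm SL XL X0 pL rpL Xp.
  by rewrite Xr eqxx.
have [s [t [fY st YX]]] := point_off_tangent C XL Xp.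
set Y := p + _ + _ in fY YX.
have SY : S Y by exact: cover_center.
apply: (eckardt_cover ek SY YX); first by rewrite (line_conicE SL _ _ _ b).
move=> n0; pose c0 := f1 A r; pose c1 := pl A B r; pose c2 := f1 B r; pose k := pl A B p.
have [a [a' eX]] := lbasisP b XL.
have [A0 B0] := (lbasis_neq0 b, lbasis_neq0 (lbasisC b)).
have Ar : c0 != 0 by exact: (smooth_at_line sm SL (lbasisL b) A0 pL rpL (center_qX C)).
have Br : c2 != 0 by exact: (smooth_at_line sm SL (lbasisR b) B0 pL rpL (center_qY C)).
have a0 : a != 0.
  by apply: contraNneq Xp => e; rewrite eX e scale0r add0r cub1Zl (center_qY C) mulr0.
have c1E : c1 = - 2%:R * (a' / a) * c2.
  have := par _ (lbasisR b); rewrite eX !cubE polarE -/c1 -/c2 => h.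
  by apply: (mulfI a0); apply/eqP; rewrite -subr_eq0 -[X in _ == X]h; apply/eqP; field.
have c0E : c0 = (a' / a) ^+ 2 * c2.
  have := Xr; rewrite eX !cubE -/c0 -/c1 -/c2 c1E => h.
  have a20 : a ^+ 2 != 0 by rewrite expf_neq0.
  by apply: (mulfI a20); apply/eqP; rewrite -subr_eq0 -[X in _ == X]h; apply/eqP; field.
(* [P1] excludes [w = 0], the fixed points of the involution and the point [X]; [P2] excludes the
   plane with parameter [n0]. The total degree is at most 6, below q. *)
pose P1 : {poly K} := 'X * ('X ^+ 2 - (c0 / c2)%:P) * ('X - (a' / a)%:P).
pose P2 : {poly K} := Poly [:: n0 * c0; k + n0 * c1; n0 * c2].
have sX2 : size ('X ^+ 2 - (c0 / c2)%:P) = 3%N by rewrite size_XnsubC.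
have P10 : P1 != 0.
  by rewrite /P1 !mulf_neq0 ?polyX_eq0 ?polyXsubC_eq0 // -size_poly_eq0 sX2.
have P20 : P2 != 0.
  apply/eqP => /(congr1 (fun z : {poly K} => (z`_0, z`_1))); rewrite !coef_Poly !coef0 /= => -[/eqP].
  rewrite mulf_eq0 (negPf Ar) orbF => /eqP-> /eqP; by rewrite mul0r addr0 (negPf k0).
have [||w] := @exists_nonroot _ (P1 * P2); first exact: mulf_neq0.
- have s12 : (size ('X * ('X ^+ 2 - (c0 / c2)%:P) : {poly K})%R <= 4)%N.
    by apply: leq_trans (size_polyMleq _ _) _; rewrite size_polyX sX2.
  have s1 : (size P1 <= 5)%N.
    by apply: leq_trans (size_polyMleq _ _) _; rewrite size_XsubC addn2.
  have s2 : (size P2 <= 3)%N by exact: size_Poly.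
  apply: leq_trans q8; apply: leq_trans (size_polyMleq _ _) _.
  by move: s1 s2; move: (size P1) (size P2) => a1 a2; clear; lia.
rewrite hornerM [P2.[w]]horner_Poly /P1 !hornerE /= mul0r add0r !mulf_eq0 !negb_or !subr_eq0.
move=> /andP[/andP[/andP[w0 wc] wa] wn].
have [w' [p' [w'0 w'w ww' bA _]]] := involution_plane sm SL b pL rpL (center_qX C) (center_qY C) w0 wc.
pose D := c0 + w * c1 + w ^+ 2 * c2.
have D0 : D != 0.
  have -> : D = c2 * (w - a' / a) ^+ 2 by rewrite /D c1E c0E; ring.
  by rewrite mulf_neq0 // expf_neq0 // subr_eq0.
have w'E : w' = c0 / c2 / w by rewrite -ww' mulrAC mulfV // mul1r.
exists (- w * k / D); first by rewrite !mulf_neq0 ?oppr_eq0 ?invr_eq0.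
split.
  apply: contraNneq wn => e; rewrite -e; apply/eqP; rewrite /D; field.
  by move: D0; rewrite /D mulrC [_ ^+ 2 * _]mulrC.
move=> R Re fR RX.
have inL Z : Z \in L -> f1 Z R = f1 Z p - w * k / D * f1 Z r.
  move=> ZL; have -> : R = (R - (Y + (- w * k / D) *: r)) + (Y + (- w * k / D) *: r) by rewrite subrK.
  by rewrite cub1Dr (line_cub1 SL ZL Re) add0r cub1Dr cub1Zr (line_conicE SL _ _ _ b) // ; ring.
apply: (cover_split bA fR _ _ XL RX); rewrite inL ?(lbasisL bA) ?(lbasisR bA) // !cubE.
  by rewrite (center_qX C) (center_qY C) -/c0 -/c1 -/c2 -/k /D; field; move: D0.
rewrite (center_qX C) (center_qY C) -/c0 -/c1 -/c2 -/k w'E /D; field.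
by rewrite Br w0 D0.
Qed.
End Cover.

(** * Counting by reflection *)

Lemma memv_diff (K : fieldType) (V : vectType K) (L : {vspace V}) p v w :
  v - p \in L -> w - p \in L -> w - v \in L.
Proof.
move=> vp wp; have -> : w - v = (w - p) - (v - p) by rewrite opprB addrA subrK.
exact: memvB.
Qed.

Lemma card_units (K : finFieldType) : #|K| = (#|[set s : K | s != 0%R]| + 1)%N.
Proof.
rewrite -(cardsC [set s : K | s != 0%R]); congr (_ + _)%N.
by rewrite -(cards1 (0%R : K)); apply: eq_card => s; rewrite !inE negbK.
Qed.

Lemma card_pairs (T U : finType) (P : T -> pred U) :
  (#|[set u : T * U | P u.1 u.2]| = \sum_t #|[set v | P t v]|)%N.
Proof.
rewrite -sum1_card (eq_bigl (fun u : T * U => P u.1 u.2)) => [|u]; last by rewrite inE.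
rewrite -(pair_big_dep xpredT P (fun _ _ => 1%N)) /=; apply: eq_bigr => t _.
by rewrite sum1_card; apply: eq_card => v; rewrite inE.
Qed.

Section Counting.
Variables (K : finFieldType) (c : 'I_4 -> 'I_4 -> 'I_4 -> K).
Notation V := 'rV[K]_4.
Hypothesis sm : csmooth c.
Notation f := (cub c).
Notation f1 := (cub1 c).
Notation pl := (polar c).
Variable L : {vspace V}.
Hypothesis SL : surface_line c L.
Variables (S : V -> Prop) (Sb : pred V).
Hypothesis SbP : forall v, reflect (S v) (Sb v).
Hypothesis HS : sigma_closed c S.
Implicit Types X Y Z p q r v : V.

Lemma planes_off Q e n : e \notin (L + <[Q]>)%VS -> e + n *: Q \notin (L + <[Q]>)%VS.
Proof.
move=> eL; apply: contraNN eL => h; rewrite -[e](addrK (n *: Q)).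
by rewrite memvB // (subvP (addvSr _ _)) // memvZ // memv_line.
Qed.

Lemma notin_sum Q e : e \notin (L + <[Q]>)%VS -> e \notin L.
Proof. by apply: contraNN; apply: (subvP (addvSl _ _)). Qed.

(** Points of one plane, normalized by the coefficient of [e]. Those in the tangent plane at [Q] are
    left out, since the line joining them to [Q] has no proper third point. *)
Definition in_pts Q e n := [set v | [&& v - (e + n *: Q) \in L, f v == 0, f1 Q v != 0 & Sb v]].
Definition out_pts Q e n := [set v | [&& v - (e + n *: Q) \in L, f v == 0, f1 Q v != 0 & ~~ Sb v]].

(* For [Q] out of [S], the line through [Q] and a point of [S] meets the surface again out of [S]. *)
Lemma reflection_count Q e : Q \notin L -> e \notin (L + <[Q]>)%VS -> f Q = 0 -> ~ S Q ->
  (\sum_n #|in_pts Q e n| <= \sum_n #|out_pts Q e n|)%N.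
Proof.
move=> QL eL fQ nQ; rewrite -!card_pairs.
set I := [set u | _]; set O := [set u | _].
(* [t v] is the third point on the line through [Q] and [v]; it lies in the plane with parameter
   [n + s v], and [t] is an involution. When [s v = 0] the line is tangent at [v]. *)
pose s v := - (f1 v Q / f1 Q v); pose t v := v + s v *: Q.
have Qt v : f1 Q (t v) = f1 Q v by rewrite /t cub1Dr cub1Zr cub1xx fQ mul0rn mulr0 addr0.
have st v : f1 Q v != 0 -> s (t v) = - s v.
  move=> Qv; rewrite {1}/s Qt /t !cubE !polarE cub1xx fQ /s.
  by field.
pose phi (u : K * V) := (u.1 + s u.2, t u.2).
have inj : {in I &, injective phi}.
  have K1 u : u \in I -> (fun w : K * V => (w.1 + s w.2, t w.2)) (phi u) = u.
    rewrite inE; case: u => n v /= /and4P[_ _ Qv _].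
    by rewrite st // addrK /t -/(t v) st // scaleNr addrK.
  by move=> u w /K1 eu /K1 ew e1; rewrite -eu -ew e1.
rewrite -(card_in_imset inj); apply/subset_leq_card/subsetP => _ /imsetP[[n v] + ->].
rewrite !inE /= => /and4P[vL /eqP fv Qv /SbP Sv]; rewrite Qt Qv /=.
have ft : f (t v) = 0 by rewrite /t cubD cubZ cub1Zr cub1Zl fQ fv /s; field.
apply/and3P; split; last 1 first.
- apply/SbP => St; apply: nQ; have [s0|s0] := eqVneq (s v) 0.
    apply: (cl_tangent HS Sv) => //.
    by move/eqP: s0; rewrite oppr_eq0 mulf_eq0 invr_eq0 (negPf Qv) orbF => /eqP.
  have -> : Q = (- (s v)^-1) *: v + (s v)^-1 *: t v.
    by rewrite /t; apply/rowP=> i; rewrite !mxE; field.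
  apply: (cl_secant HS) => //; rewrite ?oppr_eq0 ?invr_eq0 //.
    rewrite (_ : _ + _ = Q) //; rewrite /t; apply/rowP=> i; rewrite !mxE; by field.
  rewrite /t cub1Dr cub1Zr cub1xx fv mul0rn add0r mulf_neq0 //.
  by apply: contraNneq s0 => e0; rewrite /s e0 mul0r oppr0.
- rewrite (_ : _ - _ = v - (e + n *: Q)) //.
  by rewrite /t; apply/rowP=> i; rewrite !mxE; ring.
by rewrite ft.
Qed.

Section Fibres.
Variables (B0 B1 Q e : V).
Hypotheses (bB : lbasis L B0 B1) (eL : e \notin (L + <[Q]>)%VS).
Hypothesis Qan : forall X, X \in L -> X != 0 -> f1 X Q != 0.
Definition pt (i : option K) := if i is Some t then B0 + t *: B1 else B1.
(** The number of distinct rational points of [L] on the conic: 0, 1 or 2 for a nonsplit, parabolic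
    or split plane. *)
Definition fib n := #|[set i | f1 (pt i) (e + n *: Q) == 0]|.

Lemma pt_in i : pt i \in L.
Proof. by case: i => [t|]; rewrite /= ?memvD ?memvZ ?(lbasisL bB) ?(lbasisR bB). Qed.

Lemma pt_basis i j : i != j -> lbasis L (pt i) (pt j).
Proof.
case: i j => [t|] [t'|] //= ne.
- rewrite -[B0 as X in lbasis _ (X + _)]scale1r -[B0 as X in lbasis _ _ (X + _)]scale1r.
  apply: (lbasis_change SL bB); rewrite mul1r mulr1 subr_eq0.
  by apply: contraNneq ne => ->.
- rewrite -[B0]scale1r -[B1 in lbasis _ _ B1]scale1r -[1 *: B1]add0r -(scale0r B0).
  by apply: (lbasis_change SL bB); rewrite mulr1 mulr0 subr0 oner_eq0.
rewrite -[B0]scale1r -[B1 in lbasis _ B1]scale1r -[1 *: B1]add0r -(scale0r B0).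
by apply: (lbasis_change SL bB); rewrite mul0r mul1r sub0r oppr_eq0 oner_eq0.
Qed.

Lemma pt_neq0 i : pt i != 0.
Proof.
have [j ne] : exists j, i != j by case: i => [t|]; [exists None|exists (Some 0)].
exact: lbasis_neq0 (pt_basis ne).
Qed.

Lemma pt_onto X : X \in L -> X != 0 -> exists i k, k != 0 /\ X = k *: pt i.
Proof.
move=> /(lbasisP bB)[x [y ->]] ne; have [x0|x0] := eqVneq x 0.
  exists None, y; split; last by rewrite x0 scale0r add0r.
  by apply: contraNneq ne => ->; rewrite x0 !scale0r addr0.
exists (Some (y / x)), x; split=> //; rewrite scalerDr scalerA.
by rewrite mulrCA mulfV // mulr1.
Qed.

(** Each of the q + 1 points of [L] has one tangent plane, and by [Qan] this is not the plane of
    [Q], the only one missing from the parametrization. *)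
Lemma sum_fib : (\sum_n fib n = #|K|.+1)%N.
Proof.
pose g i := (- (f1 (pt i) e / f1 (pt i) Q), i).
have ginj : injective g by move=> i j [].
rewrite -card_option -cardsT -(card_imset setT ginj).
rewrite /fib -(card_pairs (fun n i => f1 (pt i) (e + n *: Q) == 0)).
apply: eq_card => -[n i]; rewrite !inE /= cub1Dr cub1Zr.
have ne := Qan (pt_in i) (pt_neq0 i).
apply/idP/imsetP => [/eqP h|[j _ [-> <-]]]; last by rewrite mulNr divfK // subrr eqxx.
exists i => //; congr (_, _); apply: (mulIf ne); rewrite mulNr divfK //.
by apply/eqP; rewrite -addr_eq0 addrC h.
Qed.

Lemma plane_notin n : e + n *: Q \notin L.
Proof. exact: notin_sum (planes_off n eL). Qed.

Lemma fib_le2 n : (fib n <= 2)%N.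
Proof.
rewrite leqNgt; apply/negP => /card_gt2P[i [j [k [[]]]]]; rewrite !inE.
move=> /eqP hi /eqP hj /eqP hk [ij jk ki].
have b := pt_basis ij; have [x [y e1]] := lbasisP b (pt_in k).
have k0 := smooth_quadratic sm SL b (plane_notin n) hi hj.
move: hk; rewrite e1 !(cub1Dl c (x *: _) (y *: _)) !cub1Zl polarZl polarZm hi hj => /eqP.
rewrite !mulr0 add0r addr0 !mulf_eq0 (negPf k0) orbF => /orP[]/eqP z0.
  have := pt_basis jk => /lbasisC bb; have := @lbasis_comb _ _ _ _ 1 (- y) bb.
  by rewrite e1 z0 scale0r add0r scale1r scaleNr subrr => -[] // /eqP; rewrite oner_eq0.
have := pt_basis ki => bb; have := @lbasis_comb _ _ _ _ 1 (- x) bb.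
by rewrite e1 z0 scale0r addr0 scale1r scaleNr subrr => -[] // /eqP; rewrite oner_eq0.
Qed.

Lemma fib2P n : fib n = 2%N -> exists X Y, [/\ lbasis L X Y, f1 X (e + n *: Q) = 0 & f1 Y (e + n *: Q) = 0].
Proof.
move=> h; have /card_gt1P[i [j [+ + ne]]] : (1 < fib n)%N by rewrite h.
rewrite !inE => /eqP hi /eqP hj; exists (pt i), (pt j); split=> //; exact: pt_basis.
Qed.

Lemma fib_split X Y n : lbasis L X Y -> f1 X (e + n *: Q) = 0 -> f1 Y (e + n *: Q) = 0 -> fib n = 2%N.
Proof.
move=> b hX hY; apply/eqP; rewrite eqn_leq fib_le2; apply/card_gt1P.
have [i [k [k0 ei]]] := pt_onto (lbasisL b) (lbasis_neq0 b).
have [j [l [l0 ej]]] := pt_onto (lbasisR b) (lbasis_neq0 (lbasisC b)).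
exists i, j; rewrite !inE; split.
- by move/eqP: hX; rewrite ei cub1Zl mulf_eq0 expf_eq0 (negPf k0).
- by move/eqP: hY; rewrite ej cub1Zl mulf_eq0 expf_eq0 (negPf l0).
apply/eqP=> ij; have := @lbasis_comb _ _ _ _ l (- k) b; rewrite ei ej ij !scalerA.
by rewrite mulNr [l * k]mulrC scaleNr subrr => -[] // /eqP; rewrite (negPf l0).
Qed.

(** A form with one rational zero has it as a double zero, as otherwise the second zero would be
    rational too. *)
Lemma fib1P n : fib n = 1%N -> exists X, [/\ X \in L, X != 0, f1 X (e + n *: Q) = 0
  & forall Y, Y \in L -> pl X Y (e + n *: Q) = 0].
Proof.
move=> h; have : (0 < fib n)%N by rewrite h.
case/card_gt0P => i; rewrite inE => /eqP hi.
have XL := pt_in i; have X0 := pt_neq0 i; exists (pt i); split=> //.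
suff main Y : lbasis L (pt i) Y -> pl (pt i) Y (e + n *: Q) = 0.
  move=> Y YL; have [Z b] := lbasis_l SL XL X0; have [x [y ->]] := lbasisP b YL.
  by rewrite polarDm !polarZm polarxx hi main //; ring.
move=> b; apply/eqP; apply/negPn/negP => ne.
pose Y' := Y - (f1 Y (e + n *: Q) / pl (pt i) Y (e + n *: Q)) *: pt i.
have b' : lbasis L (pt i) Y'.
  have -> : Y' = (- (f1 Y (e + n *: Q) / pl (pt i) Y (e + n *: Q))) *: pt i + 1 *: Y.
    by rewrite /Y' scale1r addrC scaleNr.
  rewrite -[X in lbasis _ X](addr0) -(scale0r Y) -{1}[pt i]scale1r.
  by apply: (lbasis_change SL b); rewrite mulr1 mul0r subr0 oner_eq0.
have hY : f1 Y' (e + n *: Q) = 0.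
  rewrite /Y' -scaleNr cub1Dl cub1Zl polarZm hi mulr0 addr0 [pl Y _ _]polarC; by field.
by have := fib_split b' hi hY; rewrite h.
Qed.

Lemma fib2_root X n : fib n = 2%N -> X \in L -> X != 0 -> f1 X (e + n *: Q) = 0 ->
  exists Y, lbasis L X Y /\ f1 Y (e + n *: Q) = 0.
Proof.
move=> E XL X0 Xn; have [A [B [b An Bn]]] := fib2P E.
have [AX|AX] := boolP (A \in <[X]>%VS); last by exists A; split=> //; exact: (lbasis_free SL XL (lbasisL b) X0 AX).
exists B; split=> //; apply: (lbasis_free SL XL (lbasisR b) X0).
apply/negP => BX; have /vlineP[a aE] := AX; have /vlineP[a' a'E] := BX.
have [|] := @lbasis_comb _ _ _ _ a' (- a) b.
  by rewrite aE a'E !scalerA mulNr [a' * a]mulrC scaleNr subrr.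
by move=> a'0; have := lbasis_neq0 (lbasisC b); rewrite a'E a'0 scale0r eqxx.
Qed.

Lemma fib1_root X n : fib n = 1%N -> X \in L -> X != 0 -> f1 X (e + n *: Q) = 0 ->
  forall Y, Y \in L -> pl X Y (e + n *: Q) = 0.
Proof.
move=> E XL X0 Xn Y YL; have [Z [ZL Z0 Zn par]] := fib1P E.
have /vlineP[k ->] : X \in <[Z]>%VS.
  apply: contraT => XZ; have b := lbasis_free SL ZL XL Z0 XZ.
  by have := fib_split b Zn Xn; rewrite E.
by rewrite polarZl par // mulr0.
Qed.

Lemma fib0P n X : fib n = 0%N -> X \in L -> X != 0 -> f1 X (e + n *: Q) != 0.
Proof.
move=> h XL X0; have [i [k [k0 ->]]] := pt_onto XL X0.
rewrite cub1Zl mulf_neq0 ?expf_neq0 //; apply/negP => hi.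
by have /eqP := h; rewrite cards_eq0 => /eqP/setP/(_ i); rewrite !inE hi.
Qed.

(* The weights sum to zero up to [q + 1], because [L] has [q + 1] points, one on each fibre. *)
Lemma master_inequality (bonus : K -> nat) : Q \notin L -> f Q = 0 -> ~ S Q ->
  (forall n, #|out_pts Q e n| + #|K|.+1 * fib n + bonus n <= #|in_pts Q e n| + #|K|.+1 + 4 * (fib n == 2))%N ->
  (\sum_n bonus n + 2 * #|[set n | fib n == 1%N]| <= #|K|.+1)%N.
Proof.
move=> QL fQ nQ h.
have h1 := reflection_count QL eL fQ nQ.
have h2 : (\sum_n (#|out_pts Q e n| + #|K|.+1 * fib n + bonus n) <=
  \sum_n (#|in_pts Q e n| + #|K|.+1 + 4 * (fib n == 2)))%N by apply: leq_sum => n _; exact: h.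
rewrite !big_split /= -!big_distrr /= sum_nat_const in h2.
(* So q + 1 is twice the number of split planes plus the number of parabolic ones. *)
have h3 : (\sum_n fib n = 2 * \sum_n (fib n == 2) + #|[set n | fib n == 1%N]|)%N.
  rewrite -sum1dep_card [X in (_ + X)%N]big_mkcond big_distrr /= -big_split /=; apply: eq_bigr => n _.
  by have := fib_le2 n; case: (fib n) => [|[|[|]]].
rewrite sum_fib in h3; rewrite big1_eq sum_fib in h2.
move: h1 h2 h3; change #|xpredT| with #|K|; move: (#|K| * _)%N => a; move: #|K| => q.
move: (\sum_n #|in_pts Q e n|)%N (\sum_n #|out_pts Q e n|)%N (\sum_n bonus n)%N => i o b.
by move: (\sum_n (fib n == 2%N))%N #|[set n | fib n == 1%N]| => n1 r; clear; lia.
Qed.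
End Fibres.
End Counting.

(** * Two vanishing arguments over finite fields *)

Section FiniteField.
Variable K : finFieldType.

(** The sum of all elements is unchanged by the translation by 1, which adds q to it. *)
Lemma card_natr0 : #|K|%:R = 0 :> K.
Proof.
have : \sum_(x : K) (x + 1) = \sum_(x : K) x.
  by rewrite [RHS](reindex_inj (addIr 1)).
by rewrite big_split /= sumr_const => /eqP; rewrite -subr_eq0 addrAC subrr add0r => /eqP.
Qed.

Lemma card_power : exists p k, [/\ prime p, p \in [pchar K] & #|K| = (p ^ k)%N].
Proof.
have [||p pc] := @GRing.natf0_pchar K #|K|.
- by apply/card_gt0P; exists 0.
- by rewrite card_natr0.
by exists p, (logn p #|K|); split=> //; [exact: pcharf_prime pc|exact: (card_pprimeChar pc)].
Qed.

Lemma card_odd : (2%:R != 0 :> K) -> exists M, #|K| = (2 * M).+1.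
Proof.
move=> n2; have [p [k [pp pc qE]]] := card_power.
exists #|K|./2; rewrite mul2n -[LHS](odd_double_half #|K|) qE oddX.
suff -> : odd p by rewrite orbT add1n.
by case: (even_prime pp) => // p2; move: n2; rewrite -p2 (pcharf0 pc) eqxx.
Qed.

Lemma card_even : (2%:R = 0 :> K) -> exists k, #|K| = (2 ^ k)%N.
Proof.
move=> e2; have [p [k [pp pc qE]]] := card_power; exists k; rewrite qE; congr (_ ^ _)%N.
move/eqP: e2; rewrite -(dvdn_pcharf pc) => /prime_nt_dvdP -> //.
by case: p pp {pc qE} => [|[]].
Qed.

Definition vanisher : {poly K} := 'X^#|K| - 'X.

Lemma vanisher_dvd (P : {poly K}) : (forall w, P.[w] = 0) -> exists h, P = vanisher * h.
Proof.
move=> P0; have [||h ->] := @uniq_roots_prod_XsubC _ P (enum K).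
- by apply/allP => w _; rewrite rootE P0.
- by rewrite uniq_rootsE enum_uniq.
by exists h; rewrite mulrC /vanisher finField_genPoly big_enum.
Qed.

Lemma size_vanisher : size vanisher = #|K|.+1.
Proof. by rewrite /vanisher size_polyDl size_polyXn // size_polyN size_polyX ltnS finNzRing_gt1. Qed.

Lemma vanisher_deriv : vanisher^`() = -1.
Proof. by rewrite /vanisher derivB derivX derivXn -scaler_nat card_natr0 scale0r sub0r. Qed.

Lemma vanisher_neq0 : vanisher != 0.
Proof. by rewrite -size_poly_eq0 size_vanisher. Qed.

Lemma vanisher_size (P h : {poly K}) n : vanisher * h = P -> (size P <= #|K| + n)%N -> (size h <= n)%N.
Proof.
move=> e sP; have [->|h0] := eqVneq h 0; first by rewrite size_poly0.
move: sP; rewrite -e size_mul ?vanisher_neq0 // size_vanisher.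
by rewrite addSn /= leq_add2l.
Qed.

Lemma size_mul_le (P Q : {poly K}) a b : (size P <= a.+1)%N -> (size Q <= b.+1)%N -> (size (P * Q)%R <= (a + b).+1)%N.
Proof. move=> sP sQ; apply: leq_trans (size_polyMleq _ _) _.
by move: sP sQ; move: (size P) (size Q) => x y; clear; lia.
Qed.

Lemma size_exp_leq (P : {poly K}) a n : (size P <= a.+1)%N -> (size (P ^+ n)%R <= (a * n).+1)%N.
Proof.
move=> sP; elim: n => [|n IH]; first by rewrite expr0 muln0 size_poly1.
by rewrite exprS mulnS size_mul_le.
Qed.

Lemma size_deriv_leq (P : {poly K}) a : (size P <= a.+1)%N -> (size P^`() <= a)%N.
Proof.
move=> sP; have [->|P0] := eqVneq P 0; first by rewrite linear0 size_poly0.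
by rewrite -ltnS; apply: leq_trans sP; exact: lt_size_deriv.
Qed.

Lemma size_add_leq (P Q : {poly K}) n : (size P <= n)%N -> (size Q <= n)%N -> (size (P + Q)%R <= n)%N.
Proof. by move=> sP sQ; apply: leq_trans (size_polyD _ _) _; rewrite geq_max sP. Qed.

Lemma size_natmul_leq (P : {poly K}) n k : (size P <= n)%N -> (size (P *+ k)%R <= n)%N.
Proof. by move=> sP; elim: k => [|k IH]; rewrite ?mulr0n ?size_poly0 // mulrS size_add_leq. Qed.

(* Stepanov's method: the auxiliary polynomial [e (g^M - 1)], of degree about [2q], vanishes on all of *)
(* the field; differentiating the quotient twice leaves a multiple of [X^q - X] of degree less than [q]. *)
Lemma stepanov (M r : nat) (g e : {poly K}) : #|K| = (2 * M).+1 -> (3 * r + 7 <= #|K|)%N ->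
  (size g <= 5)%N -> (size e <= r.+1)%N -> (forall w, e.[w] * (g.[w] ^+ M - 1) = 0) ->
  exists k, e ^+ 3 * g^`() ^+ 2 = g * k.
Proof.
move=> qE qr sg se van; have M0 : (0 < M)%N by move: qr; rewrite qE; case: M {qE van} => //; lia.
have [h hE] : exists h, e * (g ^+ M - 1) = vanisher * h.
  by apply: vanisher_dvd => w; rewrite !hornerE van.
have [Z [dZ Zsize hZ]] : exists Z, [/\ Z^`() = -1, forall (P h' : {poly K}) n, Z * h' = P ->
    (size P <= #|K| + n)%N -> (size h' <= n)%N & e * (g ^+ M - 1) = Z * h].
  by exists vanisher; split=> //; [exact: vanisher_deriv|exact: vanisher_size].
move: hZ => {}hE.
have sgM : (size (g ^+ M - 1)%R <= (4 * M).+1)%N.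
  rewrite size_add_leq ?size_exp_leq //.
  by rewrite size_polyN size_poly1.
have sh : (size h <= #|K| + r - 1)%N.
  apply: (Zsize _ _ _ (esym hE)); have := size_mul_le se sgM; rewrite qE; lia.
(* [m] is -1/2, because [2 M + 1 = q] is zero in the field. *)
have [m [mE m2]] : exists m : {poly K}, m = M%:R /\ 2%:R * m = -1.
  exists M%:R; split=> //.
  have : (2 * M).+1%:R = 0 :> {poly K} by rewrite -qE -polyC_natr card_natr0 polyC0.
  by rewrite -addn1 natrD natrM => /eqP; rewrite addr_eq0 => /eqP.
have e1 : e^`() * (g ^+ M - 1) + e * (m * g^`() * g ^+ M.-1) = - h + Z * h^`().
  have := congr1 (@deriv K) hE; rewrite !derivM dZ derivB derivC subr0 deriv_exp.
  rewrite mulN1r => <-; rewrite -[_ *+ M]mulr_natl -mE; ring.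
have gM : g * g ^+ M.-1 = g ^+ M by rewrite -exprS prednK.
have [k kE] : exists k, k = e * g * h^`() - e^`() * g * h - m * e * g^`() * h by eexists.
(* Multiplying by [e g] lets [hE] eliminate the power [g^M]. *)
have E1 : e * g * h + m * e ^+ 2 * g^`() = Z * k.
  have : e * g * (e^`() * (g ^+ M - 1) + e * (m * g^`() * g ^+ M.-1)) = e * g * (- h + Z * h^`()) by rewrite e1.
  have -> : e * g * (e^`() * (g ^+ M - 1) + e * (m * g^`() * g ^+ M.-1)) =
    e^`() * g * (e * (g ^+ M - 1)) + m * e * g^`() * (e * (g * g ^+ M.-1 - 1) + e) by ring.
  rewrite gM hE => E; rewrite kE.
  have -> : Z * (e * g * h^`() - e^`() * g * h - m * e * g^`() * h) =
    e * g * (- h + Z * h^`()) + e * g * h - e^`() * g * (Z * h) - m * e * g^`() * (Z * h) by ring.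
  rewrite -E; ring.
have dm : m^`() = 0 by rewrite mE -polyC_natr derivC.
have E2 : Z * (e * g * k^`() - 2%:R * e^`() * g * k - (1 + m) * e * g^`() * k) =
   - (m * (1 + m)) * (e ^+ 3 * g^`() ^+ 2) + 2%:R * (e * g * k) + m * (e ^+ 3 * g * g^`()^`()).
  have := congr1 (@deriv K) E1; rewrite !(derivD, derivM, deriv_exp) dZ dm => D1.
  have D2 : e^`() * g * h + e * g^`() * h + e * g * h^`() + m * (2%:R * e * e^`() * g^`() + e ^+ 2 * g^`()^`())
      = - k + Z * k^`() by rewrite mulN1r in D1; rewrite -D1; ring.
  have D3 : e * g * h^`() = k + e^`() * g * h + m * e * g^`() * h by rewrite kE; ring.
  rewrite D3 in D2.
  have D4 : Z * k^`() = 2%:R * e^`() * g * h + (1 + m) * e * g^`() * h + 2%:R * k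
     + m * (2%:R * e * e^`() * g^`() + e ^+ 2 * g^`()^`()).
    have -> : Z * k^`() = k + (- k + Z * k^`()) by ring.
    rewrite -D2; ring.
  have -> : Z * (e * g * k^`() - 2%:R * e^`() * g * k - (1 + m) * e * g^`() * k) =
    e * g * (Z * k^`()) - (2%:R * e^`() * g + (1 + m) * e * g^`()) * (Z * k) by ring.
  rewrite D4 -E1; ring.
have sg' := size_deriv_leq sg.
have sg'' : (size g^`()^`() <= 3)%N by exact: size_deriv_leq.
have se2 : (size (e ^+ 2)%R <= (r * 2).+1)%N by exact: size_exp_leq.
have se3 : (size (e ^+ 3)%R <= (r * 3).+1)%N by exact: size_exp_leq.
have smm (P : {poly K}) n : (size P <= n)%N -> (size (m * P)%R <= n)%N.
  by move=> sP; rewrite mE mulr_natl size_natmul_leq.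
have sk : (size k <= 2 * r + 3)%N.
  apply: (Zsize _ _ _ (esym E1)); apply: size_add_leq.
    have s1 := size_mul_le se sg; case: (posnP (size h)) => [|hp].
      by move/eqP; rewrite size_poly_eq0 => /eqP->; rewrite mulr0 size_poly0.
    have := @size_mul_le _ h _ (size h).-1 s1; rewrite (ltn_predK hp) leqnn => /(_ isT).
    by move: sh hp qr; move: (size h) #|K| (size _) => x y z; clear; lia.
  rewrite -mulrA smm // (leq_trans (size_mul_le se2 sg')) //; move: qr; clear; lia.
(* The right side of [E2] has size at most [3 r + 7 <= q], too small for a nonzero multiple of
   [X^q - X]. *)
have RHS0 : Z * (e * g * k^`() - 2%:R * e^`() * g * k - (1 + m) * e * g^`() * k) = 0.
  move: E2; set W := _ - (1 + m) * _ * _ * _ => E2.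
  suff : (size W <= 0)%N by rewrite leqn0 size_poly_eq0 => /eqP->; rewrite mulr0.
  apply: (Zsize _ _ _ E2); rewrite addn0; apply: leq_trans qr.
  apply: size_add_leq; last first.
    by rewrite smm // (leq_trans (size_mul_le (size_mul_le se3 sg) sg'')) //; clear; lia.
  apply: size_add_leq; last first.
    have sk' : (size k <= (2 * r + 2).+1)%N by rewrite -addnS.
    rewrite mulr_natl size_natmul_leq // (leq_trans (size_mul_le (size_mul_le se sg) sk')) //.
    by clear; lia.
  have s1 : (size (e ^+ 3 * g^`() ^+ 2)%R <= 3 * r + 7)%N.
    apply: leq_trans (size_mul_le se3 (size_exp_leq 2 (a := 3) sg')) _; clear; lia.
  by rewrite mulNr size_polyN -mulrA smm // mulrDl mul1r size_add_leq // smm.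
rewrite E2 in RHS0.
exists (- 4%:R * (2%:R * (e * k) + m * (e ^+ 3 * g^`()^`()))).
(* With [m = -1/2] the coefficient [m (1 + m)] is -1/4, so [e^3 g'^2] can be isolated modulo [g]. *)
have m4 : 4%:R * (m * (1 + m)) = -1.
  have -> : 4%:R * (m * (1 + m)) = (2%:R * m) * 2%:R + (2%:R * m) * (2%:R * m) by ring.
  by rewrite m2; ring.
have : 4%:R * (- (m * (1 + m)) * (e ^+ 3 * g^`() ^+ 2) + 2%:R * (e * g * k) + m * (e ^+ 3 * g * g^`()^`())) = 0.
  by rewrite RHS0 mulr0.
have -> : 4%:R * (- (m * (1 + m)) * (e ^+ 3 * g^`() ^+ 2) + 2%:R * (e * g * k) + m * (e ^+ 3 * g * g^`()^`()))
  = - (4%:R * (m * (1 + m))) * (e ^+ 3 * g^`() ^+ 2) + 4%:R * (2%:R * (e * g * k) + m * (e ^+ 3 * g * g^`()^`())) by ring.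
rewrite m4 opprK mul1r => /eqP; rewrite addr_eq0 => /eqP->; ring.
Qed.
Lemma frobenius_add (x y : K) i : 2%:R = 0 :> K -> (x + y) ^+ (2 ^ i) = x ^+ (2 ^ i) + y ^+ (2 ^ i).
Proof.
move=> c2; have pc : 2%N \in [pchar K] by rewrite inE /= c2 eqxx.
by rewrite exprDn_pchar // pnatX pnatE // pc.
Qed.

(* The absolute trace of [z^2 + z], cleared of denominators, is a polynomial vanishing on the field; *)
(* its derivative only sees the first term of the trace, the others being squares. *)
Lemma trace_wronskian (a b : K) (v M : {poly K}) : 2%:R = 0 :> K -> (8 <= #|K|)%N ->
  a != 0 -> (size v <= 3)%N -> size M = 3%N ->
  (forall w, M.[w] != 0 /\ exists z, z ^+ 2 + z = b + a * v.[w] / M.[w]) ->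
  v^`() * M + v * M^`() = 0.
Proof.
move=> c2 q8 a0 sv sM h; have [k qE] := card_even c2.
have c2P : 2%:R = 0 :> {poly K} by rewrite -polyC_natr c2.
case: k qE => [|[|[|k]]] qE; try by move: q8; rewrite qE.
pose N := b%:P * M + a%:P * v.
have sN : (size N <= 3)%N.
  rewrite size_add_leq // mul_polyC (leq_trans (size_scale_leq _ _)) ?sM //.
(* [M^(q/2)] times the absolute trace of [N / M = b + a v / M], where [q = 2^(k+3)]. *)
pose P := \sum_(i < k.+3) N ^+ (2 ^ i) * M ^+ (2 ^ k.+2 - 2 ^ i).
have [g gE] : exists g, P = vanisher * g.
  apply: vanisher_dvd => w; have [Mw [z zE]] := h w.
  have Nw : N.[w] = M.[w] * (z ^+ 2 + z).
    by rewrite zE /N !hornerE; field.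
  have -> : P.[w] = M.[w] ^+ (2 ^ k.+2) * \sum_(i < k.+3) (z ^+ (2 ^ i.+1) + z ^+ (2 ^ i)).
    rewrite /P horner_sum mulr_sumr; apply: eq_bigr => i _.
    rewrite hornerM !horner_exp Nw exprMn frobenius_add // -exprM -expnS.
    rewrite mulrAC -exprD subnKC // leq_pexp2l //.
    by rewrite -ltnS ltn_ord.
  suff -> : \sum_(i < k.+3) (z ^+ (2 ^ i.+1) + z ^+ (2 ^ i)) = z ^+ (2 ^ k.+3) + z.
    by rewrite -qE expf_card -mulr2n -mulr_natl c2 mul0r mulr0.
  elim: (k.+3) => [|n IH]; first by rewrite big_ord0 expr1 -mulr2n -mulr_natl c2 mul0r.
  rewrite big_ord_recr IH /=; move: (z ^+ (2 ^ n)) (z ^+ (2 ^ n.+1)) => x y.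
  by transitivity (y + z + 2%:R * x); [ring|rewrite c2 mul0r addr0].
have sP : (size P <= #|K| + 1)%N.
  rewrite /P; elim/big_ind: _ => [|x y|i _]; [by rewrite size_poly0|exact: size_add_leq|].
  have le : (2 ^ i <= 2 ^ k.+2)%N by rewrite leq_pexp2l // -ltnS ltn_ord.
  have := size_mul_le (size_exp_leq (2 ^ i) sN) (size_exp_leq (2 ^ k.+2 - 2 ^ i) (eq_leq sM)).
  rewrite -mulnDr subnKC // qE [in X in _ -> (_ <= X)%N]expnS addn1 //.
(* [P] has degree at most q, so its quotient by [X^q - X] is constant. *)
have sg : (size g <= 1)%N := vanisher_size (esym gE) sP.
have [d gd] : exists d, g = d%:P by exists g`_0; exact: size1_polyC.
have dP : P^`() = M ^+ (2 ^ k.+2 - 2) * (N^`() * M + N * M^`()).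
  rewrite /P big_ord_recl derivD [X in _ + X](_ : _ = 0) ?addr0.
    rewrite expr1 expn0 derivM deriv_exp.
    pose m := (2 ^ k.+1 - 1)%N; have k2 : (2 <= 2 ^ k.+2)%N by rewrite (@leq_pexp2l 2 1).
    have e2 : (2 ^ k.+2 - 2)%N = (2 * m)%N by rewrite /m mulnBr -expnS.
    have -> : (2 ^ k.+2 - 1)%N = (2 * m).+1 by rewrite -e2 -subSn.
    have odd (x : {poly K}) : x *+ (2 * m).+1 = x.
      by rewrite mulrS mulrnA -[x *+ 2]mulr_natl c2P mul0r mul0rn addr0.
    rewrite odd e2 /= exprS; move: (M ^+ (2 * m)) => y; ring.
  rewrite linear_sum big1 // => i _; rewrite /= /bump /= add1n.
  have -> : N ^+ (2 ^ i.+1) * M ^+ (2 ^ k.+2 - 2 ^ i.+1) = (N ^+ (2 ^ i) * M ^+ (2 ^ k.+1 - 2 ^ i)) ^+ 2.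
    by rewrite exprMn -!exprM ![(_ * 2)%N]mulnC mulnBr -!expnS.
  by rewrite deriv_exp -mulr_natl c2P mul0r.
have dN : N^`() * M + N * M^`() = a%:P * (v^`() * M + v * M^`()).
  rewrite /N derivD !derivM !derivC !mul0r !add0r.
  transitivity (2%:R * b%:P * M * M^`() + a%:P * (v^`() * M + v * M^`())); first by ring.
  by rewrite c2P !mul0r add0r.
(* Otherwise the factor [M^(q/2 - 2)] gives [P'] a positive degree, whereas [P' = -d]. *)
apply/eqP; apply/negPn/negP => W0.
have : size P^`() = (size (v^`() * M + v * M^`())%R + (2 * (2 ^ k.+2 - 2)))%N.
  have M0 : M != 0 by rewrite -size_poly_eq0 sM.
  rewrite dP dN size_mul ?expf_neq0 ?mulf_neq0 ?polyC_eq0 // size_Cmul //.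
  by rewrite polySpred ?expf_neq0 // size_exp sM addSn /= addnC.
have -> : P^`() = (- d)%:P.
  by rewrite gE gd derivM derivC mulr0 addr0 vanisher_deriv mulN1r polyCN.
have := size_polyC_leq1 (- d); have : (0 < size (v^`() * M + v * M^`())%R)%N by rewrite lt0n size_poly_eq0.
have : (4 <= 2 ^ k.+2)%N by rewrite (@leq_pexp2l 2 2).
by move: (size _) (size _) (2 ^ _)%N => x y z; clear; lia.
Qed.
End FiniteField.

Definition nonroots (K : finFieldType) (P : {poly K}) := [set s | P.[s] != 0].

Lemma card_nonroot (K : finFieldType) (P : {poly K}) n : P != 0 -> (size P <= n.+1)%N ->
  (#|K| <= #|nonroots P| + n)%N.
Proof.
move=> P0 sP; rewrite -(cardsC (nonroots P)) leq_add2l.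
rewrite cardE -ltnS; apply: leq_trans sP; apply: max_poly_roots => //; last exact: enum_uniq.
by apply/allP => x; rewrite mem_enum !inE negbK.
Qed.

Lemma card_image_le (T U : finType) (D : {set T}) (A : {set U}) (g : T -> U) :
  {in D &, injective g} -> (forall x, x \in D -> g x \in A) -> (#|D| <= #|A|)%N.
Proof.
move=> inj sub; rewrite -(card_in_imset inj); apply/subset_leq_card/subsetP.
by move=> _ /imsetP[x xD ->]; exact: sub.
Qed.

(** * Generated and ungenerated points in each kind of plane *)

Section Planes.
Variables (K : finFieldType) (c : 'I_4 -> 'I_4 -> 'I_4 -> K).
Notation V := 'rV[K]_4.
Hypothesis sm : csmooth c.
Notation f := (cub c).
Notation f1 := (cub1 c).
Notation pl := (polar c).
Variable L : {vspace V}.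
Hypothesis SL : surface_line c L.
Variables (S : V -> Prop) (Sb : pred V).
Hypothesis SbP : forall v, reflect (S v) (Sb v).
Hypothesis HS : sigma_closed c S.
Hypothesis HL : forall Z, Z \in L -> Z != 0 -> S Z.
Hypothesis HE : forall X r, eckardt c L X r -> S r.
Hypothesis q8 : (8 <= #|K|)%N.
Implicit Types X Y Z p q r v : V.
Variable Q : V.
Hypothesis Qdir : exists2 X, X \in L & f1 Q X != 0.

(** The sets [in_pts] and [out_pts] with the plane given by any of its points, so that a centre may
    be chosen. *)
Definition inP p := [set v | [&& v - p \in L, f v == 0, f1 Q v != 0 & Sb v]].
Definition outP p := [set v | [&& v - p \in L, f v == 0, f1 Q v != 0 & ~~ Sb v]].

Lemma inP_eq p p' : p' - p \in L -> inP p' = inP p /\ outP p' = outP p.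
Proof.
move=> h; suff e v : (v - p' \in L) = (v - p \in L) by split; apply/setP => v; rewrite !inE e.
apply/idP/idP => h'; first by rewrite -(subrKA p' v) addrC memvD.
have -> : v - p' = (v - p) - (p' - p) by rewrite opprB addrA subrK.
by rewrite memvB.
Qed.

Lemma comb_in X Y p x y : lbasis L X Y -> p + x *: X + y *: Y - p \in L.
Proof.
move=> b; have -> : p + x *: X + y *: Y - p = x *: X + y *: Y by apply/rowP=> i; rewrite !mxE; ring.
by rewrite memvD ?memvZ ?(lbasisL b) ?(lbasisR b).
Qed.

Lemma Qdir_basis X Y : lbasis L X Y -> f1 Q X = 0 -> f1 Q Y != 0.
Proof.
move=> b QX; have [Z ZL QZ] := Qdir; have [x [y e]] := lbasisP b ZL.
by apply: contraNneq QZ => QY; rewrite e cub1Dr !cub1Zr QX QY !mulr0 addr0.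
Qed.

Lemma comb_inj X Y p x y x' y' : lbasis L X Y -> p + x *: X + y *: Y = p + x' *: X + y' *: Y ->
  x = x' /\ y = y'.
Proof.
move=> b; rewrite -!addrA => /addrI /eqP; rewrite -subr_eq0 => /eqP h.
have [|/eqP + /eqP] := @lbasis_comb _ _ _ _ (x - x') (y - y') b.
  by rewrite -[RHS]h; apply/rowP=> i; rewrite !mxE; ring.
by rewrite !subr_eq0 => /eqP-> /eqP->.
Qed.

(** The conic is a hyperbola with q - 1 affine points, all generated; the tangent plane at [Q]
    removes at most two of them. *)
Lemma smooth_split_in X Y p : center c L X Y p -> f p != 0 ->
  (#|outP p| = 0)%N /\ (#|K| <= #|inP p| + 3)%N.
Proof.
move=> C fp; have b := center_basis C; have k0 := center_polar sm SL C.
split.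
  apply/eqP; rewrite cards_eq0 -subset0; apply/subsetP => v; rewrite !inE.
  case/and4P => vL /eqP fv _ /SbP nS; case: nS.
  have [x [y e]] := lbasisP b vL; have vE : v = p + x *: X + y *: Y.
    by rewrite -addrA -e addrC subrK.
  rewrite vE; apply: (cover_center sm SL HS HL C); last by rewrite -vE.
  apply: contraNT fp; rewrite negb_or !negbK => /andP[/eqP x0 /eqP y0].
  by move/eqP: fv; rewrite vE x0 y0 !scale0r !addr0.
pose l0 := f1 Q p; pose l1 := f1 Q X; pose l2 := f1 Q Y; pose a := f p / pl X Y p.
pose P : {poly K} := 'X * Poly [:: - a * l2; l0; l1].
have P0 : P != 0.
  rewrite mulf_neq0 ?polyX_eq0 //; apply/eqP => /(congr1 (fun z : {poly K} => (z`_0, z`_2))).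
  rewrite !coef_Poly !coef0 /= => -[/eqP + l10].
  by rewrite mulf_eq0 oppr_eq0 mulf_eq0 invr_eq0 (negPf fp) (negPf k0) (negPf (Qdir_basis b l10)).
have sP : (size P <= 4)%N by rewrite (@size_mul_le _ _ _ 1 2) ?size_polyX ?size_Poly.
apply: leq_trans (card_nonroot P0 sP) _; rewrite leq_add2r.
apply: (@card_image_le _ _ _ _ (fun s => p + s *: X + (- a / s) *: Y)).
  by move=> s t _ _ /(comb_inj b)[].
move=> s; rewrite !inE /P hornerM hornerX horner_Poly /= mul0r add0r mulf_eq0 negb_or => /andP[s0 ne].
have fs : f (p + s *: X + (- a / s) *: Y) = 0.
  by rewrite (center_cub SL _ _ C) /a; field; rewrite ?k0 ?s0.
rewrite fs eqxx comb_in // !cub1Dr !cub1Zr -/l0 -/l1 -/l2 /=; apply/andP; split.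
  apply: contraNneq ne => h; rewrite -[X in _ == X](mulr0 s) -[in X in _ == X]h.
  by apply/eqP; field.
by apply/SbP; apply: (cover_center sm SL HS HL C) => //; rewrite s0.
Qed.

(** When the tangent plane at [Q] passes through [X], one of its two intersections with the conic is
    on [L], so one point less is lost. *)
Lemma smooth_split_in' X Y p : center c L X Y p -> f p != 0 -> f1 Q X = 0 ->
  (#|K| <= #|inP p| + 2)%N.
Proof.
move=> C fp l10; have b := center_basis C; have k0 := center_polar sm SL C.
pose l0 := f1 Q p; pose l2 := f1 Q Y; pose a := f p / pl X Y p.
have l20 : l2 != 0 by exact: (Qdir_basis b l10).
have a0 : a != 0 by rewrite mulf_neq0 ?invr_eq0.
pose P : {poly K} := 'X * Poly [:: - a * l2; l0].
have P0 : P != 0.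
  rewrite mulf_neq0 ?polyX_eq0 //; apply/eqP => /(congr1 (fun z : {poly K} => z`_0)).
  by rewrite !coef_Poly !coef0 /= => /eqP; rewrite mulf_eq0 oppr_eq0 (negPf a0) (negPf l20).
have sP : (size P <= 3)%N by rewrite (@size_mul_le _ _ _ 1 1) ?size_polyX ?size_Poly.
apply: leq_trans (card_nonroot P0 sP) _; rewrite leq_add2r.
apply: (@card_image_le _ _ _ _ (fun s => p + s *: X + (- a / s) *: Y)).
  by move=> s t _ _ /(comb_inj b)[].
move=> s; rewrite !inE /P hornerM hornerX horner_Poly /= mul0r add0r mulf_eq0 negb_or => /andP[s0 ne].
have fs : f (p + s *: X + (- a / s) *: Y) = 0.
  by rewrite (center_cub SL _ _ C) /a; field; rewrite ?k0 ?s0.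
rewrite fs eqxx comb_in // !cub1Dr !cub1Zr l10 -/l0 -/l2 /=; apply/andP; split.
  apply: contraNneq ne => h; rewrite -[X in _ == X](mulr0 s) -[in X in _ == X]h.
  by apply/eqP; field.
by apply/SbP; apply: (cover_center sm SL HS HL C) => //; rewrite s0.
Qed.

Lemma triangle_out X Y p : center c L X Y p -> f p = 0 -> (#|outP p| <= 1)%N.
Proof.
move=> C fp; have b := center_basis C; have k0 := center_polar sm SL C.
rewrite -[X in (_ <= X)%N](cards1 p); apply/subset_leq_card/subsetP => v; rewrite !inE.
case/and4P => vL /eqP fv _ /SbP nS; apply/eqP; have [x [y e]] := lbasisP b vL.
have vE : v = p + x *: X + y *: Y by rewrite -addrA -e addrC subrK.
have [x0|x0] := eqVneq x 0; last first.
  by case: nS; rewrite vE; apply: (cover_center sm SL HS HL C); rewrite ?x0 -?vE.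
have [y0|y0] := eqVneq y 0; last first.
  by case: nS; rewrite vE; apply: (cover_center sm SL HS HL C); rewrite ?y0 ?orbT -?vE.
by rewrite vE x0 y0 !scale0r !addr0.
Qed.

Lemma triangle_side X Y p s : center c L X Y p -> f p = 0 -> s != 0 -> f1 Q p + s * f1 Q X != 0 ->
  p + s *: X \in inP p.
Proof.
move=> C fp s0 ne; have b := center_basis C.
have fs : f (p + s *: X + 0 *: Y) = 0 by rewrite (center_cub SL _ _ C) fp; ring.
have e : p + s *: X = p + s *: X + 0 *: Y by rewrite scale0r addr0.
rewrite !inE e fs comb_in // -e cub1Dr cub1Zr ne eqxx /=.
by apply/SbP; rewrite e; apply: (cover_center sm SL HS HL C) => //; rewrite s0.
Qed.

Definition side X p := [set s | (s != 0) && (f1 Q p + s * f1 Q X != 0)].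

Lemma card_side X p : f1 Q X != 0 -> (#|K| <= #|side X p| + 2)%N.
Proof.
move=> l1; pose P : {poly K} := 'X * Poly [:: f1 Q p; f1 Q X].
have P0 : P != 0.
  rewrite mulf_neq0 ?polyX_eq0 //; apply/eqP => /(congr1 (fun z : {poly K} => z`_1)).
  by rewrite !coef_Poly !coef0 /= => /eqP; rewrite (negPf l1).
have sP : (size P <= 3)%N by rewrite (@size_mul_le _ _ _ 1 1) ?size_polyX ?size_Poly.
apply: leq_trans (card_nonroot P0 sP) _; rewrite leq_add2r; apply/subset_leq_card/subsetP => s.
by rewrite !inE /P hornerM hornerX horner_Poly /= mul0r add0r mulf_eq0 negb_or addrC [f1 Q X * s]mulrC.
Qed.

Lemma triangle_in1 X Y p : center c L X Y p -> f p = 0 -> f1 Q X != 0 -> (#|K| <= #|inP p| + 2)%N.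
Proof.
move=> C fp l1; apply: leq_trans (card_side p l1) _; rewrite leq_add2r.
apply: (@card_image_le _ _ _ _ (fun s => p + s *: X)).
  move=> s t _ _; rewrite -[p + _]addr0 -[p + t *: X]addr0 -(scale0r Y).
  by case/(comb_inj (center_basis C)).
by move=> s; rewrite inE => /andP[s0 ne]; exact: (triangle_side C).
Qed.

Lemma triangle_in X Y p : center c L X Y p -> f p = 0 -> (#|K| <= #|inP p| + 2)%N.
Proof.
move=> C fp; have [l10|l1] := eqVneq (f1 Q X) 0; last exact: (triangle_in1 C).
exact: (triangle_in1 (centerC C) fp (Qdir_basis (center_basis C) l10)).
Qed.

(** The tangent plane at [Q] passes through neither [X] nor [Y], so each side loses only the vertex
    and one more point. *)
Lemma triangle_in2 X Y p : center c L X Y p -> f p = 0 -> f1 Q X != 0 -> f1 Q Y != 0 ->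
  (2 * #|K| <= #|inP p| + 4)%N.
Proof.
move=> C fp l1 l2; have b := center_basis C.
pose DX := side X p; pose DY := side Y p.
pose AX := [set p + s *: X | s in DX]; pose AY := [set p + s *: Y | s in DY].
have eX s : p + s *: X = p + s *: X + 0 *: Y by rewrite scale0r addr0.
have eY s : p + s *: Y = p + 0 *: X + s *: Y by rewrite scale0r addr0.
have cX : #|AX| = #|DX| by apply: card_imset => s t; rewrite (eX s) (eX t) => /(comb_inj b)[].
have cY : #|AY| = #|DY| by apply: card_imset => s t; rewrite (eY s) (eY t) => /(comb_inj b)[].
have dis : [disjoint AX & AY].
  rewrite -setI_eq0 -subset0; apply/subsetP => v; rewrite !inE.
  case/andP => /imsetP[s]; rewrite inE => /andP[s0 _] -> /imsetP[t _].
  by rewrite eX eY => /(comb_inj b)[/eqP]; rewrite (negPf s0).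
have sub : (AX :|: AY) \subset inP p.
  apply/subsetP => v; rewrite inE => /orP[] /imsetP[s]; rewrite inE => /andP[s0 ne] ->.
    exact: (triangle_side C).
  exact: (triangle_side (centerC C)).
have := subset_leq_card sub; rewrite cardsU (disjoint_setI0 dis) cards0 subn0 cX cY.
have := card_side p l1; have := card_side p l2; rewrite -/DX -/DY.
by move: #|DX| #|DY| #|K| #|inP p| => x y z w; clear; lia.
Qed.

Section Parabolic.
Variables (X p : V).
Hypotheses (XL : X \in L) (X0 : X != 0) (pL : p \notin L) (Xp : f1 X p = 0).
Hypothesis par : forall Y, Y \in L -> pl X Y p = 0.

Lemma parabolic_at v : v - p \in L -> [/\ v \notin L, f1 X v = 0, f1 v X = f1 p X &
  forall Y, Y \in L -> pl X Y v = 0].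
Proof.
move=> vp; have [Y b] := lbasis_l SL XL X0; have [x [y e]] := lbasisP b vp.
have vE : v = p + x *: X + y *: Y by rewrite -addrA -e addrC subrK.
split.
- by rewrite vE; exact: notin_comb.
- by rewrite vE (line_conicE SL _ _ _ b).
- by rewrite vE (conic1E SL _ _ _ b) Xp par ?(lbasisR b) //; ring.
move=> Z ZL; have [x' [y' ->]] := lbasisP b ZL.
by rewrite vE !cubE !polarE !(lineE SL b) Xp par ?(lbasisR b) //; ring.
Qed.

Lemma parabolic_out : #|outP p| = 0%N.
Proof.
apply/eqP; rewrite cards_eq0 -subset0; apply/subsetP => v; rewrite !inE.
case/and4P => vL /eqP fv _ /SbP nS; case: nS; have [vnL Xv vX pv] := parabolic_at vL.
have [vX0|vX0] := eqVneq (f1 v X) 0; last exact: (cover_tangent HS HL XL).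
by apply: (HE (X := X)); split.
Qed.

Lemma parabolic_dir Y : lbasis L X Y -> f1 Y p != 0.
Proof.
move=> b; apply/eqP => Yp; have := smooth_quadratic sm SL b pL Xp Yp.
by rewrite par ?eqxx // (lbasisR b).
Qed.

Lemma parabolic_smooth_card Y (P : {poly K}) k : lbasis L X Y -> f1 p X != 0 ->
  (forall t, P.[t] = f1 p X * f1 Q p - f1 Q X * (f p + t * f1 p Y + t ^+ 2 * f1 Y p) + t * f1 p X * f1 Q Y) ->
  (#|K| <= #|nonroots P| + k)%N -> (#|K| <= #|inP p| + k)%N.
Proof.
move=> b E0 PE h; apply: leq_trans h _; rewrite leq_add2r.
pose s t := - (f p + t * f1 p Y + t ^+ 2 * f1 Y p) / f1 p X.
apply: (@card_image_le _ _ _ _ (fun t => p + s t *: X + t *: Y)).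
  by move=> t t' _ _ /(comb_inj b)[].
move=> t; rewrite !inE PE => ne.
have ft : f (p + s t *: X + t *: Y) = 0.
  by rewrite (conicE SL _ _ _ b) Xp par ?(lbasisR b) // /s; field.
have tL : p + s t *: X + t *: Y - p \in L by exact: comb_in.
have [_ Xt tX _] := parabolic_at tL.
rewrite ft eqxx tL !cub1Dr !cub1Zr /=; apply/andP; split.
  apply: contraNneq ne => h; rewrite -[X in _ == X](mulr0 (f1 p X)) -[in X in _ == X]h.
  by apply/eqP; rewrite /s; field.
by apply/SbP; apply: (cover_tangent HS HL XL) => //; rewrite tX.
Qed.

Lemma parabolic_smooth_in : f1 p X != 0 -> (#|K| <= #|inP p| + 2)%N.
Proof.
move=> E0; have [Y b] := lbasis_l SL XL X0; have kY := parabolic_dir b.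
pose P : {poly K} := Poly [:: f1 p X * f1 Q p - f1 Q X * f p; f1 p X * f1 Q Y - f1 Q X * f1 p Y; - f1 Q X * f1 Y p].
apply: (parabolic_smooth_card (P := P) b E0) => [t|]; first by rewrite horner_Poly /=; ring.
apply: card_nonroot; last exact: size_Poly.
apply/eqP => /(congr1 (fun z : {poly K} => (z`_1, z`_2))); rewrite !coef_Poly !coef0 /= => -[h1 /eqP].
rewrite mulf_eq0 oppr_eq0 (negPf kY) orbF => /eqP l10.
by move/eqP: h1; rewrite l10 mul0r subr0 mulf_eq0 (negPf E0) (negPf (Qdir_basis b l10)).
Qed.

(* In characteristic 2, [Y] is the nucleus of the conic. *)
Lemma parabolic_nucleus_in Y : 2%:R = 0 :> K -> lbasis L X Y -> f1 p X != 0 ->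
  f1 p Y = 0 -> f1 Q Y = 0 -> (#|K| <= #|inP p| + 1)%N.
Proof.
move=> c2 b E0 pY QY; have kY := parabolic_dir b.
have l1 := Qdir_basis (lbasisC b) QY.
pose P : {poly K} := Poly [:: f1 p X * f1 Q p - f1 Q X * f p; 0; - f1 Q X * f1 Y p].
have PE t : P.[t] = f1 p X * f1 Q p - f1 Q X * (f p + t * f1 p Y + t ^+ 2 * f1 Y p) + t * f1 p X * f1 Q Y.
  by rewrite horner_Poly /= pY QY; ring.
apply: (parabolic_smooth_card b E0 PE).
rewrite -(cardsC (nonroots P)) leq_add2l; apply/card_le1_eqP => s t.
rewrite !inE !negbK !PE pY QY => /eqP h1 /eqP h2.
have : f1 Q X * f1 Y p * (s - t) ^+ 2 = 0.
  have -> : f1 Q X * f1 Y p * (s - t) ^+ 2 = f1 Q X * f1 Y p * (s ^+ 2 - t ^+ 2) + 2%:R * (f1 Q X * f1 Y p * t * (t - s)) by ring.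
  rewrite c2 mul0r addr0 -[RHS](subrr 0) -[X in _ = X - _]h2 -[X in _ = _ - X]h1; ring.
move/eqP; rewrite !mulf_eq0 (negPf l1) (negPf kY) /= orbb subr_eq0 => /eqP->//.
Qed.

(** The rational point [r] makes both lines through [X] rational. They are distinct, and each has q
    points off [L]. *)
Lemma parabolic_eckardt_in r : f1 p X = 0 -> r - p \in L -> f r = 0 -> (#|K| <= #|inP p|)%N.
Proof.
move=> pX rp fr; have [Y b] := lbasis_l SL XL X0; have kY := parabolic_dir b.
have [rL Xr rX parr] := parabolic_at rp; rewrite pX in rX.
have er : eckardt c L X r by split.
have [_ rY] := double_line_free sm SL er b.
have Yr : f1 Y r = f1 Y p by rewrite -[r in LHS](subrK p) cub1Dr (line_cub1 SL (lbasisR b) rp) add0r.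
pose y := - f1 r Y / f1 Y p.
have y0 : y != 0 by rewrite mulf_neq0 ?oppr_eq0 ?invr_eq0.
have pt2 s t : (t == 0) || (t == y) -> f1 Q r + s * f1 Q X + t * f1 Q Y != 0 -> r + s *: X + t *: Y \in inP p.
  move=> ty ne; have inL : r + s *: X + t *: Y - p \in L.
    by rewrite -(subrK r (_ + t *: Y)) -addrA memvD // comb_in.
  have fz : f (r + s *: X + t *: Y) = 0.
    rewrite (conicE SL _ _ _ b) fr rX Xr parr ?(lbasisR b) // Yr /=.
    by case/orP: ty => /eqP->; rewrite /y; field.
  rewrite inE inL fz eqxx !cub1Dr !cub1Zr ne /=; apply/SbP.
  have [zL Xz zX parz] := parabolic_at inL; rewrite pX in zX.
  by apply: (HE (X := X)); split.
have [l10|l1] := eqVneq (f1 Q X) 0.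
  have l2 := Qdir_basis b l10.
  have [t [ty ne]] : exists t, ((t == 0) || (t == y)) /\ f1 Q r + t * f1 Q Y != 0.
    have [h|h] := eqVneq (f1 Q r) 0; last by exists 0; rewrite eqxx mul0r addr0.
    by exists y; rewrite eqxx orbT h add0r mulf_neq0.
  rewrite -cardsT; apply: (@card_image_le _ _ _ _ (fun s => r + s *: X + t *: Y)).
    by move=> s s' _ _ /(comb_inj b)[].
  by move=> s _; apply: pt2 => //; rewrite l10 mulr0 addr0.
pose D t := [set s | f1 Q r + s * f1 Q X + t * f1 Q Y != 0].
have cD t : (#|K| <= #|D t| + 1)%N.
  pose P : {poly K} := Poly [:: f1 Q r + t * f1 Q Y; f1 Q X].
  have -> : D t = nonroots P.
    by apply/setP => s; rewrite !inE horner_Poly /= mul0r add0r [f1 Q X * s]mulrC addrCA addrA.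
  apply: card_nonroot; last exact: size_Poly.
  by apply/eqP => /(congr1 (fun z : {poly K} => z`_1)); rewrite coef_Poly coef0 /=; move/eqP: l1.
pose A t := [set r + s *: X + t *: Y | s in D t].
have cA t : #|A t| = #|D t| by apply: card_imset => s s' /(comb_inj b)[].
have dis : [disjoint A 0 & A y].
  rewrite -setI_eq0 -subset0; apply/subsetP => v; rewrite !inE.
  case/andP => /imsetP[s _ ->] /imsetP[s' _] /(comb_inj b)[_ /eqP].
  by rewrite eq_sym (negPf y0).
have sub : (A 0 :|: A y) \subset inP p.
  by apply/subsetP => v; rewrite inE => /orP[] /imsetP[s]; rewrite inE => ne ->; apply: pt2; rewrite ?eqxx ?orbT.
have := subset_leq_card sub; rewrite cardsU (disjoint_setI0 dis) cards0 subn0 !cA.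
have := cD 0; have := cD y; move: q8.
by move: #|D 0| #|D y| #|K| #|inP p| => x z w u; clear; lia.
Qed.
End Parabolic.
End Planes.

Lemma card_pred_sum (T : finType) (P : pred T) : #|[set n | P n]| = (\sum_n (P n : nat))%N.
Proof. by rewrite -sum1dep_card big_mkcond; apply: eq_bigr => n _; case: (P n). Qed.

(** * The surplus of a plane and its consequences *)

Section Gains.
Variables (K : finFieldType) (c : 'I_4 -> 'I_4 -> 'I_4 -> K).
Notation V := 'rV[K]_4.
Hypothesis sm : csmooth c.
Notation f := (cub c).
Notation f1 := (cub1 c).
Notation pl := (polar c).
Variable L : {vspace V}.
Hypothesis SL : surface_line c L.
Variables (S : V -> Prop) (Sb : pred V).
Hypothesis SbP : forall v, reflect (S v) (Sb v).
Hypothesis HS : sigma_closed c S.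
Hypothesis HL : forall Z, Z \in L -> Z != 0 -> S Z.
Hypothesis HE : forall X r, eckardt c L X r -> S r.
Hypothesis q8 : (8 <= #|K|)%N.
Implicit Types X Y Z p q r v : V.
Variables B0 B1 : V.
Hypothesis bB : lbasis L B0 B1.
Notation pt := (pt B0 B1).

Definition conic p := [set v | (v - p \in L) && (f v == 0)].

Lemma conicP p v : reflect (v - p \in L /\ f v = 0) (v \in conic p).
Proof. by rewrite inE; apply: (iffP andP) => -[? /eqP]. Qed.

Section Anisotropic.
Variable p : V.
Hypothesis pan : forall X, X \in L -> X != 0 -> f1 X p != 0.

Lemma an_at v X : v - p \in L -> X \in L -> f1 X v = f1 X p.
Proof. by move=> vp XL; rewrite -[v](subrK p) cub1Dr (line_cub1 SL XL vp) add0r. Qed.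

(** The second point of the conic on the line joining [v] to [pt i]; it is [v] itself when this line
    is tangent. *)
Let g v i := v + (- f1 v (pt i) / f1 (pt i) p) *: pt i.

Lemma an_line v X k : v \in conic p -> X \in L -> X != 0 -> v + k *: X \in conic p ->
  k = 0 \/ k = - f1 v X / f1 X p.
Proof.
move=> /conicP[vp fv] XL X0 /conicP[_]; rewrite !cubE fv (line_cub SL XL) (an_at vp XL) => h.
have Xp := pan XL X0; have [->|k0] := eqVneq k 0; [by left|right].
apply: (mulIf Xp); rewrite divfK //; apply: (mulfI k0); apply/eqP.
by rewrite -subr_eq0 -[X in _ == X]h; apply/eqP; ring.
Qed.

Lemma an_on v i : v \in conic p -> g v i \in conic p.
Proof.
move=> /conicP[vp fv]; have iL := pt_in bB i; have ip := pan iL (pt_neq0 SL bB i).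
apply/conicP; split; first by rewrite /g addrAC memvD // memvZ.
by rewrite /g !cubE fv (line_cub SL iL) (an_at vp iL); field.
Qed.

Lemma an_cover v w : v \in conic p -> w \in conic p -> exists i, w = g v i.
Proof.
move=> vC wC; have [->|ne] := eqVneq w v.
  have [h|h] := eqVneq (f1 v B1) 0; first by exists None; rewrite /g /= h oppr0 mul0r scale0r addr0.
  exists (Some (- f1 v B0 / f1 v B1)); rewrite /g /= cub1Dr cub1Zr divfK // subrr.
  by rewrite oppr0 mul0r scale0r addr0.
have wv : w - v \in L.
  by move/conicP: vC => [vp _]; move/conicP: wC => [wp _]; exact: (memv_diff vp wp).
have wv0 : w - v != 0 by rewrite subr_eq0.
have [i [k [k0 e]]] := pt_onto bB wv wv0; exists i.
have wE : w = v + k *: pt i by rewrite -e addrC subrK.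
rewrite wE in wC; have [k0'|ke] := an_line vC (pt_in bB i) (pt_neq0 SL bB i) wC.
  by rewrite k0' eqxx in k0.
by rewrite wE /g -ke.
Qed.

Lemma an_card : (#|conic p| <= #|K|.+1)%N.
Proof.
case: (set_0Vmem (conic p)) => [->|[v vC]]; first by rewrite cards0.
rewrite -card_option -[X in (_ <= X)%N]cardsT; apply: leq_trans (leq_imset_card (g v) _).
apply/subset_leq_card/subsetP => w wC; have [i ->] := an_cover vC wC.
by rewrite imset_f // inE.
Qed.

(** If two directions gave the same point, [v] would be a singular point of the conic, and then
    every line through [v] would meet the conic only there. *)
Lemma an_big v w : v \in conic p -> w \in conic p -> v != w -> (#|K|.+1 <= #|conic p|)%N.
Proof.
move=> vC wC ne; rewrite -card_option -[X in (X <= _)%N]cardsT.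
apply: (@card_image_le _ _ _ _ (g v)); last by move=> i _; exact: an_on.
move=> i j _ _ e; apply/eqP; apply: contraNT ne => ij.
have b := pt_basis SL bB ij.
have ip := pan (pt_in bB i) (pt_neq0 SL bB i); have jp := pan (pt_in bB j) (pt_neq0 SL bB j).
have := @lbasis_comb _ _ _ _ (- f1 v (pt i) / f1 (pt i) p) (- (- f1 v (pt j) / f1 (pt j) p)) b.
rewrite scaleNr; move: e; rewrite /g => /addrI -> /(_ (subrr _)) [/eqP + /eqP].
rewrite oppr_eq0 !mulf_eq0 !invr_eq0 (negPf ip) (negPf jp) !orbF !oppr_eq0 => /eqP vi /eqP vj.
have [k ->] := an_cover vC wC; have [x [y e]] := lbasisP b (pt_in bB k).
by rewrite /g {1}e cub1Dr !cub1Zr vi vj !mulr0 addr0 oppr0 mul0r scale0r addr0.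
Qed.

(** The line joining two points of the conic meets [L] in a generated point, so one secant leads
    from either to the other. *)
Lemma an_spread v w : v \in conic p -> w \in conic p -> S v -> S w.
Proof.
move=> vC wC Sv; have [i wE] := an_cover vC wC.
have iL := pt_in bB i; have i0 := pt_neq0 SL bB i; have ip := pan iL i0.
have [h|h] := eqVneq (f1 v (pt i)) 0; first by rewrite wE /g h oppr0 mul0r scale0r addr0.
rewrite wE; apply: (gen_pt HS iL) => //; last by move: wC; rewrite wE => /conicP[].
  by rewrite mulf_neq0 ?oppr_eq0 ?invr_eq0.
exact: HL.
Qed.

Variable Q : V.
Hypothesis Qdir : exists2 X, X \in L & f1 Q X != 0.

Lemma an_tangent_line : (#|[set v in conic p | f1 Q v == 0%R]| <= 2)%N.
Proof.
set A := [set v in _ | _]; case: (set_0Vmem A) => [->|[v]]; first by rewrite cards0.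
rewrite inE => /andP[vC /eqP Qv].
have [X [XL X0 QX]] : exists X, [/\ X \in L, X != 0 & f1 Q X = 0].
  have [h|h] := eqVneq (f1 Q B1) 0.
    by exists B1; split=> //; [exact: lbasisR bB|exact: lbasis_neq0 (lbasisC bB)].
  exists (pt (Some (- f1 Q B0 / f1 Q B1))); rewrite (pt_in bB) (pt_neq0 SL bB); split=> //.
  by rewrite /= cub1Dr cub1Zr divfK // subrr.
have [Y b] := lbasis_l SL XL X0; have QY := Qdir_basis Qdir b QX.
pose B := [set v; v + (- f1 v X / f1 X p) *: X].
have cB : (#|B| <= 2)%N by rewrite cards2; case: (_ != _).
apply: leq_trans cB.
apply/subset_leq_card/subsetP => w; rewrite !inE => /andP[wC /eqP Qw].
have wv : w - v \in L.
  by move: vC => /conicP[vp _]; move: (wC) => /andP[wp _]; exact: (memv_diff vp wp).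
have [x [y e]] := lbasisP b wv.
have wE : w = v + x *: X + y *: Y by rewrite -addrA -e addrC subrK.
have y0 : y = 0.
  move: Qw; rewrite wE !cub1Dr !cub1Zr Qv QX mulr0 !add0r => /eqP.
  by rewrite mulf_eq0 (negPf QY) orbF => /eqP.
rewrite y0 scale0r addr0 in wE.
have wC' : v + x *: X \in conic p by rewrite -wE inE.
by have [x0|xE] := an_line vC XL X0 wC'; rewrite wE ?x0 ?xE ?scale0r ?addr0 eqxx ?orbT.
Qed.

Lemma an_out : (#|outP c L Sb Q p| <= #|conic p|)%N.
Proof.
by apply/subset_leq_card/subsetP => v; rewrite !inE => /and4P[-> -> _ _].
Qed.

Lemma an_in v w : v \in conic p -> w \in conic p -> v != w -> S v ->
  #|outP c L Sb Q p| = 0%N /\ (#|K| <= #|inP c L Sb Q p| + 1)%N.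
Proof.
move=> vC wC vw Sv; split.
  apply/eqP; rewrite cards_eq0 -subset0; apply/subsetP => z; rewrite !inE.
  case/and4P => zp fz _ /SbP nS; case: nS; apply: an_spread Sv => //.
  by rewrite inE zp.
have := an_big vC wC vw; have := an_tangent_line.
have : (#|conic p| <= #|[set v in conic p | f1 Q v == 0%R]| + #|inP c L Sb Q p|)%N.
  apply: leq_trans (leq_card_setU _ _); apply/subset_leq_card/subsetP => z zC.
  have Sz := an_spread vC zC Sv; move: (zC); rewrite !inE => /andP[-> ->] /=.
  by case: (f1 Q z == 0) => //=; apply/SbP.
by move: #|inP _ _ _ _ _| #|conic p| #|K| #|[set _ in _ | _]| => x y z t; clear; lia.
Qed.
End Anisotropic.

Section Sum.
Variables Q e : V.
Hypotheses (eL : e \notin (L + <[Q]>)%VS) (QL : Q \notin L) (fQ : f Q = 0) (nQ : ~ S Q).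
Hypothesis Qan : forall X, X \in L -> X != 0 -> f1 X Q != 0.
Hypothesis Qdir : exists2 X, X \in L & f1 Q X != 0.
Notation pn n := (e + n *: Q).
Notation fib := (fib c B0 B1 Q e).
Notation inn n := (#|inP c L Sb Q (pn n)|).
Notation outn n := (#|outP c L Sb Q (pn n)|).

Lemma pn_notin n : pn n \notin L.
Proof. exact: notin_sum (planes_off n eL). Qed.

Lemma fib0_an n : fib n = 0%N -> forall X, X \in L -> X != 0 -> f1 X (pn n) != 0.
Proof. by move=> E X XL X0; exact: (fib0P bB E). Qed.

(* The surplus of the plane of [pn n] in [master_inequality]; it is never truncated ([gain_base]). *)
Definition gain n := ((inn n + #|K|.+1 + 4 * (fib n == 2%N)) - (outn n + #|K|.+1 * fib n))%N.

Lemma fib2_center n : fib n = 2%N -> exists X Y p, center c L X Y p /\ p - pn n \in L.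
Proof.
move=> E; have [X [Y [b h1 h2]]] := fib2P SL bB E.
have [x [y C]] := center_ex sm SL b (pn_notin n) h1 h2.
by exists X, Y, (pn n + x *: X + y *: Y); split=> //; exact: comb_in.
Qed.

(** A nonsplit plane has at most q + 1 points; a parabolic one has no ungenerated point. A smooth
    split plane has only generated points and counts at least q - 3 of them; a triangle counts at
    least q - 2, against one vertex. The term [4] absorbs the deficit of split planes. *)
Lemma gain_base n : (outn n + #|K|.+1 * fib n <= inn n + #|K|.+1 + 4 * (fib n == 2%N))%N.
Proof.
have := fib_le2 sm SL bB eL n; case E: (fib n) => [|[|[|//]]] _.
- have := an_card (fib0_an E).
  have := an_out (pn n) Q; rewrite muln0.
  by move: (outn n) (inn n) #|K| #|conic _| => x y z t; clear; lia.
- have [X [XL X0 Xp par]] := fib1P sm SL bB eL E.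
  rewrite (parabolic_out SL SbP HS HL HE Q XL X0 (pn_notin n) Xp par).
  by move: (inn n) #|K| => y z; clear; lia.
have [X [Y [p [C pp]]]] := fib2_center E; have [<- <-] := inP_eq c Sb Q pp.
have [p0|p0] := eqVneq (f p) 0.
  have := triangle_out sm SL SbP HS HL Q C p0; have := triangle_in sm SL SbP HS HL Qdir C p0.
  by move: #|inP _ _ _ _ _| #|outP _ _ _ _ _| #|K| => x y z; clear; lia.
have [-> ] := smooth_split_in sm SL SbP HS HL Qdir C p0.
by move: #|inP _ _ _ _ _| #|K| => x z; clear; lia.
Qed.

Lemma gain_sum : (\sum_n gain n + 2 * #|[set n | fib n == 1%N]| <= #|K|.+1)%N.
Proof.
apply: (master_inequality sm SL SbP HS bB eL Qan QL fQ nQ) => n.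
by rewrite /gain subnKC //; exact: gain_base.
Qed.

Lemma gain_le1 a : (gain a <= \sum_n gain n)%N.
Proof. by rewrite (bigD1 a) //= leq_addr. Qed.

Lemma gain_le2 a b : a != b -> (gain a + gain b <= \sum_n gain n)%N.
Proof.
by move=> ab; rewrite (bigD1 a) //= (bigD1 b) /= 1?eq_sym // addnA leq_addr.
Qed.

Lemma gain_killed n v w : fib n = 0%N -> v \in conic (pn n) -> w \in conic (pn n) -> v != w -> S v ->
  (2 * #|K| <= gain n)%N.
Proof.
move=> E vC wC vw Sv; have [o i] := an_in (fib0_an E) Qdir vC wC vw Sv.
rewrite /gain o E; move: i; move: (inn n) #|K| => x y; clear; lia.
Qed.

Lemma gain_small n : fib n = 0%N -> (#|conic (pn n)| <= 1)%N -> (#|K| <= gain n)%N.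
Proof.
move=> E le1; have := leq_trans (an_out (pn n) Q) le1; rewrite /gain E.
by move: (inn n) (outn n) #|K| => x y z; clear; lia.
Qed.

Lemma gain_parabolic n : fib n = 1%N -> (inn n <= gain n)%N.
Proof.
move=> E; have [X [XL X0 Xp par]] := fib1P sm SL bB eL E.
rewrite /gain E (parabolic_out SL SbP HS HL HE Q XL X0 (pn_notin n) Xp par).
by move: (inn n) #|K| => x z; clear; lia.
Qed.

Lemma gain_triangle n X Y p : center c L X Y p -> p - pn n \in L -> f p = 0 ->
  f1 Q X != 0 -> f1 Q Y != 0 -> (#|K| <= gain n + 2)%N.
Proof.
move=> C pp p0 l1 l2; have b := center_basis C.
have E : fib n = 2%N.
  by apply: (fib_split sm SL bB eL b); rewrite -(an_at pp) ?(lbasisL b) ?(lbasisR b) ?(center_qX C) ?(center_qY C).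
rewrite /gain E; have [<- <-] := inP_eq c Sb Q pp.
have := triangle_out sm SL SbP HS HL Q C p0; have := triangle_in2 sm SL SbP HS HL C p0 l1 l2.
by move: #|inP _ _ _ _ _| #|outP _ _ _ _ _| #|K| => x y z; clear; lia.
Qed.

Lemma gain_vertex n X Y p : center c L X Y p -> p - pn n \in L -> f p != 0 -> f1 Q X = 0 ->
  (1 <= gain n)%N.
Proof.
move=> C pp p0 l1; have b := center_basis C.
have E : fib n = 2%N.
  by apply: (fib_split sm SL bB eL b); rewrite -(an_at pp) ?(lbasisL b) ?(lbasisR b) ?(center_qX C) ?(center_qY C).
rewrite /gain E; have [<- <-] := inP_eq c Sb Q pp.
have [-> _] := smooth_split_in sm SL SbP HS HL Qdir C p0.
have := smooth_split_in' sm SL SbP HS HL Qdir C p0 l1.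
by move: #|inP _ _ _ _ _| #|K| => x z; clear; lia.
Qed.

Notation npar := #|[set n | fib n == 1%N]|.

Lemma gain_bound k : (k <= \sum_n gain n)%N -> (k + 2 * npar <= #|K|.+1)%N.
Proof. by move=> h; apply: leq_trans gain_sum; rewrite leq_add2r. Qed.

(** The surplus 2q exceeds the total q + 1. *)
Lemma not_killed n v w : fib n = 0%N -> v \in conic (pn n) -> w \in conic (pn n) -> v != w -> ~ S v.
Proof.
move=> E vC wC vw Sv.
have := gain_bound (leq_trans (gain_killed E vC wC vw Sv) (gain_le1 n)); move: q8.
by move: #|K| npar => x y; clear; lia.
Qed.

Lemma small_unique m n : fib m = 0%N -> fib n = 0%N -> (#|conic (pn m)| <= 1)%N ->
  (#|conic (pn n)| <= 1)%N -> m = n.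
Proof.
move=> Em En sm' sn; apply/eqP; apply/negPn/negP => mn.
have := gain_bound (leq_trans (leq_add (gain_small Em sm') (gain_small En sn)) (gain_le2 mn)); move: q8.
by move: #|K| npar => x y; clear; lia.
Qed.

Lemma no_small n : fib n = 0%N -> (1 <= npar)%N -> (2 <= #|conic (pn n)|)%N.
Proof.
move=> E r1; rewrite ltnNge; apply/negP => s1.
have := gain_bound (leq_trans (gain_small E s1) (gain_le1 n)); move: r1 q8.
by move: #|K| npar => x y; clear; lia.
Qed.

Lemma npar_gt0 n : fib n = 1%N -> (1 <= npar)%N.
Proof. by move=> E; apply/card_gt0P; exists n; rewrite inE E. Qed.

Lemma no_parabolic_lines n X r : fib n = 1%N -> X \in L -> X != 0 -> f1 X (pn n) = 0 ->
  f1 (pn n) X = 0 -> r \in conic (pn n) -> False.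
Proof.
move=> E XL X0 Xp pX /conicP[rp fr].
have par := fib1_root sm SL bB eL E XL X0 Xp.
have i := parabolic_eckardt_in sm SL SbP HE q8 Qdir XL X0 (pn_notin n) Xp par pX rp fr.
have := gain_bound (leq_trans (leq_trans i (gain_parabolic E)) (gain_le1 n)).
by have := npar_gt0 E; move: #|K| npar => x y; clear; lia.
Qed.

Lemma no_parabolic_smooth n X : fib n = 1%N -> X \in L -> X != 0 -> f1 X (pn n) = 0 ->
  f1 (pn n) X != 0 -> (2 <= npar)%N -> False.
Proof.
move=> E XL X0 Xp pX r2.
have par := fib1_root sm SL bB eL E XL X0 Xp.
have i := parabolic_smooth_in sm SL SbP HS HL Qdir XL X0 (pn_notin n) Xp par pX.
have := leq_trans (gain_parabolic E) (gain_le1 n) => j.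
have := gain_bound j; move: i r2.
by move: #|K| npar (inn n) => x y z; clear; lia.
Qed.

Lemma plane_through X : X \in L -> X != 0 -> exists n, f1 X (pn n) = 0.
Proof.
move=> XL X0; have XQ := Qan XL X0; exists (- f1 X e / f1 X Q).
by rewrite cub1Dr cub1Zr divfK // subrr.
Qed.

Lemma plane_through_unique X m n : X \in L -> X != 0 -> f1 X (pn m) = 0 -> f1 X (pn n) = 0 -> m = n.
Proof.
move=> XL X0; rewrite !cub1Dr !cub1Zr => hm hn; apply: (mulIf (Qan XL X0)).
by apply: (addrI (f1 X e)); rewrite hm hn.
Qed.

(** The tangent plane at [Q] meets [L] in [X], so it wastes one of its intersections with the conic
    there and removes fewer points than [gain_base] allows. *)
Lemma gain_vertex_any n X Y p : center c L X Y p -> p - pn n \in L -> f1 Q X = 0 -> (1 <= gain n)%N.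
Proof.
move=> C pp l1; have [p0|p0] := eqVneq (f p) 0; last exact: (gain_vertex C pp p0 l1).
have b := center_basis C; have l2 := Qdir_basis Qdir b l1.
have E : fib n = 2%N.
  by apply: (fib_split sm SL bB eL b); rewrite -(an_at pp) ?(lbasisL b) ?(lbasisR b) ?(center_qX C) ?(center_qY C).
rewrite /gain E; have [<- <-] := inP_eq c Sb Q pp.
have o1 := triangle_out sm SL SbP HS HL Q C p0.
have i1 := triangle_in1 sm SL SbP HS HL (centerC C) p0 l2.
have [l0|l0] := eqVneq (f1 Q p) 0.
  have -> : #|outP c L Sb Q p| = 0%N.
    apply/eqP; rewrite cards_eq0 -subset0; apply/subsetP => v; rewrite !inE.
    case/and4P => vp /eqP fv Qv /SbP nS; case: nS; have [x [y ey]] := lbasisP b vp.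
    have vE : v = p + x *: X + y *: Y by rewrite -addrA -ey addrC subrK.
    rewrite vE; apply: (cover_center sm SL HS HL C); last by rewrite -vE.
    apply: contraNT Qv; rewrite negb_or !negbK => /andP[/eqP x0 /eqP y0].
    by rewrite vE x0 y0 !scale0r !addr0 l0.
  by move: i1 q8; move: #|inP _ _ _ _ _| #|K| => x z; clear; lia.
have i2 : (#|K| <= #|inP c L Sb Q p| + 1)%N.
  rewrite card_units leq_add2r; apply: (@card_image_le _ _ _ _ (fun s => p + s *: X)).
    move=> s t _ _; rewrite -[p + s *: X]addr0 -[p + t *: X]addr0 -(scale0r Y).
    by case/(comb_inj b).
  move=> s; rewrite inE => s0; apply: (triangle_side sm SL SbP HS HL C) => //.
  by rewrite l1 mulr0 addr0.
by move: i2 o1; move: #|inP _ _ _ _ _| #|outP _ _ _ _ _| #|K| => x y z; clear; lia.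
Qed.

(* Here [Y] is the nucleus of the conic. *)
Lemma no_parabolic_nucleus n X Y : 2%:R = 0 :> K -> fib n = 1%N -> lbasis L X Y -> f1 X (pn n) = 0 ->
  f1 (pn n) X != 0 -> f1 (pn n) Y = 0 -> f1 Q Y = 0 -> False.
Proof.
move=> c2 E b Xp pX pY QY; have [XL YL] := (lbasisL b, lbasisR b).
have X0 := lbasis_neq0 b; have Y0 := lbasis_neq0 (lbasisC b).
have parX := fib1_root sm SL bB eL E XL X0 Xp.
have i := parabolic_nucleus_in sm SL SbP HS HL Qdir XL X0 (pn_notin n) Xp parX c2 b pX pY QY.
have g1 := leq_trans i (leq_add (gain_parabolic E) (leqnn 1)).
have [m Yp] := plane_through YL Y0.
have mn : m != n.
  by apply/eqP => mn; rewrite mn in Yp; have := fib_split sm SL bB eL b Xp Yp; rewrite E.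
have r1 := npar_gt0 E.
(* Plane [n] contributes at least q - 1, plus 2 for being parabolic, which already reaches the bound
   q + 1. The plane [m] tangent at [Y] adds something in any case: it is either parabolic or
   split. *)
have : (1 <= gain m + 2 * (npar - 1))%N.
  have := fib_le2 sm SL bB eL m; case Em: (fib m) => [|[|[|//]]] _.
  - by have := fib0_an Em YL Y0; rewrite Yp eqxx.
  - have : (2 <= npar)%N.
      by apply/card_gt1P; exists m, n; rewrite !inE Em E.
    by move: npar (gain m) => x y; clear; lia.
  have [W [bW Wp]] := fib2_root SL bB Em YL Y0 Yp.
  have [x [y C]] := center_ex sm SL bW (pn_notin m) Yp Wp.
  have := gain_vertex_any C (comb_in _ _ _ bW) QY.
  by move: npar (gain m) => x' y'; clear; lia.
have := gain_bound (gain_le2 mn); move: g1 r1.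
by move: (gain m) (gain n) npar #|K| => x y z t; clear; lia.
Qed.

Definition triangle n := (fib n == 2%N) && [exists v, [&& v \in conic (pn n), f1 v B0 == 0 & f1 v B1 == 0]].

Lemma triangleP n : triangle n -> exists X Y v, [/\ center c L X Y v, v - pn n \in L & f v = 0].
Proof.
case/andP => /eqP E /existsP[v /and3P[/conicP[vp fv] /eqP v0 /eqP v1]].
have [X [Y [b Xp Yp]]] := fib2P SL bB E; exists X, Y, v; split=> //.
have dir Z : Z \in L -> f1 v Z = 0.
  by move=> /(lbasisP bB)[x [y ->]]; rewrite cub1Dr !cub1Zr v0 v1 !mulr0 addr0.
split=> //; rewrite ?(an_at vp) ?dir ?(lbasisL b) ?(lbasisR b) //.
by apply: contra (pn_notin n) => vL; rewrite -(subKr v (pn n)); exact: memvB.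
Qed.

Lemma triangle_gain n X0 : triangle n -> X0 \in L -> X0 != 0 -> f1 Q X0 = 0 -> f1 X0 (pn n) != 0 ->
  (#|K| <= gain n + 2)%N.
Proof.
move=> /triangleP[X [Y [v [C vp fv]]]] X0L X00 QX0 X0p.
have b := center_basis C.
have nz Z W : lbasis L Z W -> f1 Z v = 0 -> f1 Q Z != 0.
  move=> bZ Zv; apply: contraNneq X0p => QZ; have [x [y e0]] := lbasisP bZ X0L.
  have y0 : y = 0.
    move/eqP: QX0; rewrite e0 cub1Dr !cub1Zr QZ mulr0 add0r mulf_eq0 => /orP[/eqP//|].
    by rewrite (negPf (Qdir_basis Qdir bZ QZ)).
  by rewrite -(an_at vp X0L) e0 y0 scale0r addr0 cub1Zl Zv mulr0.
by apply: (gain_triangle C vp fv); [exact: (nz _ _ b (center_qX C))|exact: (nz _ _ (lbasisC b) (center_qY C))].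
Qed.

(** Let [X0] be the point of [L] in the tangent plane at [Q]. A triangle outside the plane tangent
    at [X0] counts both sides and has surplus at least q - 2; two of these exceed the bound, and so
    does one beside two parabolic planes. *)
Lemma card_triangles : (#|[set n | triangle n]| <= 2)%N /\ ((2 <= npar)%N -> (#|[set n | triangle n]| <= 1)%N).
Proof.
have [X0 [X0L X00 QX0]] : exists X, [/\ X \in L, X != 0 & f1 Q X = 0].
  have [h|h] := eqVneq (f1 Q B1) 0.
    by exists B1; split=> //; [exact: lbasisR bB|exact: lbasis_neq0 (lbasisC bB)].
  exists (pt (Some (- f1 Q B0 / f1 Q B1))); rewrite (pt_in bB) (pt_neq0 SL bB); split=> //.
  by rewrite /= cub1Dr cub1Zr divfK // subrr.
have [n0 h0] := plane_through X0L X00.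
have tg n : triangle n -> n != n0 -> (#|K| <= gain n + 2)%N.
  move=> tn ne; apply: (triangle_gain tn X0L X00 QX0).
  by apply: contraNneq ne => h; rewrite (plane_through_unique X0L X00 h h0).
have lt1 : (#|[set n | triangle n] :\ n0| <= 1)%N.
  apply/card_le1_eqP => m n; rewrite !inE => /andP[m0 tm] /andP[nn0 tn].
  apply/eqP; apply/negPn/negP => mn.
  have := gain_bound (gain_le2 mn); have := tg _ tm m0; have := tg _ tn nn0; move: q8.
  by move: (gain m) (gain n) npar #|K| => x y z t; clear; lia.
split; first by rewrite (cardsD1 n0); move: lt1; case: (n0 \in _); move: #|_| => x; clear; lia.
move=> r2; suff e0 : #|[set n | triangle n] :\ n0| = 0%N.
  by rewrite (cardsD1 n0) e0 addn0; case: (n0 \in _).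
apply/eqP; rewrite cards_eq0 -subset0; apply/subsetP => n; rewrite !inE => /andP[nn0 tn].
have := gain_bound (gain_le1 n); have := tg _ tn nn0; move: q8 r2.
by move: (gain n) npar #|K| => x y z; clear; lia.
Qed.

Lemma card_fibres : #|K|.+1 = (2 * #|[set n | fib n == 2%N]| + npar)%N /\
  #|[set n | fib n == 2%N]| = #|[set n | fib n == 0%N]|.+1.
Proof.
have h3 : (\sum_n fib n = 2 * #|[set n | fib n == 2%N]| + npar)%N.
  rewrite !card_pred_sum big_distrr /= -big_split /=; apply: eq_bigr => n _.
  by have := fib_le2 sm SL bB eL n; case: (fib n) => [|[|[|]]].
have h4 : (#|K| = #|[set n | fib n == 2%N]| + npar + #|[set n | fib n == 0%N]|)%N.
  rewrite !card_pred_sum -!big_split /= -[LHS]sum1_card; apply: eq_bigr => n _.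
  by have := fib_le2 sm SL bB eL n; case: (fib n) => [|[|[|]]].
move: h3; rewrite (sum_fib SL e bB Qan) => h3; split=> //.
by move: h3 h4; move: #|K| npar #|[set n | fib n == 2%N]| #|[set n | fib n == 0%N]| => x y z t; clear; lia.
Qed.
End Sum.
End Gains.

(** * Discriminants and tangent curves *)

Lemma sqrt_char2 (K : finFieldType) (y : K) : 2%:R = 0 :> K -> exists x, y = x ^+ 2.
Proof.
move=> c2; have inj : injective (fun x : K => x ^+ 2).
  move=> x z /= e; apply/eqP; rewrite -subr_eq0 -sqrf_eq0.
  have -> : (x - z) ^+ 2 = (x ^+ 2 - z ^+ 2) - 2%:R * (z * (x - z)) by ring.
  by rewrite e subrr c2 mul0r subr0.
by have [g _ gK] := injF_bij inj; exists (g y); rewrite gK.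
Qed.

Section Pencil.
Variables (K : finFieldType) (c : 'I_4 -> 'I_4 -> 'I_4 -> K).
Notation V := 'rV[K]_4.
Hypothesis sm : csmooth c.
Notation f := (cub c).
Notation f1 := (cub1 c).
Notation pl := (polar c).
Variable L : {vspace V}.
Hypothesis SL : surface_line c L.
Implicit Types X Y Z p q r v : V.

(** The discriminant of the form on [L]; a change of basis multiplies it by a square. *)
Definition disc X Y z := pl X Y z ^+ 2 - f1 X z * f1 Y z *+ 4.

Lemma disc_change X Y A B : lbasis L X Y -> lbasis L A B ->
  exists k, forall z, disc A B z = k ^+ 2 * disc X Y z.
Proof.
move=> b b'; have [x [y eA]] := lbasisP b (lbasisL b'); have [x' [y' eB]] := lbasisP b (lbasisR b').
exists (x * y' - x' * y) => z; rewrite /disc eA eB !polarDl !polarDm !polarZl !polarZm !cub1Dl !cub1Zl !polarZl !polarZm.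
by rewrite !polarxx (polarC c Y X); ring.
Qed.

Variables B0 B1 Q e : V.
Hypothesis bB : lbasis L B0 B1.
Hypotheses (eL : e \notin (L + <[Q]>)%VS) (QL : Q \notin L).
Hypothesis Qan : forall X, X \in L -> X != 0 -> f1 X Q != 0.
Notation pn n := (e + n *: Q).
Notation fib := (fib c B0 B1 Q e).
Notation npar := #|[set n | fib n == 1%N]|.

Lemma par_disc X Y n : lbasis L X Y -> fib n = 1%N -> disc X Y (pn n) = 0.
Proof.
move=> b E; have [Z [ZL Z0 Zp par]] := fib1P sm SL bB eL E.
have [W bZ] := lbasis_l SL ZL Z0; have [k ->] := disc_change bZ b.
by rewrite /disc Zp par ?(lbasisR bZ) // mul0r mul0rn expr0n subrr mulr0.
Qed.

Lemma disc_par X Y n : lbasis L X Y -> 2%:R != 0 :> K -> disc X Y (pn n) = 0 -> fib n = 1%N.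
Proof.
move=> b c2 D; have := fib_le2 sm SL bB eL n; case E: (fib n) => [|[|[|//]]] _ //.
  have Xp := fib0P bB E (lbasisL b) (lbasis_neq0 b).
  have Yp := fib0P bB E (lbasisR b) (lbasis_neq0 (lbasisC b)).
  pose Z := (f1 Y (pn n) *+ 2) *: X + (- pl X Y (pn n)) *: Y.
  have Z0 : Z != 0.
    apply: contraNneq Yp => /(lbasis_comb b)[+ _].
    by rewrite -mulr_natl => /eqP; rewrite mulf_eq0 (negPf c2).
  have ZL : Z \in L by rewrite memvD ?memvZ ?(lbasisL b) ?(lbasisR b).
  have := fib0P bB E ZL Z0; move: D; rewrite /Z /disc; move: (pn n) => z D.
  rewrite !cub1Dl !cub1Zl polarZl polarZm.
  suff -> : (f1 Y z *+ 2) ^+ 2 * f1 X z + f1 Y z *+ 2 * (- pl X Y z * pl X Y z) + (- pl X Y z) ^+ 2 * f1 Y z =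
     - f1 Y z * (pl X Y z ^+ 2 - f1 X z * f1 Y z *+ 4) by rewrite D mulr0 eqxx.
  by ring.
have [A [B [bA Ap Bp]]] := fib2P SL bB E; have [k h] := disc_change b bA.
have := smooth_quadratic sm SL bA (plane_notin eL n) Ap Bp; rewrite -sqrf_eq0.
by have := h (pn n); rewrite D mulr0 /disc Ap mul0r mul0rn subr0 => ->; rewrite eqxx.
Qed.

Lemma disc_square X Y n : lbasis L X Y -> fib n != 0%N -> exists z, disc X Y (pn n) = z ^+ 2.
Proof.
move=> b E; have := fib_le2 sm SL bB eL n; case E': (fib n) E => [|[|[|//]]] // _ _.
  by exists 0; rewrite (par_disc b E') expr0n.
have [A [B [bA Ap Bp]]] := fib2P SL bB E'; have [k ->] := disc_change bA b.
by exists (k * pl A B (pn n)); rewrite /disc Ap mul0r mul0rn subr0 exprMn.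
Qed.

Lemma disc_aniso X Y : lbasis L X Y -> 2%:R != 0 :> K -> disc X Y Q != 0.
Proof.
move=> b c2; apply/eqP => D.
have Yp := Qan (lbasisR b) (lbasis_neq0 (lbasisC b)).
pose Z := (f1 Y Q *+ 2) *: X + (- pl X Y Q) *: Y.
have Z0 : Z != 0.
  apply: contraNneq Yp => /(lbasis_comb b)[+ _].
  by rewrite -mulr_natl => /eqP; rewrite mulf_eq0 (negPf c2).
have ZL : Z \in L by rewrite memvD ?memvZ ?(lbasisL b) ?(lbasisR b).
have := Qan ZL Z0; rewrite /Z.
rewrite !cub1Dl !cub1Zl polarZl polarZm.
suff -> : (f1 Y Q *+ 2) ^+ 2 * f1 X Q + f1 Y Q *+ 2 * (- pl X Y Q * pl X Y Q) + (- pl X Y Q) ^+ 2 * f1 Y Q =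
     - f1 Y Q * disc X Y Q by rewrite D mulr0 eqxx.
by rewrite /disc; ring.
Qed.

(** Without its middle term the form is, in characteristic two, the square of a linear form, which
    has a rational zero. *)
Lemma polar_aniso X Y : lbasis L X Y -> 2%:R = 0 :> K -> pl X Y Q != 0.
Proof.
move=> b c2; apply/eqP => P0.
have Xp := Qan (lbasisL b) (lbasis_neq0 b).
have [x xE] := sqrt_char2 (f1 Y Q) c2; have [y yE] := sqrt_char2 (f1 X Q) c2.
pose Z := x *: X + y *: Y.
have Z0 : Z != 0.
  apply: contraNneq Xp => /(lbasis_comb b)[_ y0].
  by rewrite yE y0 expr0n.
have ZL : Z \in L by rewrite memvD ?memvZ ?(lbasisL b) ?(lbasisR b).
have := Qan ZL Z0; rewrite /Z !cub1Dl !cub1Zl polarZl polarZm P0 -xE -yE.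
by rewrite !mulr0 addr0 mulrC -mulr2n -mulr_natl c2 mul0r eqxx.
Qed.

(** The discriminant is quadratic in [n] with leading coefficient [disc B0 B1 Q], which is nonzero;
    and [npar] has the parity of q + 1. *)
Lemma npar_odd : 2%:R != 0 :> K -> npar = 0%N \/ exists n1 n2, [/\ n1 != n2, fib n1 = 1%N & fib n2 = 1%N] /\ npar = 2%N.
Proof.
move=> c2; pose P : {poly K} := Poly [:: disc B0 B1 e;
   (pl B0 B1 e * pl B0 B1 Q) *+ 2 - (f1 B0 e * f1 B1 Q + f1 B0 Q * f1 B1 e) *+ 4; disc B0 B1 Q].
have P0 : P != 0.
  apply/eqP => /(congr1 (fun z : {poly K} => z`_2)); rewrite coef_Poly coef0 /= => /eqP.
  by rewrite (negPf (disc_aniso bB c2)).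
have le2 : (npar <= 2)%N.
  have := card_nonroot P0 (size_Poly _); rewrite -[#|K|](cardsC (nonroots P)) leq_add2l.
  apply: leq_trans; apply/subset_leq_card/subsetP => n; rewrite !inE negbK => /eqP E.
  rewrite horner_Poly /=; apply/eqP; rewrite -[RHS](par_disc bB E) /disc.
  by rewrite !polarDr !polarZr !cub1Dr !cub1Zr; ring.
have par' : ~~ odd npar.
  have [par _] := card_fibres sm SL bB eL Qan; have [M' M'E] := card_odd c2; move: par; rewrite M'E.
  move: #|[set n | fib n == 2%N]| npar => x y; clear; lia.
have [e0|e2] : npar = 0%N \/ npar = 2%N.
  by move: le2 par'; case: npar => [|[|[|]]] //; auto.
  by left.
right; have /card_gt1P[n1 [n2 [+ + ne]]] : (1 < npar)%N by rewrite e2.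
by rewrite !inE => /eqP E1 /eqP E2; exists n1, n2.
Qed.

(** The discriminant is here the square of the polar form, which is linear in [n]; and q + 1 is
    odd. *)
Lemma npar_even : 2%:R = 0 :> K -> npar = 1%N.
Proof.
move=> c2; pose P : {poly K} := Poly [:: pl B0 B1 e; pl B0 B1 Q].
have P0 : P != 0.
  apply/eqP => /(congr1 (fun z : {poly K} => z`_1)); rewrite coef_Poly coef0 /= => /eqP.
  by rewrite (negPf (polar_aniso bB c2)).
have le1 : (npar <= 1)%N.
  have := card_nonroot P0 (size_Poly _); rewrite -[#|K|](cardsC (nonroots P)) leq_add2l.
  apply: leq_trans; apply/subset_leq_card/subsetP => n; rewrite !inE negbK => /eqP E.
  have := par_disc bB E; rewrite /disc -mulr_natl.
  have -> : 4%:R = 2%:R * 2%:R :> K by ring.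
  rewrite c2 !mul0r subr0 => /eqP; rewrite sqrf_eq0 polarDr polarZr => /eqP h.
  by rewrite horner_Poly /= mul0r add0r addrC mulrC h.
have [par _] := card_fibres sm SL bB eL Qan; have [k kE] := card_even c2.
move: par; rewrite kE; have : (1 < 2 ^ k)%N by rewrite -kE finNzRing_gt1.
case: k {kE} => // k _; rewrite expnS.
move: le1; move: #|[set n | fib n == 2%N]| npar (2 ^ k)%N => x y z; clear; lia.
Qed.

Lemma npar_le2 : (npar <= 2)%N.
Proof.
have [c2|c2] := eqVneq (2%:R : K) 0; first by rewrite npar_even.
by have [->|[n1 [n2 [_ ->]]]] := npar_odd c2.
Qed.

End Pencil.

Lemma exists_common_nonroot (K : finFieldType) (D : {set K}) (F : K -> {poly K}) d :
  (forall n, n \in D -> F n != 0 /\ (size (F n) <= d.+1)%N) -> (d * #|D| + 1 < #|K|)%N ->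
  exists s, s != 0 /\ forall n, n \in D -> (F n).[s] != 0.
Proof.
move=> FP le; pose P := 'X * \prod_(n in D) F n.
have P0 : P != 0.
  rewrite mulf_neq0 ?polyX_eq0 //; apply/prodf_neq0 => n nD; by case: (FP n nD).
have sP : (size P <= #|K|)%N.
  have sp : (size (\prod_(n in D) F n)%R <= (d * #|D|).+1)%N.
    rewrite -sum1_card big_distrr /=.
    apply: (big_rec2 (fun (x : {poly K}) y => (size x <= y.+1)%N)); first by rewrite size_poly1.
    by move=> n y x nD h; rewrite muln1; apply: size_mul_le h; case: (FP n nD).
  apply: leq_trans le; rewrite addn1 -[X in (_ <= X.+1)%N]add1n.
  have := @size_mul_le _ ('X : {poly K}) (\prod_(n in D) F n) 1 (d * #|D|).
  by rewrite size_polyX add1n; apply.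
have [s] := exists_nonroot P0 sP.
rewrite hornerM hornerX mulf_eq0 negb_or => /andP[s0 hs]; exists s; split=> // n nD.
by move: hs; rewrite horner_prod => /prodf_neq0; apply.
Qed.

Section TangentCurve.
Variables (K : fieldType) (c : 'I_4 -> 'I_4 -> 'I_4 -> K).
Notation f := (cub c).
Notation f1 := (cub1 c).
Notation pl := (polar c).
Variables X Y W : 'rV[K]_4.
(** On the tangent line through [Y] and [w X + W] the cubic is [s t^2 u(w) - t^3 v(w)], where [u] is
    the derivative toward [Y] and [-v] the value of [cub], both at [w X + W]. The residual point is
    at [s = v], [t = u]. *)
Definition curve_u w := f1 X Y * w ^+ 2 + pl X Y W * w + f1 W Y.
Definition curve_v w := - (f1 X W * w ^+ 2 + f1 W X * w + f W).
(* The residual intersections of the surface with its tangent lines at [Y]. *)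
Definition curve w := (curve_u w * w) *: X + curve_v w *: Y + curve_u w *: W.

Hypotheses (fX : f X = 0) (fY : f Y = 0) (YX : f1 Y X = 0) (YW : f1 Y W = 0).

Lemma curve_on w : f (curve w) = 0.
Proof. by rewrite /curve !cubE ?polarE fX fY YX YW /curve_u /curve_v; ring. Qed.

Lemma curve_tangent w : f1 Y (curve w) = 0.
Proof. by rewrite /curve !cub1Dr !cub1Zr YX YW cub1xx fY mul0rn !mulr0 !addr0. Qed.

Lemma curve_dir w : f1 (curve w) Y = curve_u w ^+ 3.
Proof.
rewrite /curve !cubE ?polarE ?cub1xx fY YX YW (polar_perm c X Y W) /curve_u; ring.
Qed.
End TangentCurve.

(* A simple root of [W - t U] would be a simple root of [g], which [e] cannot compensate. *)
Lemma double_root (K : fieldType) (E : closedFieldType) (h : {rmorphism K -> E})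
    (u0 u1 u2 v0 v1 v2 al be ga : K) (e k : {poly K}) (t : E) :
  let U := Poly [:: u0; u1; u2] in let W := Poly [:: v0; v1; v2] in
  let g := al%:P * W ^+ 2 + be%:P * (U * W) + ga%:P * U ^+ 2 in
  e ^+ 3 * g^`() ^+ 2 = g * k ->
  h al * t ^+ 2 + h be * t + h ga = 0 -> be ^+ 2 - al * ga *+ 4 != 0 ->
  (forall w, (map_poly h U).[w] = 0 -> (map_poly h W).[w] = 0 -> False) ->
  (forall w, (map_poly h W).[w] = t * (map_poly h U).[w] -> (map_poly h e).[w] != 0) ->
  h v2 - t * h u2 != 0 ->
  (h v1 - t * h u1) ^+ 2 = (h v2 - t * h u2) * (h v0 - t * h u0) *+ 4.
Proof.
move=> U W g eg tE D0 nc ne le0; apply/eqP; apply/negPn/negP => dne.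
set A := h v2 - _ in le0 dne *; set B := h v1 - _ in dne *; set C := h v0 - _ in dne *.
have [w wE] : exists w, A * w ^+ 2 + B * w + C = 0.
  have [w wE] := @solve_monicpoly E 2 (fun i => if i is 0 then - C / A else - B / A) isT.
  by exists w; rewrite wE !big_ord_recl big_ord0 /=; field.
have UE : (map_poly h U).[w] = h u2 * w ^+ 2 + h u1 * w + h u0.
  by rewrite map_Poly horner_Poly /=; ring.
have WE : (map_poly h W).[w] = h v2 * w ^+ 2 + h v1 * w + h v0.
  by rewrite map_Poly horner_Poly /=; ring.
have dE (x y z : K) : (map_poly h (Poly [:: x; y; z])^`()).[w] = h z * w *+ 2 + h y.
  have -> : (Poly [:: x; y; z])^`() = Poly [:: y; z *+ 2].
    by apply/polyP => i; rewrite coef_deriv !coef_Poly; case: i => [|[|[|i]]] //=; rewrite mul0rn.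
  by rewrite map_Poly horner_Poly /= rmorphMn; ring.
have dU := dE u0 u1 u2 : (map_poly h U^`()).[w] = _; have dW := dE v0 v1 v2 : (map_poly h W^`()).[w] = _.
clearbody U W.
have Wt : (map_poly h W).[w] = t * (map_poly h U).[w].
  by rewrite UE WE; apply/eqP; rewrite -subr_eq0 -wE /A /B /C; apply/eqP; ring.
have e0 := ne w Wt.
have U0 : (map_poly h U).[w] != 0.
  by apply/eqP => U0; apply: (nc w) => //; rewrite Wt U0 mulr0.
have g0 : (map_poly h g).[w] = 0.
  rewrite /g !(rmorphD, rmorphM, rmorphXn) /= !map_polyC !(hornerD, hornerM, horner_exp, hornerC) Wt.
  transitivity ((map_poly h U).[w] ^+ 2 * (h al * t ^+ 2 + h be * t + h ga)); first by ring.
  by rewrite tE mulr0.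
(* The derivative of [g] splits into [U], the derivative of the quadratic at [t] and the derivative
   of [W - t U] at [w]; none of them vanishes. *)
have g'E : (map_poly h g^`()).[w] = (map_poly h U).[w] * (h al * t *+ 2 + h be) * (A * w *+ 2 + B).
  rewrite /g !derivD !expr2 !derivM !derivC !mul0r !add0r.
  rewrite !(rmorphD, rmorphM) /= !map_polyC !(hornerD, hornerM, hornerC) Wt dU dW.
  apply/eqP; rewrite -subr_eq0 -[X in _ == X](mulr0 ((map_poly h U).[w] * (h u2 * w *+ 2 + h u1) *+ 2)) -tE.
  by apply/eqP; rewrite /A /B; ring.
have /(congr1 (fun P => (map_poly h P).[w])) := eg.
rewrite rmorphM !rmorphXn rmorphM /= hornerM !horner_exp hornerM g0 g'E mul0r => /eqP.
have d1 : (h al * t *+ 2 + h be) ^+ 2 = h (be ^+ 2 - al * ga *+ 4).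
  rewrite rmorphB rmorphMn rmorphXn rmorphM.
  have -> : h ga = - h al * t ^+ 2 - h be * t.
    by apply/eqP; rewrite -subr_eq0 -tE; apply/eqP; ring.
  by ring.
have d2 : (A * w *+ 2 + B) ^+ 2 = B ^+ 2 - A * C *+ 4.
  have -> : C = - A * w ^+ 2 - B * w.
    by apply/eqP; rewrite -subr_eq0 -wE; apply/eqP; ring.
  by ring.
rewrite mulf_eq0 !expf_eq0 (negPf e0) /= !mulf_eq0 (negPf U0) /= -sqrf_eq0 d1 fmorph_eq0 (negPf D0) /=.
by rewrite -sqrf_eq0 d2 subr_eq0 (negPf dne).
Qed.

Lemma conic_expand (R : comNzRingType) (c : 'I_4 -> 'I_4 -> 'I_4 -> R) (X Y p : 'rV[R]_4) x y :
  cub c X = 0 -> cub c Y = 0 -> cub1 c X Y = 0 -> cub1 c Y X = 0 ->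
  let v := p + x *: X + y *: Y in
  [/\ cub c v = cub c p + x * cub1 c p X + y * cub1 c p Y + x ^+ 2 * cub1 c X p
        + x * y * polar c X Y p + y ^+ 2 * cub1 c Y p,
      cub1 c v X = cub1 c p X + x * cub1 c X p *+ 2 + y * polar c X Y p & cub1 c X v = cub1 c X p].
Proof.
move=> fX fY XY YX v; rewrite /v; split; rewrite !cubE ?polarE ?cub1xx ?(polar_perm c X Y p) fX ?fY ?XY ?YX; ring.
Qed.

(* Comparing the tangent curves at the parameters [s] and [-s]: both give a vanishing discriminant at *)
(* the same root [t], which forces the conic there to be a double line. *)
Lemma double_shift (R : comNzRingType) (t z A B C0 F G N : R) :
  F ^+ 2 = A * N *+ 4 -> B ^+ 2 = A * C0 *+ 4 ->
  (F + t *+ 2 * A *+ 2 + z * B) ^+ 2 =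
    A * (N + t *+ 2 * F + z * G + (t *+ 2) ^+ 2 * A + t *+ 2 * z * B + z ^+ 2 * C0) *+ 4 ->
  z * (B * F - A * G *+ 2) *+ 2 = 0.
Proof.
move=> FE BE /eqP; rewrite -subr_eq0 => /eqP E.
rewrite -[RHS]E; transitivity (z * (B * F - A * G *+ 2) *+ 2 + (F ^+ 2 - A * N *+ 4) + z ^+ 2 * (B ^+ 2 - A * C0 *+ 4)).
  by rewrite FE BE; ring.
by ring.
Qed.

Lemma fib_shift (K : finFieldType) (c : 'I_4 -> 'I_4 -> 'I_4 -> K) (L : {vspace 'rV[K]_4}) (A B p Q v : 'rV[K]_4) n :
  surface_line c L -> lbasis L A B -> v - Q \in L -> fib c A B v p n = fib c A B Q p n.
Proof.
move=> SL b vQ; apply: eq_card => i; rewrite !inE.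
have iL := pt_in b i; suff -> : cub1 c (pt A B i) (p + n *: v) = cub1 c (pt A B i) (p + n *: Q) by [].
by rewrite !cub1Dr !cub1Zr (an_at SL vQ iL).
Qed.

(** * A nonsplit conic with two points cannot stay ungenerated *)

Section Kill.
Variables (K : finFieldType) (c : 'I_4 -> 'I_4 -> 'I_4 -> K).
Notation V := 'rV[K]_4.
Hypothesis sm : csmooth c.
Notation f := (cub c).
Notation f1 := (cub1 c).
Notation pl := (polar c).
Variable L : {vspace V}.
Hypothesis SL : surface_line c L.
Variables (S : V -> Prop) (Sb : pred V).
Hypothesis SbP : forall v, reflect (S v) (Sb v).
Hypothesis HS : sigma_closed c S.
Hypothesis HL : forall Z, Z \in L -> Z != 0 -> S Z.
Hypothesis HE : forall X r, eckardt c L X r -> S r.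
Hypothesis q8 : (8 <= #|K|)%N.
Implicit Types X Y Z r v : V.
Hypothesis q17 : 2%:R != 0 :> K -> (17 <= #|K|)%N.
Variables X1 X2 p Q : V.
Hypothesis C : center c L X1 X2 p.
Hypothesis fp : f p != 0.
Hypotheses (pQ : p \notin (L + <[Q]>)%VS) (QL : Q \notin L) (fQ : f Q = 0) (nQ : ~ S Q).
Hypothesis Qan : forall X, X \in L -> X != 0 -> f1 X Q != 0.
Hypothesis Qdir : exists2 X, X \in L & f1 Q X != 0.
Let bB := center_basis C.
Let pL := center_notin C.
Let k0 := center_polar sm SL C.
Notation pn n := (p + n *: Q).
Notation fib := (fib c X1 X2 Q p).
Notation npar := #|[set n | fib n == 1%N]|.
Notation conic := (conic c L).
Notation triangle := (triangle c L X1 X2 Q p).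

(* No rational line of the surface other than [L] passes through [X]. *)
Definition good X := forall v, v \notin L -> f v = 0 -> f1 v X = 0 -> f1 X v = 0 -> False.

(** A line of the surface through [X] lies in the tangent plane at [X], where the residual conic is
    smooth. *)
Lemma good_smooth X n : X \in L -> X != 0 -> f1 X (pn n) = 0 -> fib n = 2%N -> ~~ triangle n -> good X.
Proof.
move=> XL X0 Xn E nt v vL fv vX Xv.
have [Y [b Yn]] := fib2_root SL bB E XL X0 Xn.
have [x [y C']] := center_ex sm SL b (plane_notin pQ n) Xn Yn.
have p'in := comb_in (pn n) x y b; move: C' p'in.
set p' := pn n + _ + _ => C' p'in.
have [x' [y' [m [l vE]]]] := lbasis_spans b QL (planes_off n pQ) v.
have m0 : m = 0.
  move: Xv; rewrite vE !cub1Dr !cub1Zr (line_cub1 SL XL XL) (line_cub1 SL XL (lbasisR b)) Xn !mulr0 !add0r addr0.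
  by move/eqP; rewrite mulf_eq0 (negPf (Qan XL X0)) orbF => /eqP.
have l0 : l != 0.
  apply: contraNneq vL => l0; rewrite vE m0 l0 !scale0r !addr0.
  by rewrite memvD ?memvZ ?(lbasisR b).
have {}vE : v = l *: (p' + (x' / l - x) *: X + (y' / l - y) *: Y).
  by rewrite vE m0; apply/rowP => i; rewrite /p' !mxE; field.
have bk : y' / l - y = 0.
  move: vX; rewrite vE cub1Zl (center_dirX SL _ _ C') => /eqP.
  by rewrite !mulf_eq0 (negPf (center_polar sm SL C')) (negPf l0) /= orbF => /eqP.
have fp' : f p' = 0.
  move: fv; rewrite vE bk cubZ (center_cub SL _ _ C') mulr0 mul0r addr0 => /eqP.
  by rewrite !mulf_eq0 (negPf l0) /= => /eqP.
case/negP: nt; rewrite /triangle E eqxx /=; apply/existsP; exists p'.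
by rewrite !(center_dir0 C') ?(lbasisL bB) ?(lbasisR bB) // eqxx !andbT; apply/conicP.
Qed.

Section AtPoint.
Variable s : K.
Hypothesis s0 : s != 0.
Let a := f p / pl X1 X2 p.
(* [tan_pt] runs over the conic of the plane of [p], and its tangent there meets [L] in [tan_dir]. *)
Definition tan_dir := s *: X1 + (a / s) *: X2.
Definition tan_pt := p + s *: X1 + (- (a / s)) *: X2.
Notation X := tan_dir.
Notation Y := tan_pt.
(** [Q] moved along [X1] into the tangent plane at [tan_pt], which is spanned by [tan_pt], [tan_dir]
    and this vector. *)
Definition tan_vec := Q - (f1 Y Q / f1 Y X1) *: X1.
Notation W := tan_vec.
Let X1L := lbasisL bB.
Let X2L := lbasisR bB.

Lemma tan_dir_in : X \in L.
Proof. by rewrite memvD ?memvZ. Qed.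

Lemma tan_dir_neq0 : X != 0.
Proof. by apply/eqP => /(lbasis_comb bB)[/eqP]; rewrite (negPf s0). Qed.

Lemma tan_dir_basis : lbasis L X X1.
Proof.
have a0 : a / s != 0 by rewrite !mulf_neq0 ?invr_eq0.
have := @lbasis_change _ _ _ SL X1 X2 s (a / s) 1 0 bB.
by rewrite scale1r scale0r addr0 mulr0 mulr1 sub0r oppr_eq0; apply.
Qed.

Lemma tan_ptX1 : f1 Y X1 = - (f p / s).
Proof. by rewrite (center_dirX SL _ _ C) /a; field; rewrite ?k0 ?s0. Qed.

Lemma tan_ptX1_neq0 : f1 Y X1 != 0.
Proof. by rewrite tan_ptX1 oppr_eq0 mulf_neq0 ?invr_eq0. Qed.

Lemma tan_pt_on : f Y = 0.
Proof. by rewrite (center_cub SL _ _ C) /a; field; rewrite ?k0 ?s0. Qed.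

Lemma tan_pt_S : S Y.
Proof. by apply: (cover_center sm SL HS HL C); rewrite ?s0 // tan_pt_on. Qed.

Lemma tan_ptX : f1 Y X = 0.
Proof. by rewrite cub1Dr !cub1Zr (center_dirX SL _ _ C) (center_dirY SL _ _ C) /a; field; rewrite ?k0 ?s0. Qed.

Lemma tan_dirp : f1 X p = f p.
Proof.
by rewrite cub1Dl !cub1Zl polarZl polarZm (center_qX C) (center_qY C) /a; field; rewrite ?k0 ?s0.
Qed.

Lemma tan_dirY : f1 X Y = f p.
Proof. by rewrite (line_conicE SL _ _ _ bB tan_dir_in) tan_dirp. Qed.

Lemma tan_ptW : f1 Y W = 0.
Proof. by rewrite /tan_vec -scaleNr cub1Dr cub1Zr mulNr divfK ?subrr ?tan_ptX1_neq0. Qed.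

Lemma tan_vecQ : W - Q \in L.
Proof. by rewrite /tan_vec addrAC subrr add0r memvN memvZ. Qed.

Lemma tan_dirW : f1 X W = f1 X Q.
Proof.
by rewrite -[W](subrK Q) cub1Dr (line_cub1 SL tan_dir_in tan_vecQ) add0r.
Qed.

Notation u := (curve_u c X Y W).
Notation v := (curve_v c X W).
Notation r := (curve c X Y W).

(** So [u w / v w] is the parameter of the plane that contains the point of the curve. *)
Lemma curve_plane w : r w - (v w *: p + u w *: Q) \in L.
Proof.
have -> : r w - (v w *: p + u w *: Q) = (u w * w) *: X + v w *: (Y - p) + u w *: (W - Q).
  by rewrite /curve; move: (u w) (v w) X Y W => x y X Y W; apply/rowP => i; rewrite !mxE; ring.
by rewrite !memvD ?memvZ ?tan_dir_in ?tan_vecQ ?(comb_in _ _ _ bB).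
Qed.

Lemma curveP w : f (r w) = 0 /\ (u w != 0 -> S (r w)).
Proof.
have fX := line_cub SL tan_dir_in.
have fr := curve_on fX tan_pt_on tan_ptX tan_ptW w; split=> // u0.
apply: (cl_tangent HS tan_pt_S) => //; first exact: (curve_tangent tan_pt_on tan_ptX tan_ptW).
by rewrite (curve_dir tan_pt_on tan_ptX tan_ptW) expf_neq0.
Qed.

(** A zero of [v] alone would be a generated point on the conic of [Q], and [an_spread] would
    generate [Q]. *)
Lemma curve_v0 w : v w = 0 -> u w = 0.
Proof.
move=> v0; apply/eqP/negP => /negP u0; have [fr /(_ u0) Sr] := curveP w; apply: nQ.
have iC : (u w)^-1 *: r w \in conic Q.
  apply/conicP; split; last by rewrite cubZ fr mulr0.
  have := memvZ (u w)^-1 (curve_plane w).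
  by rewrite v0 scale0r add0r scalerBr scalerA mulVf ?scale1r.
apply: (an_spread SL HS HL bB Qan iC); last by apply: (cl_scale HS); rewrite ?invr_eq0.
by apply/conicP; rewrite subrr mem0v.
Qed.

Lemma curve_hit w : v w != 0 -> exists r, r \in conic (pn (u w / v w)) /\ (u w != 0 -> S r).
Proof.
move=> v0; have [fr Sr] := curveP w; exists ((v w)^-1 *: r w); split.
  apply/conicP; split; last by rewrite cubZ fr mulr0.
  move: (curve_plane w); move: (r w) => t /(memvZ (v w)^-1).
  by rewrite scalerBr scalerDr !scalerA mulVf // scale1r [_ / _]mulrC.
by move=> u0; apply: (cl_scale HS); rewrite ?invr_eq0 //; exact: Sr.
Qed.

Hypothesis gX : good X.

(** If [u] and [v] are proportional, the line joining [X] to [al Y - be W] lies on the surface,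
    against [good X]. *)
Lemma curve_nonprop al be : f1 X Y * al = f1 X W * be -> pl X Y W * al = f1 W X * be ->
  f1 W Y * al = f W * be -> (al != 0) || (be != 0) -> False.
Proof.
move=> e1 e2 e3 ab; have fX := line_cub SL tan_dir_in.
apply: (gX (v := al *: Y + (- be) *: W)).
- have [al0|al0] := eqVneq al 0.
    rewrite al0 scale0r add0r scaleNr memvN; rewrite al0 eqxx /= in ab.
    apply: contraNN QL => /(memvZ be^-1); rewrite scalerA mulVf // scale1r => WL.
    by rewrite -[Q](subKr W) memvB // tan_vecQ.
  apply: contraNN pQ => h.
  have -> : p = al^-1 *: (al *: Y + (- be) *: W) - (Y - p) + (be / al) *: (W - Q) + (be / al) *: Q.
    by move: Y W => Y W; apply/rowP => i; rewrite !mxE; field.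
  have sub : (L <= L + <[Q]>)%VS := addvSl _ _.
  have subQ : (<[Q]> <= L + <[Q]>)%VS := addvSr _ _.
  apply: memvD; last by rewrite (subvP subQ) // memvZ // memv_line.
  apply: memvD; last by rewrite (subvP sub) // memvZ // tan_vecQ.
  by apply: memvB; [rewrite (subvP sub) // memvZ|rewrite (subvP sub) // (comb_in _ _ _ bB)].
- move: e3 tan_pt_on tan_ptW; move: Y W => Y W e3 fY YW; rewrite !cubE ?polarE fY YW.
  transitivity (be ^+ 2 * (f1 W Y * al - f W * be)); first by ring.
  by rewrite e3 subrr mulr0.
- move: e2 tan_ptX; move: X Y W => X Y W e2 YX; rewrite !cubE YX (polar_perm c X Y W).
  transitivity (- be * (pl X Y W * al - f1 W X * be)); first by ring.
  by rewrite e2 subrr mulr0.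
rewrite !cub1Dr !cub1Zr; transitivity (f1 X Y * al - f1 X W * be); first by ring.
by rewrite e1 subrr.
Qed.

Variable G : {set K}.
Hypothesis GP : forall n, n \in G -> fib n = 0%N /\ (2 <= #|conic (pn n)|)%N.
Hypothesis G3 : (3 <= #|G|)%N.

Lemma fib_p : fib 0 = 2%N.
Proof. by apply: (fib_split sm SL bB pQ bB); rewrite scale0r addr0 ?(center_qX C) ?(center_qY C). Qed.

Lemma curve_avoid n w : n \in G -> v w != 0 -> u w != n * v w.
Proof.
move=> nG v0; apply/eqP => uE; have [E big] := GP nG.
have n0 : n != 0 by apply: contra_eq_neq E => ->; rewrite fib_p.
have u0 : u w != 0 by rewrite uE mulf_neq0.
have [r [rC /(_ u0) Sr]] := curve_hit v0; rewrite uE mulfK // in rC.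
have /card_gt1P[z [z' [zC z'C zz']]] := big.
have [t tC rt] : exists2 t, t \in conic (pn n) & r != t.
  by have [rz|rz] := eqVneq r z; [exists z'; rewrite // rz|exists z].
exact: (not_killed sm SL SbP HS HL HE q8 bB pQ QL fQ nQ Qan Qdir E rC tC rt Sr).
Qed.

(** After cancelling a common root, [u / v] is a quotient of linear polynomials, hence proportional
    or a homography. A homography reaches one of the three forbidden planes. *)
Lemma curve_no_common w0 : u w0 = 0 -> v w0 = 0 -> False.
Proof.
move=> u0 v0; set a0 := f1 X Y; have A0 : a0 != 0 by rewrite /a0 tan_dirY.
pose b0 := pl X Y W + a0 * w0; pose a1 := f1 X W; pose b1 := f1 W X + a1 * w0.
have uE w : u w = (w - w0) * (a0 * w + b0).
  by rewrite -[LHS]subr0 -u0 /curve_u /b0 -/a0; ring.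
have vE w : v w = - ((w - w0) * (a1 * w + b1)).
  by rewrite -[LHS]subr0 -v0 /curve_v /b1 -/a1; ring.
have prop w1 : a0 * w1 + b0 = 0 -> a1 * w1 + b1 = 0 -> False.
  move=> h0 h1; have g2 : f1 W Y = - w0 * b0.
    by apply/eqP; rewrite -subr_eq0 -u0 /curve_u /b0 -/a0; apply/eqP; ring.
  have g3 : f W = - w0 * b1.
    apply/eqP; rewrite -subr_eq0 -oppr_eq0 -v0 /curve_v /b1 -/a1; apply/eqP; ring.
  have d1 : pl X Y W = b0 - a0 * w0 by rewrite /b0; ring.
  have d2 : f1 W X = b1 - a1 * w0 by rewrite /b1; ring.
  have b0E : b0 = - a0 * w1 by apply/eqP; rewrite -subr_eq0 -h0; apply/eqP; ring.
  have b1E : b1 = - a1 * w1 by apply/eqP; rewrite -subr_eq0 -h1; apply/eqP; ring.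
  apply: (@curve_nonprop a1 a0); rewrite ?A0 ?orbT // -/a0 -/a1.
  - by ring.
  - by rewrite d1 d2 b0E b1E; ring.
  by rewrite g2 g3 b0E b1E; ring.
pose A := a0 * w0 + b0; pose B := a1 * w0 + b1.
(* [D1] holds the value taken at infinity and [D2] the value taken at the cancelled root [w0]. *)
pose D1 := [set n | a0 + n * a1 == 0]; pose D2 := [set n | A + n * B == 0].
have c1 : (#|D1| <= 1)%N.
  apply/card_le1_eqP => m n; rewrite !inE => /eqP hm /eqP hn.
  have [a10|a10] := eqVneq a1 0; first by rewrite a10 mulr0 addr0 in hm; rewrite hm eqxx in A0.
  by apply: (mulIf a10); apply: (addrI a0); rewrite hm hn.
have c2 : (#|D2| <= 1)%N.
  apply/card_le1_eqP => m n; rewrite !inE => /eqP hm /eqP hn.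
  have [B0|B0] := eqVneq B 0; last by apply: (mulIf B0); apply: (addrI A); rewrite hm hn.
  by case: (@prop w0) => //; move: hm; rewrite B0 mulr0 addr0.
have [n nG nD] : exists2 n, n \in G & n \notin D1 :|: D2.
  apply/subsetPn; apply: contraL G3 => /subset_leq_card h; rewrite -ltnNge.
  apply: leq_ltn_trans h _; apply: leq_ltn_trans (leq_card_setU _ _) _.
  by move: c1 c2; move: #|D1| #|D2| => x y; clear; lia.
move: nD; rewrite !inE negb_or => /andP[n1 n2].
pose w1 := - (b0 + n * b1) / (a0 + n * a1).
have w1E : a0 * w1 + b0 = - (n * (a1 * w1 + b1)) by rewrite /w1; field.
have uv : u w1 = n * v w1 by rewrite uE vE w1E; ring.
have w10 : w1 != w0.
  apply: contra_neq n2 => e; rewrite /A /B -e w1E; ring.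
have [v1|v1] := eqVneq (v w1) 0; last by have := curve_avoid nG v1; rewrite uv eqxx.
move: v1; rewrite vE => /eqP; rewrite oppr_eq0 mulf_eq0 subr_eq0 (negPf w10) /= => /eqP h1.
by apply: (prop w1) => //; rewrite w1E h1 mulr0 oppr0.
Qed.

Lemma curve_vn0 w : v w != 0.
Proof. by apply/eqP => v0; exact: (curve_no_common (curve_v0 v0) v0). Qed.

End AtPoint.
Let TR := card_triangles sm SL SbP HS HL HE q8 bB pQ QL fQ nQ Qan Qdir.

Definition bad := [set n | (fib n == 1%N) || triangle n].

Lemma card_bad : (#|bad| <= 3)%N.
Proof.
have -> : bad = [set n | fib n == 1%N] :|: [set n | triangle n] by apply/setP => n; rewrite !inE.
apply: leq_trans (leq_card_setU _ _) _; have [t2 t1] := TR; move: (npar_le2 sm SL bB pQ Qan) t2 t1.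
by move: npar #|[set n | triangle n]| => x y; clear; lia.
Qed.

(** For a bad plane, the [s] with [tan_dir s] on its conic are roots of a quartic in even powers of
    [s]. Three bad planes exclude at most 12 nonzero values; in characteristic two only [s^2]
    matters, and at most 6 are excluded. *)
Lemma exists_good : exists s, [/\ s != 0, good (tan_dir s) & forall n, fib n = 1%N -> f1 (tan_dir s) (pn n) != 0].
Proof.
suff [s [s0 sP]] : exists s : K, s != 0 /\ forall n, n \in bad -> f1 (tan_dir s) (pn n) != 0.
  exists s; split=> //; last by move=> n E; apply: sP; rewrite inE E.
  have XL := tan_dir_in s; have X0 := tan_dir_neq0 s0.
  have [n Xn] := plane_through p Qan XL X0.
  have nb : n \notin bad by apply/negP => /sP; rewrite Xn eqxx.
  move: nb; rewrite inE negb_or => /andP[n1 nt].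
  apply: (good_smooth XL X0 Xn) => //.
  have := fib_le2 sm SL bB pQ n; case E: (fib n) n1 => [|[|[|//]]] // _ _.
  by have := fib0P bB E XL X0; rewrite Xn eqxx.
pose a := f p / pl X1 X2 p.
have a0 : a != 0 by rewrite mulf_neq0 ?invr_eq0.
have tE s n : s != 0 -> f1 (tan_dir s) (pn n) * s ^+ 2 =
    f1 X1 (pn n) * s ^+ 4 + a * pl X1 X2 (pn n) * s ^+ 2 + a ^+ 2 * f1 X2 (pn n).
  by move=> s0; rewrite /tan_dir cub1Dl !cub1Zl polarZl polarZm -/a; field.
clearbody a.
have nz n x y z : x = f1 X1 (pn n) -> y = a * pl X1 X2 (pn n) -> z = a ^+ 2 * f1 X2 (pn n) -> ~ [/\ x = 0, y = 0 & z = 0].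
  move=> -> -> -> [h1 /eqP h2 /eqP h3]; move: h2 h3.
  rewrite !mulf_eq0 (negPf a0) /= => /eqP h2 /eqP h3.
  by have := smooth_quadratic sm SL bB (plane_notin pQ n) h1 h3; rewrite h2 eqxx.
have [c2|c2] := eqVneq (2%:R : K) 0.
  pose F n : {poly K} := Poly [:: a ^+ 2 * f1 X2 (pn n); a * pl X1 X2 (pn n); f1 X1 (pn n)].
  have [|//|u [u0 uP]] := @exists_common_nonroot K bad F 2.
    move=> n _; split; last exact: size_Poly.
    apply/eqP => F0; apply: (@nz n _ _ _ (erefl _) (erefl _) (erefl _)).
    by have := F0 => /polyP F0'; move: (F0' 0%N) (F0' 1%N) (F0' 2%N); rewrite /F !coef_Poly !coef0 /= => -> -> ->.
    by apply: leq_ltn_trans q8; move: card_bad; move: #|bad| => x; clear; lia.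
  have [s sE] := sqrt_char2 u c2; have s0 : s != 0 by apply: contraNneq u0 => s0; rewrite sE s0 expr0n.
  exists s; split=> // n nb; have := uP n nb; rewrite /F horner_Poly /= => h.
  apply: contraNneq h => h; have := tE s n s0; rewrite h mul0r => e0.
  by apply/eqP; rewrite [RHS]e0 sE; ring.
pose F n : {poly K} := Poly [:: a ^+ 2 * f1 X2 (pn n); 0; a * pl X1 X2 (pn n); 0; f1 X1 (pn n)].
have [||s [s0 sP]] := @exists_common_nonroot K bad F 4.
- move=> n _; split; last exact: size_Poly.
  apply/eqP => F0; apply: (@nz n _ _ _ (erefl _) (erefl _) (erefl _)).
  by have := F0 => /polyP F0'; move: (F0' 0%N) (F0' 2%N) (F0' 4%N); rewrite /F !coef_Poly !coef0 /= => -> -> ->.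
- by apply: leq_trans (q17 c2); move: card_bad; move: #|bad| => x; clear; lia.
exists s; split=> // n nb; have := sP n nb; rewrite /F horner_Poly /= => h.
apply: contraNneq h => h; have := tE s n s0; rewrite h mul0r => e0.
by apply/eqP; rewrite [RHS]e0; ring.
Qed.

Definition bigs := [set n | (fib n == 0%N) && (2 <= #|conic (pn n)|)%N].

Lemma bigsP n : n \in bigs -> fib n = 0%N /\ (2 <= #|conic (pn n)|)%N.
Proof. by rewrite inE => /andP[/eqP]. Qed.

Lemma card_bigs : (3 <= #|bigs|)%N.
Proof.
have [h1 h2] := card_fibres sm SL bB pQ Qan.
pose sml := [set n | (fib n == 0%N) && (#|conic (pn n)| <= 1)%N].
have s1 : (#|sml| <= 1)%N.
  apply/card_le1_eqP => m n; rewrite !inE => /andP[/eqP Em sm'] /andP[/eqP En sn].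
  exact: (esym (small_unique sm SL SbP HS HL HE q8 bB pQ QL fQ nQ Qan Qdir Em En sm' sn)).
have h3 : #|[set n | fib n == 0%N]| = (#|bigs| + #|sml|)%N.
  rewrite !card_pred_sum -big_split /=; apply: eq_bigr => n _; rewrite [(2 <= _)%N]ltnNge.
  by case: (fib n == 0%N) => //=; case: (_ <= 1)%N.
have [c2|c2] := eqVneq (2%:R : K) 0.
  have s0 : #|sml| = 0%N.
    apply/eqP; rewrite cards_eq0 -subset0; apply/subsetP => n; rewrite !inE => /andP[/eqP E sn].
    have := no_small sm SL SbP HS HL HE q8 bB pQ QL fQ nQ Qan Qdir E.
    by rewrite (npar_even sm SL bB pQ Qan c2) => /(_ isT); rewrite ltnNge sn.
  move: h1 h2 h3; rewrite s0 (npar_even sm SL bB pQ Qan c2); move: q8.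
  by move: #|[set n | fib n == 0%N]| #|[set n | fib n == 2%N]| #|bigs| #|K| => x y z t; clear; lia.
move: h1 h2 h3 s1 (npar_le2 sm SL bB pQ Qan) (q17 c2).
by move: #|[set n | fib n == 0%N]| #|[set n | fib n == 2%N]| #|bigs| #|K| #|sml| npar => x y z t u v; clear; lia.
Qed.

Let D2 := disc c X1 X2 p.
Let D1 := (pl X1 X2 p * pl X1 X2 Q) *+ 2 - (f1 X1 p * f1 X2 Q + f1 X1 Q * f1 X2 p) *+ 4.
Let D0 := disc c X1 X2 Q.

Section Odd.
Hypothesis c2 : 2%:R != 0 :> K.

Section Parabolic.
Hypothesis empty_parabolic : forall n r, fib n = 1%N -> r \in conic (pn n) -> False.
Variables (E : closedFieldType) (h : {rmorphism K -> E}).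

Lemma disc_comb m n : disc c X1 X2 (m *: p + n *: Q) = D2 * m ^+ 2 + D1 * (m * n) + D0 * n ^+ 2.
Proof. by rewrite /D2 /D1 /D0 /disc !polarDr !polarZr !cub1Dr !cub1Zr; ring. Qed.

Lemma disc_pn n : disc c X1 X2 (pn n) = D2 + D1 * n + D0 * n ^+ 2.
Proof. by rewrite -[X in X + _]scale1r disc_comb; ring. Qed.

(* The planes of the pencil, over the algebraic closure, whose conic is tangent to [L]. *)
Definition parabolic_root t := h D2 * t ^+ 2 + h D1 * t + h D0 = 0.

Lemma parabolic_root_rat t : parabolic_root (h t) -> t != 0 /\ fib t^-1 = 1%N.
Proof.
rewrite /parabolic_root -!(rmorphXn, rmorphM, rmorphD) /= => /eqP; rewrite fmorph_eq0 => /eqP e0.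
have t0 : t != 0.
  apply: contraNneq (disc_aniso Qan bB c2) => t0; rewrite -/D0 -[X in _ == X]e0 t0; apply/eqP; ring.
split=> //; apply: (disc_par sm SL bB pQ bB c2).
rewrite disc_pn; apply: (mulfI (expf_neq0 2 t0)); rewrite mulr0 -[RHS]e0; by field.
Qed.

Section Curve.
Variable s : K.
Hypotheses (s0 : s != 0) (gX : good (tan_dir s)).
Notation X := (tan_dir s).
Notation Y := (tan_pt s).
Notation W := (tan_vec s).
Notation u := (curve_u c X Y W).
Notation v := (curve_v c X W).

Let vn0 w : v w != 0 :=
  curve_vn0 s0 gX
   bigsP card_bigs w.

(** Parabolic planes are excluded because they have no points, nonsplit planes with two points by
    [curve_avoid]. *)
Lemma curve_fib w : fib (u w / v w) = 2%N \/ fib (u w / v w) = 0%N /\ (#|conic (pn (u w / v w))| <= 1)%N.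
Proof.
have := fib_le2 sm SL bB pQ (u w / v w); case E0: (fib (u w / v w)) => [|[|[|//]]] _; last by left.
  right; split=> //; rewrite leqNgt; apply/negP => big.
  have nB : u w / v w \in bigs by rewrite inE E0.
  have := curve_avoid s0 bigsP nB (vn0 w).
  by rewrite divfK ?eqxx.
by have [r [rC _]] := curve_hit s0 (vn0 w); case: (empty_parabolic E0 rC).
Qed.

Let U := Poly [:: f1 W Y; pl X Y W; f1 X Y].
Let V' := Poly [:: - f W; - f1 W X; - f1 X W].

Let UE w : U.[w] = u w.
Proof. by rewrite horner_Poly /curve_u /=; ring. Qed.
Let VE w : V'.[w] = v w.
Proof. by rewrite horner_Poly /curve_v /=; ring. Qed.

(** The discriminant along the curve is a nonzero square except at the at most one nonsplit plane
    with at most one point; there the factor [e] vanishes. *)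
Lemma curve_stepanov : exists e k, (e = 1 \/ exists n, fib n = 0%N /\ e = U - n%:P * V') /\
  let g := D2%:P * V' ^+ 2 + D1%:P * (U * V') + D0%:P * U ^+ 2 in e ^+ 3 * g^`() ^+ 2 = g * k.
Proof.
set g := D2%:P * V' ^+ 2 + D1%:P * (U * V') + D0%:P * U ^+ 2.
have [M qE] := card_odd c2.
have gE w : g.[w] = disc c X1 X2 (v w *: p + u w *: Q).
  by rewrite disc_comb /g !(hornerD, hornerM, hornerC, horner_exp) UE VE; ring.
have sU : (size U <= 3)%N := size_Poly _.
have sV : (size V' <= 3)%N := size_Poly _.
have sg : (size g <= 5)%N.
  have sm2 (P1 P2 : {poly K}) a : (size P1 <= 3)%N -> (size P2 <= 3)%N -> (size (a%:P * (P1 * P2))%R <= 5)%N.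
    move=> s1 s2; rewrite mul_polyC; apply: leq_trans (size_scale_leq _ _) _.
    exact: (@size_mul_le _ P1 P2 2 2).
  by rewrite /g !expr2 !size_add_leq // sm2.
have sq w : fib (u w / v w) = 2%N -> g.[w] ^+ M - 1 = 0.
  move=> E2; have [|z zE] := @disc_square _ c sm L SL X1 X2 Q p bB pQ X1 X2 (u w / v w) bB.
    by rewrite E2.
  have gz : g.[w] = (v w * z) ^+ 2.
    rewrite gE exprMn -zE disc_pn disc_comb; move: (u w) (v w) (vn0 w) => x y y0; by field.
  have gn0 : g.[w] != 0.
    apply: contra_eq_neq E2 => g0; suff -> : fib (u w / v w) = 1%N by [].
    apply: (disc_par sm SL bB pQ bB c2); rewrite zE; apply: (mulfI (expf_neq0 2 (vn0 w))).
    by rewrite mulr0 -exprMn -gz g0.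
  have vz0 : v w * z != 0 by rewrite gz expf_eq0 in gn0.
  apply/eqP; rewrite subr_eq0 gz -exprM; apply/eqP/(mulIf vz0).
  by rewrite mul1r -exprSr -qE expf_card.
case: (pickP (fun n => (fib n == 0%N) && (#|conic (pn n)| <= 1)%N)) => [ns /andP[/eqP Es ss]|none].
  have [||||k kE] := @stepanov K M 2 g (U - ns%:P * V') qE.
  - by apply: leq_trans (q17 c2).
  - exact: sg.
  - by rewrite size_add_leq // size_polyN mul_polyC (leq_trans (size_scale_leq _ _)).
  - move=> w; have [E2|[E0 sml]] := curve_fib w; first by rewrite sq // mulr0.
    rewrite hornerD hornerN hornerM hornerC UE VE.
    rewrite (small_unique sm SL SbP HS HL HE q8 bB pQ QL fQ nQ Qan Qdir Es E0 ss sml).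
    by rewrite divfK ?vn0 // subrr mul0r.
  by exists (U - ns%:P * V'), k; split=> //; right; exists ns.
have [||||k kE] := @stepanov K M 2 g 1 qE.
- by apply: leq_trans (q17 c2).
- exact: sg.
- by rewrite size_poly1.
- move=> w; have [E2|[E0 sml]] := curve_fib w; first by rewrite sq // mulr0.
  by have := none (u w / v w); rewrite E0 sml.
by exists 1, k; split=> //; left.
Qed.

(** The three coefficients are those of [cub] on the line [P + x X] with [P = t Y + W]: in the
    parabolic plane of [t] this line touches the conic. *)
Lemma curve_double t : parabolic_root t -> D1 ^+ 2 - D2 * D0 *+ 4 != 0 ->
  h (f1 X W) + t * h (f1 X Y) != 0 ->
  (h (f1 W X) + t * h (pl X Y W)) ^+ 2 = (h (f1 X W) + t * h (f1 X Y)) * (h (f W) + t * h (f1 W Y)) *+ 4.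
Proof.
move=> tE D0' A0; have [e [k [eE ek]]] := curve_stepanov.
have a0 : f1 X Y != 0 by rewrite (tan_dirY s0).
have nc w : (map_poly h U).[w] = 0 -> (map_poly h V').[w] = 0 -> False.
  rewrite !map_Poly !horner_Poly /= !rmorphN !mul0r !add0r => hU hV.
  pose l1 := f1 X Y * f1 W X - f1 X W * pl X Y W; pose l0 := f1 X Y * f W - f1 X W * f1 W Y.
  have lE : h l1 * w + h l0 = 0.
    rewrite /l1 /l0 !(rmorphB, rmorphM).
    transitivity (- h (f1 X Y) * 0 - h (f1 X W) * 0); last by rewrite !mulr0 subrr.
    by rewrite -{1}hV -hU; ring.
  have [l10|l10] := eqVneq l1 0.
    move: lE; rewrite l10 rmorph0 mul0r add0r => /eqP; rewrite fmorph_eq0 => /eqP l00.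
    apply: (@curve_nonprop s s0 gX (f1 X W) (f1 X Y)); rewrite ?a0 ?orbT //.
    - by rewrite mulrC.
    - by apply/eqP; rewrite -subr_eq0 -oppr_eq0 -[X in _ == X]l10 /l1; apply/eqP; ring.
    - by apply/eqP; rewrite -subr_eq0 -oppr_eq0 -[X in _ == X]l00 /l0; apply/eqP; ring.
  have wE : w = h (- l0 / l1).
    have hl1 : h l1 != 0 by rewrite fmorph_eq0.
    rewrite fmorph_div rmorphN; apply: (mulfI hl1); rewrite [RHS]mulrC divfK //.
    by apply/eqP; rewrite -subr_eq0 opprK lE.
  move: (- l0 / l1) wE => w0 wE; have := vn0 w0; rewrite -(fmorph_eq0 h) /curve_v.
  have E' (x y z : K) : h (- (x * w0 ^+ 2 + y * w0 + z)) = (- h x * w - h y) * w - h z.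
    by rewrite rmorphN !rmorphD !rmorphM -wE; ring.
  by rewrite E' hV eqxx.
have H := @double_root K E h (f1 W Y) (pl X Y W) (f1 X Y) (- f W) (- f1 W X) (- f1 X W) D2 D1 D0 e k t ek tE D0' nc.
have : (h (- f1 W X) - t * h (pl X Y W)) ^+ 2 = (h (- f1 X W) - t * h (f1 X Y)) * (h (- f W) - t * h (f1 W Y)) *+ 4.
  apply: H; last first.
    by rewrite rmorphN -opprD oppr_eq0.
  move=> w Hw; case: eE => [->|[n [En ->]]]; first by rewrite rmorph1 hornerC oner_eq0.
  rewrite rmorphB rmorphM /= map_polyC hornerD hornerN hornerM hornerC Hw.
  have -> : (map_poly h U).[w] - h n * (t * (map_poly h U).[w]) = (map_poly h U).[w] * (1 - h n * t) by ring.
  rewrite mulf_neq0 //.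
    by apply/eqP => U0; apply: (nc w) => //; rewrite Hw U0 mulr0.
  apply/eqP => /eqP; rewrite subr_eq0 => /eqP nt.
  have n0 : n != 0 by apply: contraTneq (oner_neq0 E) => n0; rewrite nt n0 rmorph0 mul0r eqxx.
  have hn0 : h n != 0 by rewrite fmorph_eq0.
  have tE' : t = h n^-1 by rewrite fmorphV; apply: (mulfI hn0); rewrite -nt mulfV.
  by move: tE; rewrite tE' => /parabolic_root_rat[_]; rewrite invrK En.
by rewrite !rmorphN => e0; apply/eqP; rewrite -subr_eq0 -(subrr ((- h (f1 W X) - t * h (pl X Y W)) ^+ 2)) {2}e0; apply/eqP; ring.
Qed.
End Curve.
End Parabolic.

(** At the rational root [1 / n1] the double root given by [curve_double] is rational, so the curve
    has a point in the plane [n1], supposed empty. *)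
Lemma odd_two n1 n2 : n1 != n2 -> fib n1 = 1%N -> fib n2 = 1%N ->
  (forall n r, fib n = 1%N -> r \in conic (pn n) -> False) -> False.
Proof.
move=> n12 F1 F2 emp; have [E [h _]] := fin_closure K.
have [s [s0 gX XP]] := exists_good.
set X := tan_dir s in gX XP.
pose Y := tan_pt s; pose W := tan_vec s.
have e1 := par_disc sm SL bB pQ bB F1; have e2 := par_disc sm SL bB pQ bB F2.
rewrite disc_pn -/D2 -/D1 -/D0 in e1; rewrite disc_pn -/D2 -/D1 -/D0 in e2.
have n10 : n1 != 0 by apply: contra_eq_neq F1 => ->; rewrite (fib_p).
have D00 : D0 != 0 := disc_aniso Qan bB c2.
have D1E : D1 = - D0 * (n1 + n2).
  have n12' : n1 - n2 != 0 by rewrite subr_eq0.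
  apply: (mulfI n12'); apply/eqP; rewrite -subr_eq0; apply/eqP.
  transitivity ((D2 + D1 * n1 + D0 * n1 ^+ 2) - (D2 + D1 * n2 + D0 * n2 ^+ 2)); first by ring.
  by rewrite e1 e2 subrr.
have D2E : D2 = D0 * n1 * n2.
  by apply/eqP; rewrite -subr_eq0 -[X in _ == X]e1 D1E; apply/eqP; ring.
have dn0 : D1 ^+ 2 - D2 * D0 *+ 4 != 0.
  have -> : D1 ^+ 2 - D2 * D0 *+ 4 = (D0 * (n1 - n2)) ^+ 2 by rewrite D1E D2E; ring.
  by rewrite expf_neq0 // mulf_neq0 // subr_eq0.
have rt : parabolic_root h (h n1^-1).
  rewrite /parabolic_root -/D2 -/D1 -/D0 -!(rmorphXn, rmorphM, rmorphD) /= -(rmorph0 h); congr (h _).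
  by rewrite D2E D1E; field.
have AE : f1 X W + n1^-1 * f1 X Y = n1^-1 * f1 X (pn n1).
  rewrite (tan_dirW s) (tan_dirY s0) cub1Dr cub1Zr (tan_dirp s0).
  by field.
have A0 : f1 X W + n1^-1 * f1 X Y != 0 by rewrite AE mulf_neq0 ?invr_eq0 ?XP.
have := @curve_double emp E h s s0 gX
   (h n1^-1) rt dn0; rewrite -/X -/Y -/W.
rewrite -!(rmorphM, rmorphD, rmorphXn, rmorphMn) /= fmorph_eq0 => /(_ A0) /fmorph_inj dE.
pose A := f1 X W + n1^-1 * f1 X Y; pose B := f1 W X + n1^-1 * pl X Y W; pose G := f W + n1^-1 * f1 W Y.
pose w := - B / (A *+ 2).
have A20 : A *+ 2 != 0 by rewrite -mulr_natl mulf_neq0.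
have uv : curve_v c X W w = n1^-1 * curve_u c X Y W w.
  apply/eqP; rewrite eq_sym -subr_eq0; apply/eqP.
  transitivity (A * w ^+ 2 + B * w + G); first by rewrite /curve_v /curve_u /A /B /G; ring.
  apply: (mulfI (expf_neq0 2 A20)); rewrite mulr0.
  have wE : A *+ 2 * w = - B by rewrite /w mulrC divfK.
  transitivity (A * (A *+ 2 * w) ^+ 2 + B * (A *+ 2) * (A *+ 2 * w) + A *+ 2 * A *+ 2 * G); first by ring.
  rewrite wE; transitivity (- A * (B ^+ 2 - A * G *+ 4)); first by ring.
  by rewrite /B dE -/A -/G subrr mulr0.
have vn0 := curve_vn0 s0 gX
   bigsP card_bigs w.
have [r [rC _]] := curve_hit s0 vn0.
apply: (emp n1 r F1); move: rC vn0; rewrite -/X -/Y -/W uv; move: (curve_u c X Y W w) => x.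
move=> + x0; have x0' : x != 0 by apply: contraNneq x0 => ->; rewrite mulr0.
suff -> : x / (n1^-1 * x) = n1 by [].
by field; rewrite n10.
Qed.

Lemma line_polar X Y Z : X \in L -> Y \in L -> Z \in L -> pl X Y Z = 0.
Proof.
move=> XL YL ZL; have := line_cub1 SL (memvD XL YL) ZL.
by rewrite cub1Dl (line_cub1 SL XL ZL) (line_cub1 SL YL ZL) add0r addr0.
Qed.

Lemma tan_vec_notin s : tan_vec s \notin (L + <[tan_pt s]>)%VS.
Proof.
set Y := tan_pt s; set W := tan_vec s.
have WQ := tan_vecQ s; have Yp := comb_in p s (- (f p / pl X1 X2 p / s)) bB.
apply/negP => /memv_addP[l lL [_ /vlineP[k ->] WE]].
have QE : Q = (l + k *: (Y - p) - (W - Q)) + k *: p.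
  by rewrite WE; apply/rowP => i; rewrite !mxE; ring.
have : l + k *: (Y - p) - (W - Q) \in L by rewrite memvB // memvD // memvZ.
move: (l + _ - _) QE => m QE mL.
have [k00|kn0] := eqVneq k 0; first by case/negP: QL; rewrite QE k00 scale0r addr0.
case/negP: pQ; have -> : p = (- k^-1) *: m + k^-1 *: Q.
  by rewrite QE; apply/rowP => i; rewrite !mxE; field.
by rewrite memv_add ?memvZ ?memv_line.
Qed.

(** The root [t] is irrational, so [curve_double] applies to both [s] and [-s], which give the same
    point [X] of [L]. With [L] itself, three lines through [X] touch the conic of the plane of [t],
    which must be a double line. *)
Lemma odd_none : (forall n, fib n != 1%N) -> False.
Proof.
move=> nopar; have emp n r : fib n = 1%N -> r \in conic (pn n) -> False by move=> F; move: (nopar n); rewrite F.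
have [E [h _]] := fin_closure K.
have [s [s0 gX _]] := exists_good.
have D20 : D2 != 0.
  by rewrite /D2 /disc (center_qX C) mul0r mul0rn subr0 expf_neq0.
have D2h : h D2 != 0 by rewrite fmorph_eq0.
have [t tE] : exists t, parabolic_root h t.
  have [t tE] := @solve_monicpoly E 2 (fun i => if i is 0 then - h D0 / h D2 else - h D1 / h D2) isT.
  by exists t; rewrite /parabolic_root -/D2 -/D1 -/D0 tE !big_ord_recl big_ord0 /=; field.
have irr x : t != h x.
  apply/eqP => tx; move: tE; rewrite tx => /(parabolic_root_rat)[_] F1.
  by have := nopar x^-1; rewrite F1.
have dn0 : D1 ^+ 2 - D2 * D0 *+ 4 != 0.
  apply/eqP => d0; have D22 : D2 *+ 2 != 0 by rewrite -mulr_natl mulf_neq0.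
  have rt : parabolic_root h (h (- D1 / (D2 *+ 2))).
    rewrite /parabolic_root -/D2 -/D1 -/D0 -!(rmorphXn, rmorphM, rmorphD) /= -(rmorph0 h); congr (h _).
    apply: (mulfI (expf_neq0 2 D22)); rewrite mulr0 -(mulr0 (- D2)) -d0; field.
    by rewrite D20 c2.
  have [_ F1] := parabolic_root_rat rt.
  by have := nopar (- D1 / (D2 *+ 2))^-1; rewrite F1.
pose hc i j k := h (c i j k).
have geom s' : s' != 0 -> good (tan_dir s') ->
    let X' := map_mx h (tan_dir s') in
    let P := t *: map_mx h (tan_pt s') + map_mx h (tan_vec s') in
    cub1 hc X' P != 0 /\ cub1 hc P X' ^+ 2 = cub1 hc X' P * cub hc P *+ 4.
  move=> s'0 gX'.
  have := @curve_double emp E h s' s'0 gX' t tE dn0.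
  have fY := tan_pt_on s'0; have YX := tan_ptX s'0; have YW := tan_ptW s'0.
  have a0 : f1 (tan_dir s') (tan_pt s') != 0 by rewrite (tan_dirY s'0).
  move: (tan_dir s') (tan_pt s') (tan_vec s') fY YX YW a0.
  move=> X Y W fY YX YW a0 H; cbv zeta.
  have A0 : h (f1 X W) + t * h (f1 X Y) != 0.
    have ha0 : h (f1 X Y) != 0 by rewrite fmorph_eq0.
    apply: contraNneq (irr (- f1 X W / f1 X Y)) => e0.
    rewrite fmorph_div rmorphN; apply/eqP/(mulIf ha0); rewrite divfK //.
    by apply/eqP; rewrite -subr_eq0 opprK addrC e0.
  have AE : cub1 hc (map_mx h X) (t *: map_mx h Y + map_mx h W) = h (f1 X W) + t * h (f1 X Y).
    by rewrite cub1Dr cub1Zr !cub1_map; ring.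
  have FE : cub1 hc (t *: map_mx h Y + map_mx h W) (map_mx h X) = h (f1 W X) + t * h (pl X Y W).
    by rewrite cub1Dl cub1Zl polarZl polar_map !cub1_map YX rmorph0 (polar_perm c X Y W); ring.
  have NE : cub hc (t *: map_mx h Y + map_mx h W) = h (f W) + t * h (f1 W Y).
    by rewrite cubD cubZ cub1Zl cub1Zr !cub1_map !cub_map YW fY !rmorph0; ring.
  by rewrite AE FE NE; split=> //; exact: H.
pose X := tan_dir s; pose Y := tan_pt s; pose W := tan_vec s.
have sn0 : - s != 0 by rewrite oppr_eq0.
have XnE : tan_dir (- s) = - X.
  by rewrite /X /tan_dir invrN mulrN !scaleNr opprD.
have gXn : good (tan_dir (- s)).
  rewrite XnE => z zL fz; rewrite -scaleN1r cub1Zr cub1Zl sqrrN expr1n mul1r mulN1r => /eqP.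
  by rewrite oppr_eq0 => /eqP; exact: gX.
have [A0 F2] := geom s s0 gX; have [_ F2'] := geom (- s) sn0 gXn.
have YnE : tan_pt (- s) = Y + 2%:R *: X + (- 4%:R * s) *: X1.
  by rewrite /Y /X /tan_pt /tan_dir invrN mulrN opprK; apply/rowP => i; rewrite !mxE; ring.
pose et := - (s / f p) * (f1 Y Q + f1 (tan_pt (- s)) Q).
have WnE : tan_vec (- s) = W + et *: X1.
  rewrite /W /tan_vec (tan_ptX1 s0) (tan_ptX1 sn0) /et -/Y.
  by move: (f1 Y Q) (f1 (tan_pt (- s)) Q) (f p) fp => x y z z0; apply/rowP => i; rewrite !mxE; field; rewrite !oppr_eq0 s0 z0.
(* Its nonvanishing separates the two tangent lines through [X]; it holds because [t] is
   irrational. *)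
pose ze := h et + t * h (- 4%:R * s).
have ze0 : ze != 0.
  have s40 : h (4%:R * s) != 0.
    by rewrite fmorph_eq0 mulf_neq0 // (natrM K 2 2) mulf_neq0.
  apply: contraNneq (irr (et / (4%:R * s))) => ze0; rewrite fmorph_div; apply/eqP/(mulIf s40).
  by rewrite divfK //; apply/eqP; rewrite eq_sym -subr_eq0 -mulrN -rmorphN -mulNr -/ze ze0.
pose X' := map_mx h X; pose X1' := map_mx h X1; pose P := t *: map_mx h Y + map_mx h W.
have P2E : t *: map_mx h (tan_pt (- s)) + map_mx h (tan_vec (- s)) = P + (t *+ 2) *: X' + ze *: X1'.
  have gen (x y w x1 : V) (d1 d2 : K) : t *: map_mx h (y + 2%:R *: x + d2 *: x1) + map_mx h (w + d1 *: x1) =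
      (t *: map_mx h y + map_mx h w) + (t *+ 2) *: map_mx h x + (h d1 + t * h d2) *: map_mx h x1.
    by apply/rowP => i; rewrite !mxE !(rmorphD, rmorphM, rmorph_nat); ring.
  by rewrite YnE WnE gen.
rewrite P2E XnE in F2'; rewrite -/X -/Y -/W -/X' -/P in A0 F2.
have [XL X1L] := (tan_dir_in s, lbasisL bB); have X2L := lbasisR bB.
have [||||eN eF eA] := @conic_expand _ hc X' X1' P (t *+ 2) ze.
- by rewrite cub_map (line_cub SL XL) rmorph0.
- by rewrite cub_map (line_cub SL X1L) rmorph0.
- by rewrite cub1_map (line_cub1 SL XL X1L) rmorph0.
- by rewrite cub1_map (line_cub1 SL X1L XL) rmorph0.
have mN : map_mx h (- X) = - X' by rewrite /X' map_mxN.
rewrite mN -scaleN1r cub1Zr cub1Zl sqrrN expr1n mul1r mulN1r sqrrN eN eF eA in F2'.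
set A := cub1 hc X' P in A0 F2 F2'; set F := cub1 hc P X' in F2 F2'; set N := cub hc P in F2 F2'.
set B := polar hc X' X1' P in F2'; set C0 := cub1 hc X1' P in F2'; set G := cub1 hc P X1' in F2'.
have BE : B ^+ 2 = A * C0 *+ 4.
  pose be := polar hc X1' (map_mx h X2) P; pose C2 := cub1 hc (map_mx h X2) P.
  pose a := f p / pl X1 X2 p.
  have X'E : X' = h s *: X1' + h (a / s) *: map_mx h X2.
    by rewrite /X' /X /tan_dir; apply/rowP => i; rewrite !mxE rmorphD !rmorphM.
  have at_p x : x \in L -> f1 x Y = f1 x p.
    by move=> xL; rewrite -[Y](subrK p) cub1Dr (line_cub1 SL xL (comb_in p _ _ bB)) add0r.
  have at_Q x : x \in L -> f1 x W = f1 x Q.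
    by move=> xL; rewrite -[W](subrK Q) cub1Dr (line_cub1 SL xL (tan_vecQ s)) add0r.
  have C0E : C0 = t * h (f1 X1 p) + h (f1 X1 Q).
    by rewrite /C0 /P cub1Dr cub1Zr !cub1_map at_p ?at_Q.
  have C2E : C2 = t * h (f1 X2 p) + h (f1 X2 Q).
    by rewrite /C2 /P cub1Dr cub1Zr !cub1_map at_p ?at_Q.
  have beE : be = t * h (pl X1 X2 p) + h (pl X1 X2 Q).
    rewrite /be /P polarDr polarZr !polar_map.
    rewrite -[Y](subrK p) polarDr (line_polar X1L X2L (comb_in p _ _ bB)) add0r.
    by rewrite -[W](subrK Q) polarDr (line_polar X1L X2L (tan_vecQ s)) add0r.
  have d0 : be ^+ 2 - C0 * C2 *+ 4 = 0.
    rewrite -[RHS]tE C0E C2E beE /disc !(rmorphB, rmorphD, rmorphMn, rmorphXn, rmorphM) /=.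
    by ring.
  have AE : A = h s ^+ 2 * C0 + h s * h (a / s) * be + h (a / s) ^+ 2 * C2.
    by rewrite /A X'E cub1Dl !cub1Zl polarZl polarZm /be /C0 /C2; ring.
  have BE : B = h s * C0 *+ 2 + h (a / s) * be.
    by rewrite /B X'E polarDl !polarZl polarxx (polarC hc (map_mx h X2)) /be /C0; ring.
  apply/eqP; rewrite -subr_eq0 -[X in _ == X](mulr0 (h (a / s) ^+ 2)) -d0 AE BE; apply/eqP; ring.
have := double_shift F2 BE F2'; rewrite -mulr_natl => /eqP; rewrite !mulf_eq0 (negPf ze0) /=.
have h2 : 2%:R != 0 :> E by rewrite -(rmorph_nat h) fmorph_eq0.
have h4 : 4%:R != 0 :> E by rewrite (natrM E 2 2) mulf_neq0.
rewrite (negPf h2) /= subr_eq0 => /eqP BF.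
have bXX1 := tan_dir_basis s0.
have YL : Y \notin L by exact: notin_comb.
have A2 : A *+ 2 != 0 by rewrite -mulr_natl mulf_neq0.
(* The conic is [A (x + y B/(2A) + F/(2A))^2]. *)
have NE : N = F ^+ 2 / (A *+ 4) by rewrite F2; field; rewrite A0 h4.
have CE : C0 = B ^+ 2 / (A *+ 4) by rewrite BE; field; rewrite A0 h4.
have GE : G = B * F / (A *+ 2) by rewrite BF; field; rewrite A0 h2.
apply: (@smooth_double_line _ c sm L SL X X1 Y W E h t 1 (B / (A *+ 2)) (F / (A *+ 2)) A bXX1 YL (tan_vec_notin s)).
- by rewrite oner_eq0.
- by rewrite -/hc -/P -/N NE; field; rewrite A0 h2.
- by rewrite -/hc -/P -/X' -/F; field; rewrite A0 h2.
- by rewrite -/hc -/P -/X1' -/G GE; field; rewrite A0 h2.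
- by rewrite -/hc -/P -/X' -/A expr1n mulr1.
- by rewrite -/hc -/P -/X1' -/C0 CE; field; rewrite A0 h2.
by rewrite -/hc -/P -/X' -/X1' -/B; field; rewrite A0 h2.
Qed.

Lemma odd_kill : False.
Proof.
have [npar0|[n1 [n2 [[ne F1 F2] r2]]]] := npar_odd sm SL bB pQ Qan c2.
  apply: odd_none => n; apply/negP => F1.
  by move/eqP: npar0; rewrite cards_eq0 => /eqP/setP/(_ n); rewrite !inE F1.
apply: (odd_two ne F1 F2) => n r Fn rC.
have [X [XL X0 Xn _]] := fib1P sm SL bB pQ Fn.
have [nX|nX] := eqVneq (f1 (pn n) X) 0.
  exact: (no_parabolic_lines sm SL SbP HS HL HE q8 bB pQ QL fQ nQ Qan Qdir Fn XL X0 Xn nX rC).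
apply: (no_parabolic_smooth sm SL SbP HS HL HE bB pQ QL fQ nQ Qan Qdir Fn XL X0 Xn nX).
by rewrite r2.
Qed.

End Odd.

Section Even.
Hypothesis c2 : 2%:R = 0 :> K.
Hypothesis Qbig : (2 <= #|conic Q|)%N.

(** [Q] may be replaced by any rational point of its conic, as none of them is generated. *)
Lemma shift_conic v : v \in conic Q -> [/\ ~ S v, v \notin L, p \notin (L + <[v]>)%VS,
  (forall X, X \in L -> X != 0 -> f1 X v != 0) & exists2 X, X \in L & f1 v X != 0].
Proof.
move=> vC; have [vQ fv] := conicP _ _ _ _ vC.
have van X : X \in L -> X != 0 -> f1 X v != 0 by move=> XL X0; rewrite (an_at SL vQ XL) Qan.
split=> //.
- move=> Sv; apply: nQ; apply: (an_spread SL HS HL bB Qan vC) => //.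
  by apply/conicP; rewrite subrr mem0v.
- by apply: contraNN QL => vL; rewrite -(subKr v Q) memvB.
- apply: contraNN pQ => /memv_addP[l lL [_ /vlineP[k ->] ->]].
  have -> : l + k *: v = (l + k *: (v - Q)) + k *: Q by apply/rowP => i; rewrite !mxE; ring.
  by rewrite memv_add ?memvD ?memvZ ?memv_line.
have /card_gt1P[z [z' [zC z'C zz']]] := Qbig.
have [w wC vw] : exists2 w, w \in conic Q & v != w.
  by have [vz|vz] := eqVneq v z; [exists z'; rewrite // vz|exists z].
have [wQ fw] := conicP _ _ _ _ wC.
have wvL : w - v \in L := memv_diff vQ wQ.
exists (w - v) => //; apply: contraNneq (van _ wvL _) => [h|]; last by rewrite subr_eq0 eq_sym.
by move: fw; rewrite -{1}[w](subrK v) addrC cubD fv h (line_cub SL wvL) addr0 !add0r => ->.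
Qed.

(** [Q] is replaced by the point [Q'] of its conic whose tangent plane passes through the nucleus
    direction [N] of the parabolic conic; then [no_parabolic_nucleus] applies. *)
Lemma even_empty n r : fib n = 1%N -> r \in conic (pn n) -> False.
Proof.
move=> F rC; have [X [XL X0 Xn par]] := fib1P sm SL bB pQ F.
have [nX|nX] := eqVneq (f1 (pn n) X) 0.
  exact: (no_parabolic_lines sm SL SbP HS HL HE q8 bB pQ QL fQ nQ Qan Qdir F XL X0 Xn nX rC).
have [Y bY] := lbasis_l SL XL X0.
have [N bN nN] : exists2 N, lbasis L X N & f1 (pn n) N = 0.
  exists ((- f1 (pn n) Y / f1 (pn n) X) *: X + 1 *: Y); last first.
    by rewrite [f1 (pn n) _]cub1Dr !cub1Zr divfK // mul1r addNr.
  exact: (lbasis_shear SL).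
have NL := lbasisR bN; have NQ := Qan NL (lbasis_neq0 (lbasisC bN)).
have kn0 := polar_aniso Qan bN c2.
pose z := - f1 Q N / pl X N Q.
have [x xE] := sqrt_char2 ((z * f1 Q X + z ^+ 2 * f1 X Q) / f1 N Q) c2.
pose Q' := Q + z *: X + x *: N.
have kz : f1 Q N + z * pl X N Q = 0 by rewrite /z divfK // subrr.
have fQ' : f Q' = 0.
  rewrite (conicE SL _ _ _ bN) fQ -xE.
  transitivity (x * (f1 Q N + z * pl X N Q) + 2%:R * (z * f1 Q X + z ^+ 2 * f1 X Q)).
    by field.
  by rewrite kz c2 mulr0 mul0r addr0.
have Q'Q : Q' - Q \in L := comb_in Q z x bN.
have [nQ' Q'L pQ' Q'an Q'dir] := shift_conic (introT (conicP _ _ _ _) (conj Q'Q fQ')).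
have Q'N : f1 Q' N = 0.
  by rewrite (conic2E SL _ _ _ bN) kz -mulr_natl c2 mul0r addr0.
have pnE : p + n *: Q' = pn n + (n * z) *: X + (n * x) *: N.
  by rewrite /Q'; apply/rowP => i; rewrite !mxE; ring.
have F' := F; rewrite -(fib_shift p n SL bB Q'Q) in F'.
apply: (no_parabolic_nucleus sm SL SbP HS HL HE q8 bB pQ' Q'L fQ' nQ' Q'an Q'dir c2 F' bN) => //; rewrite pnE.
- by rewrite (line_conicE SL _ _ _ bN XL).
- by rewrite (conic1E SL _ _ _ bN) Xn par // mulr0 mulr0 mul0rn !addr0.
by rewrite (conic2E SL _ _ _ bN) nN par // mulr0 -mulr_natl c2 mul0r !addr0.
Qed.

(** Every plane met by the curve is split, so the Artin-Schreier class of its form on [L] is trivial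
    for every [w]. This is the input of [trace_wronskian], whose conclusion makes [u] and [v]
    proportional. *)
Lemma even_kill : False.
Proof.
have [s [s0 gX XP]] := exists_good.
have npar1 := npar_even sm SL bB pQ Qan c2.
have [n1 F1] : exists n1, fib n1 = 1%N.
  have /card_gt0P[n1] : (0 < npar)%N by rewrite npar1.
  by rewrite inE => /eqP; exists n1.
have vn0 := curve_vn0 s0 gX
   bigsP card_bigs.
have cf w := @curve_fib even_empty s s0 gX w.
have nonprop := @curve_nonprop s s0 gX.
have XL := tan_dir_in s; have X0 := tan_dir_neq0 s0.
have XY := tan_dirY s0; have XW := tan_dirW s; have Xp := tan_dirp s0.
have bXX1 := tan_dir_basis s0.
move: (tan_dir s) (tan_pt s) (tan_vec s) XL X0 XY XW Xp bXX1 gX XP vn0 cf nonprop.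
move=> X Y W XL X0 XY XW Xp bXX1 gX XP vn0 cf nonprop.
pose b := pl X X1 Q; have b0 : b != 0 := polar_aniso Qan bXX1 c2.
(* The polar form is linear in the plane and vanishes at the parabolic plane [n1]. *)
have Bp : pl X X1 p = - n1 * b.
  have := par_disc sm SL bB pQ bXX1 F1; rewrite /disc -mulr_natl (natrM K 2 2) c2 !mul0r subr0 => /eqP.
  rewrite sqrf_eq0 polarDr polarZr -/b addr_eq0 => /eqP->; ring.
pose M : {poly K} := Poly [:: b * (f1 W Y + n1 * f W); b * (pl X Y W + n1 * f1 W X); b * (f1 X Y + n1 * f1 X W)].
pose V' : {poly K} := Poly [:: - f W; - f1 W X; - f1 X W].
have ME w : M.[w] = b * (curve_u c X Y W w - n1 * curve_v c X W w).
  by rewrite horner_Poly /curve_u /curve_v /=; ring.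
have VE w : V'.[w] = curve_v c X W w by rewrite horner_Poly /curve_v /=; ring.
have m2 : b * (f1 X Y + n1 * f1 X W) != 0.
  by rewrite mulf_neq0 //; have := XP n1 F1; rewrite cub1Dr cub1Zr Xp XY XW.
have sM : size M = 3%N by rewrite /M (@PolyK _ 0).
have sV : (size V' <= 3)%N := size_Poly _.
pose al1 := f1 X Q / b; pose al2 := f1 X p + n1 * f1 X Q.
pose ga1 := f1 X1 Q / b; pose ga2 := f1 X1 p + n1 * f1 X1 Q.
(* Adding [z^2 + z] with [z = si v / Bq] trades the quadratic term of the class for a linear one. *)
have [si siE] := sqrt_char2 (al2 * ga2) c2.
pose a' := si - al1 * ga2 - al2 * ga1.
have split w : fib (curve_u c X Y W w / curve_v c X W w) = 2%N.
  case: (cf w) => // -[E0 sml].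
  have := no_small sm SL SbP HS HL HE q8 bB pQ QL fQ nQ Qan Qdir E0.
  by rewrite npar1 => /(_ isT); rewrite ltnNge sml.
have Mn0 w : M.[w] != 0.
  rewrite ME mulf_neq0 //; apply/eqP => /eqP; rewrite subr_eq0 => /eqP uv.
  by have := split w; rewrite uv mulfK ?vn0 // F1.
have AS w : exists z, z ^+ 2 + z = - (al1 * ga1) + a' * V'.[w] / M.[w].
  have [A [A' [bA Aw _]]] := fib2P SL bB (split w).
  have [x [y AE]] := lbasisP bXX1 (lbasisL bA).
  have A0 := lbasis_neq0 bA.
  have M0 := Mn0 w; have v0 := vn0 w; rewrite ME in M0; rewrite ME VE; move: M0 v0 Aw.
  move: (curve_u c X Y W w) (curve_v c X W w) => u v M0 v0.
  have uv0 : u - n1 * v != 0 by apply: contraNneq M0 => ->; rewrite mulr0.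
  rewrite AE cub1Dl !cub1Zl polarZl polarZm !cub1Dr !cub1Zr polarDr polarZr -/b Bp => Aw.
  pose Aq := v * f1 X p + u * f1 X Q; pose Cq := v * f1 X1 p + u * f1 X1 Q; pose Bq := b * (u - n1 * v).
  have AqE : Aq = al1 * Bq + al2 * v by rewrite /Aq /al1 /al2 /Bq; field.
  have CqE : Cq = ga1 * Bq + ga2 * v by rewrite /Cq /ga1 /ga2 /Bq; field.
  have {}Aw : x ^+ 2 * Aq + x * y * Bq + y ^+ 2 * Cq = 0.
    by rewrite -[RHS](mulr0 v) -Aw /Aq /Bq /Cq; field.
  have [z zE] : exists z, z ^+ 2 + z = - (Aq * Cq / Bq ^+ 2).
    have [y0|y0] := eqVneq y 0.
      exists 0; have x0 : x != 0 by apply: contraNneq A0 => x0; rewrite AE x0 y0 !scale0r addr0.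
      have -> : Aq = 0.
        by apply: (mulfI (expf_neq0 2 x0)); rewrite mulr0 -Aw y0; ring.
      by rewrite !mul0r; ring.
    exists (x * Aq / (y * Bq)); have Bq0 : Bq != 0 by [].
    have -> : Cq = - (x ^+ 2 * Aq + x * y * Bq) / y ^+ 2.
      apply: (mulIf (expf_neq0 2 y0)); rewrite divfK ?expf_neq0 //.
      by apply/eqP; rewrite -subr_eq0 opprK -Aw; apply/eqP; ring.
    by field; rewrite y0 Bq0.
  exists (z + si * (v / Bq)); have Bq0 : Bq != 0 by [].
  have -> : (z + si * (v / Bq)) ^+ 2 + (z + si * (v / Bq)) =
     (z ^+ 2 + z) + si ^+ 2 * (v / Bq) ^+ 2 + si * (v / Bq) + 2%:R * (z * (si * (v / Bq))) by ring.
  rewrite zE -siE c2 mul0r addr0 AqE CqE -/Bq /a'; field; exact: Bq0.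
(* If [a'] were zero, the class [al1 ga1] of the plane of [Q] would be trivial and that plane
   split. *)
have a'0 : a' != 0.
  apply/eqP => a'0; have [z] := AS 0; rewrite a'0 !mul0r addr0 => zE.
  have a10 := Qan XL X0.
  pose Z := (z * b / f1 X Q) *: X + 1 *: X1.
  have Z0 : Z != 0 by apply/eqP => /(lbasis_comb bXX1)[_ /eqP]; rewrite oner_eq0.
  have ZL : Z \in L by rewrite memvD ?memvZ ?(lbasisR bXX1).
  have := Qan ZL Z0; rewrite cub1Dl !cub1Zl polarZl polarZm -/b.
  have -> : (z * b / f1 X Q) ^+ 2 * f1 X Q + z * b / f1 X Q * (1 * b) + 1 ^+ 2 * f1 X1 Q =
    b ^+ 2 / f1 X Q * (z ^+ 2 + z) + f1 X1 Q by field.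
  rewrite zE /al1 /ga1 => /eqP; apply; field.
  by rewrite a10 b0.
have := trace_wronskian c2 q8 a'0 sV sM (fun w => conj (Mn0 w) (AS w)).
pose m1 := b * (pl X Y W + n1 * f1 W X); pose v1 := - f1 W X.
have dE (x y z w : K) : (Poly [:: x; y; z])^`().[w] = y.
  have -> : (Poly [:: x; y; z])^`() = Poly [:: y; z *+ 2].
    by apply/polyP => i; rewrite coef_deriv !coef_Poly; case: i => [|[|[|i]]] //=; rewrite mul0rn.
  by rewrite horner_Poly /= -mulr_natl c2; ring.
have dM w : M^`().[w] = m1 by exact: dE.
have dV w : V'^`().[w] = v1 by exact: dE.
(* Derivatives of quadratic polynomials are constant in characteristic two, so the relation is
   linear between [M] and [V']. *)
move=> wr; have {}wr w : v1 * M.[w] + V'.[w] * m1 = 0.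
  by have /(congr1 (fun P : {poly K} => P.[w])) := wr; rewrite hornerD !hornerM dM dV horner0.
have [m10|m1n0] := eqVneq m1 0.
  have [w wE] := sqrt_char2 (- (b * (f1 W Y + n1 * f W)) / (b * (f1 X Y + n1 * f1 X W))) c2.
  have := Mn0 w; rewrite horner_Poly /= -/m1 m10 => /eqP; apply.
  transitivity (b * (f1 X Y + n1 * f1 X W) * w ^+ 2 + b * (f1 W Y + n1 * f W)); first by ring.
  by rewrite -wE mulrC divfK // addNr.
pose k := - (v1 / m1).
have Vk : V' = k%:P * M.
  apply/eqP; rewrite -subr_eq0; apply/negPn/negP => ne.
  have [|w] := exists_nonroot ne.
    apply: leq_trans q8; apply: (@leq_trans 3) => //; rewrite size_add_leq // size_polyN mul_polyC.
    by rewrite (leq_trans (size_scale_leq _ _)) // sM.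
  rewrite hornerD hornerN hornerM hornerC => /eqP; apply; apply: (mulIf m1n0).
  by rewrite mul0r -(wr w) /k; field.
have ce i : V'`_i = k * M`_i by rewrite Vk coefCM.
move: (ce 0%N) (ce 1%N) (ce 2%N); rewrite !coef_Poly /= => e0 e1 e2.
apply: (nonprop (k * b) (- (1 + k * b * n1))).
- by apply/eqP; rewrite -subr_eq0 -(subrr (- f1 X W)) {1}e2; apply/eqP; ring.
- by apply/eqP; rewrite -subr_eq0 -(subrr (- f1 W X)) {1}e1; apply/eqP; ring.
- by apply/eqP; rewrite -subr_eq0 -(subrr (- f W)) {1}e0; apply/eqP; ring.
have [->|//] := eqVneq (k * b) 0.
by rewrite mul0r addr0 oppr_eq0 oner_eq0.
Qed.

End Even.
End Kill.

(** * Covering the surface *)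

Section Covering.
Variables (K : finFieldType) (c : 'I_4 -> 'I_4 -> 'I_4 -> K).
Notation V := 'rV[K]_4.
Hypothesis sm : csmooth c.
Notation f := (cub c).
Notation f1 := (cub1 c).
Notation pl := (polar c).
Variable L : {vspace V}.
Hypothesis SL : surface_line c L.
Variables (S : V -> Prop) (Sb : pred V).
Hypothesis SbP : forall v, reflect (S v) (Sb v).
Hypothesis HS : sigma_closed c S.
Hypothesis HL : forall Z, Z \in L -> Z != 0 -> S Z.
Hypothesis HE : forall X r, eckardt c L X r -> S r.
Hypothesis q8 : (8 <= #|K|)%N.
Implicit Types X Y Z r v : V.
Hypothesis hq : (#|K| == 8%N) || (16 <= #|K|)%N.

Let q17 : 2%:R != 0 :> K -> (17 <= #|K|)%N.
Proof. by case/card_odd => M; move: hq; move: #|K| => x; clear; lia. Qed.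

Let SP v : ~ ~ S v -> S v.
Proof. by move=> h; case: (SbP v). Qed.

(** At least (q - 1)/2 planes are split and at most two are triangles, so there is a smooth split
    plane from which to draw the tangent curves. *)
Lemma cover_nonsplit Q w : Q \notin L -> f Q = 0 -> (forall X, X \in L -> X != 0 -> f1 X Q != 0) ->
  w - Q \in L -> f w = 0 -> w != Q -> S Q.
Proof.
move=> QL fQ Qan wQ fw wne; apply: SP => nQ.
have QC : Q \in conic c L Q by apply/conicP; rewrite subrr mem0v.
have wC : w \in conic c L Q by apply/conicP.
have Qbig : (2 <= #|conic c L Q|)%N by apply/card_gt1P; exists w, Q.
have Qdir : exists2 X, X \in L & f1 Q X != 0.
  exists (w - Q) => //; have := Qan _ wQ; rewrite subr_eq0 => /(_ wne); apply: contraNneq => h.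
  by move: fw; rewrite -{1}[w](subrK Q) addrC cubD fQ h (line_cub SL wQ) addr0 !add0r => ->.
have [e eL] := off_plane SL Q; have [B0 [B1 bB]] := lbasis_ex SL.
have [cf _] := card_fibres sm SL bB eL Qan; have np := npar_le2 sm SL bB eL Qan.
have [ct _] := card_triangles sm SL SbP HS HL HE q8 bB eL QL fQ nQ Qan Qdir.
have [n E nt] : exists2 n, fib c B0 B1 Q e n = 2%N & ~~ triangle c L B0 B1 Q e n.
  have : ~~ ([set n | fib c B0 B1 Q e n == 2%N] \subset [set n | triangle c L B0 B1 Q e n]).
    apply/negP => /subset_leq_card h; move: cf np ct h q8.
    by move: #|_| #|_| #|_| #|K| => x y z t; clear; lia.
  by case/subsetPn => n; rewrite !inE => /eqP; exists n.
have [X1 [X2 [p [C pp]]]] := fib2_center sm SL bB eL E.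
have fp : f p != 0.
  apply: contraNneq nt => fp; rewrite /triangle E eqxx /=; apply/existsP; exists p.
  by rewrite !(center_dir0 C) ?(lbasisL bB) ?(lbasisR bB) // eqxx !andbT; apply/conicP.
have pQ : p \notin (L + <[Q]>)%VS.
  apply: contraNN (planes_off n eL) => h; rewrite -(subKr p (e + n *: Q)) memvB //.
  exact: (subvP (addvSl _ _)).
have [c2|c2] := eqVneq (2%:R : K) 0.
  exact: (even_kill sm SL SbP HS HL HE q8 q17 C fp pQ QL fQ nQ Qan Qdir c2 Qbig).
exact: (odd_kill sm SL SbP HS HL HE q8 q17 C fp pQ QL fQ nQ Qan Qdir c2).
Qed.

(** An ungenerated point is singular on its conic: in a nonsplit plane, or as the vertex of a
    triangle. *)
Lemma uncovered_dir Q : Q \notin L -> f Q = 0 -> ~ S Q ->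
  (forall X, X \in L -> f1 Q X = 0) /\
  ((forall X, X \in L -> X != 0 -> f1 X Q != 0) \/ exists X Y, center c L X Y Q).
Proof.
move=> QL fQ nQ.
case: (pickP (fun X => [&& X \in L, X != 0 & f1 X Q == 0])) => [X /and3P[XL X0 /eqP XQ]|Qan]; last first.
  have {}Qan X : X \in L -> X != 0 -> f1 X Q != 0.
    by move=> XL X0; have := Qan X; rewrite XL X0 /= => ->.
  split; last by left.
  move=> X XL; have [->|X0] := eqVneq X 0; first by rewrite -(scale0r 0) cub1Zr mul0r.
  apply/eqP/negPn/negP => QX; have XQ := Qan X XL X0.
  apply: nQ; apply: (@cover_nonsplit Q (Q + (- f1 Q X / f1 X Q) *: X)) => //.
  - by rewrite addrC addKr memvZ.
  - by rewrite !cubE fQ (line_cub SL XL); field.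
  rewrite -subr_eq0 addrC addKr scaler_eq0 negb_or X0 andbT.
  by rewrite mulf_neq0 ?invr_eq0 ?oppr_eq0.
have [Y b] := lbasis_l SL XL X0; have YL := lbasisR b.
have [Y' b' [Y'Q|par]] : exists2 Y', lbasis L X Y' & f1 Y' Q = 0 \/ forall Z, Z \in L -> pl X Z Q = 0.
  have [k0|k0] := eqVneq (pl X Y Q) 0.
    exists Y => //; right=> Z /(lbasisP b)[x [y ->]].
    by rewrite polarDm !polarZm polarxx XQ k0; ring.
  exists ((- f1 Y Q / pl X Y Q) *: X + 1 *: Y); last first.
    by left; rewrite cub1Dl !cub1Zl polarZl polarZm XQ; field.
  exact: (lbasis_shear SL).
- have dir Z : Z \in L -> f1 Q Z = 0.
    move=> ZL; apply/eqP/negPn/negP => QZ; apply: nQ.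
    exact: (cover_split HS HL b' fQ XQ Y'Q ZL QZ).
  by split=> //; right; exists X, Y'; split; rewrite ?dir ?(lbasisR b').
case: nQ; have [QX|QX] := eqVneq (f1 Q X) 0; last exact: (cover_tangent HS HL XL).
by apply: (HE (X := X)); split; split.
Qed.

(** Two singular points of a conic make it singular also where their line meets [L], and this is the
    situation of [eckardt]. *)
Lemma uncovered_unique p v w : p \notin L -> v - p \in L -> w - p \in L ->
  f v = 0 -> f w = 0 -> ~ S v -> ~ S w -> v = w.
Proof.
move=> pL vp wp fv fw nv nw; apply/eqP/negPn/negP => vw.
have vL : v \notin L by apply: contraNN pL => vL; rewrite -(subKr v p) memvB.
have wL : w \notin L by apply: contraNN pL => wL; rewrite -(subKr w p) memvB.
have [dv _] := uncovered_dir vL fv nv; have [dw _] := uncovered_dir wL fw nw.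
have lL : w - v \in L := memv_diff vp wp.
move: lL vw; move lE : (w - v) => l lL; have wE : w = v + l by rewrite -lE addrC subrK.
move=> vw; have l0 : l != 0 by rewrite -lE subr_eq0 eq_sym.
have lv : f1 l v = 0 by move: fw; rewrite wE cubD fv (dv _ lL) (line_cub SL lL) !add0r addr0.
have par Z : Z \in L -> pl l Z v = 0.
  move=> ZL; have := dw Z ZL; rewrite wE cub1Dl (dv _ ZL) (line_cub1 SL lL ZL) add0r addr0.
  by rewrite (polar_perm c l Z v).
by apply: nv; apply: (HE (X := l)); split; split=> //; exact: dv.
Qed.

Lemma two_splits Q e B0 B1 : Q \notin L -> e \notin (L + <[Q]>)%VS -> lbasis L B0 B1 ->
  (forall X, X \in L -> X != 0 -> f1 X Q != 0) \/ (exists X Y, center c L X Y Q) ->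
  exists n1 n2, [/\ n1 != n2, fib c B0 B1 Q e n1 = 2%N & fib c B0 B1 Q e n2 = 2%N].
Proof.
move=> QL eL bB [Qan|[X [Y C]]].
  have [cf _] := card_fibres sm SL bB eL Qan; have np := npar_le2 sm SL bB eL Qan.
  have /card_gt1P[n1 [n2 [+ + ne]]] : (1 < #|[set n | fib c B0 B1 Q e n == 2%N]|)%N.
    by move: cf np q8; move: #|_| #|_| #|_| => x y z; clear; lia.
  by rewrite !inE => /eqP E1 /eqP E2; exists n1, n2.
have b := center_basis C; have [XQ YQ] := (center_qX C, center_qY C).
have kn0 := center_polar sm SL C.
have plane (r : K) : r != 0 -> r ^+ 2 != f1 X e / f1 Y e -> exists n (r' : K),
    [/\ r * r' = f1 X e / f1 Y e, fib c B0 B1 Q e n = 2%N & lbasis L (X + r *: Y) (X + r' *: Y)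
      /\ f1 (X + r *: Y) (e + n *: Q) = 0 /\ f1 (X + r' *: Y) (e + n *: Q) = 0].
  move=> r0 rn; have [r' [p' [r'0 rr' rrE b' C']]] := involution_plane sm SL b QL eL XQ YQ r0 rn.
  have [x [y [m [k pE]]]] := lbasis_spans b QL eL p'.
  have rQ : f1 (X + r *: Y) Q = r * pl X Y Q.
    by rewrite cub1Dl cub1Zl polarZm XQ YQ; ring.
  have pk Z : Z \in L -> f1 Z p' = m * f1 Z Q + k * f1 Z e.
    move=> ZL; rewrite pE !cub1Dr !cub1Zr (line_cub1 SL ZL (lbasisL b)) (line_cub1 SL ZL (lbasisR b)); ring.
  have [ZL Z'L] := (lbasisL b', lbasisR b').
  have k0 : k != 0.
    apply/eqP => k0; have m0 : m = 0.
      have /eqP := pk _ ZL; rewrite (center_qX C') k0 mul0r addr0 rQ eq_sym !mulf_eq0 (negPf r0) (negPf kn0) !orbF.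
      by move/eqP.
    case/negP: (center_notin C'); rewrite pE k0 m0 !scale0r !addr0 memvD ?memvZ ?(lbasisL b) ?(lbasisR b) //.
  have van Z : Z \in L -> f1 Z p' = 0 -> f1 Z (e + (m / k) *: Q) = 0.
    move=> ZL' Zp; apply: (mulfI k0); rewrite mulr0 -Zp pk // cub1Dr cub1Zr; by field.
  exists (m / k), r'; split=> //; last by rewrite !van ?(center_qX C') ?(center_qY C').
  by apply: (fib_split sm SL bB eL b'); rewrite van ?(center_qX C') ?(center_qY C').
have Ye : f1 Y e != 0 by exact: (smooth_at_line sm SL (lbasisR b) (lbasis_neq0 (lbasisC b)) QL eL YQ).
pose P : {poly K} := 'X^2 - (f1 X e / f1 Y e)%:P.
have P0 : P != 0 by rewrite -size_poly_eq0 size_XnsubC.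
have [r1 [r10 r1n]] := @exists_sqr_neq K (f1 X e / f1 Y e) (leq_trans (isT : 4 <= 8)%N q8).
have [n1 [r1' [rr1 E1 [b1 [h1 h1']]]]] := plane r1 r10 r1n.
pose F (i : K) : {poly K} := P * (('X - r1%:P) * ('X - r1'%:P)).
have [||r2 [r20 r2P]] := @exists_common_nonroot K [set 0] F 4.
- move=> n _; split; first by rewrite !mulf_neq0 ?polyXsubC_eq0.
  have := @size_mul_le _ P (('X - r1%:P) * ('X - r1'%:P)) 2 2.
  rewrite size_XnsubC //; apply=> //.
  by apply: (@size_mul_le _ ('X - r1%:P) ('X - r1'%:P) 1 1); rewrite size_XsubC.
- by rewrite cards1; move: q8; move: #|K| => x; clear; lia.
have := r2P 0; rewrite inE eqxx => /(_ isT); rewrite !hornerM !hornerXsubC hornerD hornerN hornerXn hornerC.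
rewrite !mulf_eq0 !negb_or !subr_eq0 => /and3P[r2n r21 r21'].
have [n2 [r2' [rr2 E2 [b2 [h2 _]]]]] := plane r2 r20 r2n.
exists n1, n2; split=> //; apply/eqP => n12; rewrite -n12 in h2.
have [x [y e2]] : exists x y, X + r2 *: Y = x *: (X + r1 *: Y) + y *: (X + r1' *: Y).
  exact: (lbasisP b1 (lbasisL b2)).
have kk := smooth_quadratic sm SL b1 (plane_notin eL n1) h1 h1'.
move: h2; rewrite e2 cub1Dl !cub1Zl polarZl polarZm h1 h1' !mulr0 addr0 add0r => /eqP.
have /(lbasis_comb b)[/eqP xy /eqP xy'] : (1 - x - y) *: X + (r2 - x * r1 - y * r1') *: Y = 0.
  have <- : X + r2 *: Y - (x *: (X + r1 *: Y) + y *: (X + r1' *: Y)) = (1 - x - y) *: X + (r2 - x * r1 - y * r1') *: Y.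
    by apply/rowP => i; rewrite !mxE; ring.
  by rewrite -e2 subrr.
rewrite !mulf_eq0 (negPf kk) orbF => /orP[/eqP x0|/eqP y0].
  move: xy xy'; rewrite x0 subr0 mul0r subr0 !subr_eq0 => /eqP<- /eqP r2E.
  by rewrite r2E mul1r eqxx in r21'.
move: xy xy'; rewrite y0 !subr0 mul0r subr0 !subr_eq0 => /eqP<- /eqP r2E.
by rewrite r2E mul1r eqxx in r21.
Qed.

(** The tangent plane at [Q] contains [L], so all points of the other planes enter the reflection.
    These planes have at most q ungenerated points in all, while two split ones have at least
    [2 (q - 1)] generated points. *)
Lemma cover_all Q : Q != 0 -> f Q = 0 -> S Q.
Proof.
move=> Q0 fQ; have [QL|QL] := boolP (Q \in L); first exact: HL.
apply: SP => nQ; have [dQ Qcase] := uncovered_dir QL fQ nQ.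
have [e eL] := off_plane SL Q; have [B0 [B1 bB]] := lbasis_ex SL.
have QQ : f1 Q Q = 0 by rewrite cub1xx fQ mul0rn.
have Qe : f1 Q e != 0.
  apply/eqP => Qe; have [E [h _]] := fin_closure K.
  have := @smooth_coords _ _ sm B0 B1 Q e E h 0 0 1 0 (lbasis_spans bB QL eL).
  rewrite oner_eq0 !orbT /= !scale0r !add0r !addr0 scale1r !cub1_map cub_map.
  by rewrite (dQ _ (lbasisL bB)) (dQ _ (lbasisR bB)) Qe QQ fQ rmorph0; apply.
have Qv n v : v - (e + n *: Q) \in L -> f1 Q v = f1 Q e.
  by move=> vn; rewrite -[v](subrK (e + n *: Q)) cub1Dr dQ // add0r cub1Dr cub1Zr QQ mulr0 addr0.
have out1 n : (#|out_pts c L Sb Q e n| <= 1)%N.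
  apply/card_le1_eqP => v w; rewrite !inE => /and4P[vn /eqP fv _ /SbP nv] /and4P[wn /eqP fw _ /SbP nw].
  by apply: esym; exact: (uncovered_unique (plane_notin eL n) vn wn).
have in1 n : fib c B0 B1 Q e n = 2%N -> (#|K| <= #|in_pts c L Sb Q e n| + 1)%N.
  move=> E; have [X [Y [p [C pn]]]] := fib2_center sm SL bB eL E; have b := center_basis C.
  have k0 := center_polar sm SL C.
  rewrite card_units leq_add2r; apply: (@card_image_le _ _ _ _ (fun s => p + s *: X + (- (f p / pl X Y p) / s) *: Y)).
    by move=> s t _ _ /(comb_inj b)[].
  move=> s; rewrite !inE => s0.
  have fs : f (p + s *: X + (- (f p / pl X Y p) / s) *: Y) = 0.
    by rewrite (center_cub SL _ _ C); field; rewrite s0.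
  have sn : p + s *: X + (- (f p / pl X Y p) / s) *: Y - (e + n *: Q) \in L.
    by rewrite -(subrKA p) memvD // (comb_in _ _ _ b).
  rewrite sn fs eqxx (Qv n) // Qe /=; apply/SbP.
  by apply: (cover_center sm SL HS HL C) => //; rewrite s0.
have [n1 [n2 [n12 E1 E2]]] := two_splits QL eL bB Qcase.
have := reflection_count SbP HS QL eL fQ nQ.
have : (\sum_n #|out_pts c L Sb Q e n| <= #|K|)%N.
  by rewrite -[X in (_ <= X)%N]sum1_card; apply: leq_sum => n _; exact: out1.
have : (#|in_pts c L Sb Q e n1| + #|in_pts c L Sb Q e n2| <= \sum_n #|in_pts c L Sb Q e n|)%N.
  by rewrite (bigD1 n1) //= (bigD1 n2) /= 1?eq_sym // addnA leq_addr.
move: (in1 n1 E1) (in1 n2 E2) q8; move: #|K| #|in_pts _ _ _ _ _ n1| #|in_pts _ _ _ _ _ n2|.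
by move: (\sum_n _)%N (\sum_n _)%N => x y z t u; clear; lia.
Qed.

End Covering.

(** * Surfaces all of whose planes through the line are parabolic *)

Section Inseparable.
Variables (K : finFieldType) (c : 'I_4 -> 'I_4 -> 'I_4 -> K).
Notation V := 'rV[K]_4.
Hypothesis sm : csmooth c.
Notation f := (cub c).
Notation f1 := (cub1 c).
Notation pl := (polar c).
Variable L : {vspace V}.
Hypothesis SL : surface_line c L.
Implicit Types X Y Z r v : V.
Hypothesis q8 : (8 <= #|K|)%N.
Hypothesis noc : forall X Y p, ~ center c L X Y p.

Lemma insep_split X Y p : lbasis L X Y -> p \notin L -> f1 X p = 0 -> f1 Y p != 0.
Proof.
move=> b pL Xp; apply/eqP => Yp; have [x [y C]] := center_ex sm SL b pL Xp Yp; exact: noc C.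
Qed.

Lemma insep_root X Y p : lbasis L X Y -> p \notin L -> f1 X p = 0 -> pl X Y p = 0.
Proof.
move=> b pL Xp; apply/eqP/negPn/negP => k0.
have b' : lbasis L X ((- f1 Y p / pl X Y p) *: X + 1 *: Y).
  exact: (lbasis_shear SL).
have := insep_split b' pL Xp; rewrite cub1Dl !cub1Zl polarZl polarZm Xp => /eqP; apply.
by field.
Qed.

(** The map sending a point of [L] to its tangent plane has degree two; when no fibre has two
    rational points it turns out to be purely inseparable. *)
Lemma insep : 2%:R = 0 :> K /\ forall X Y p, X \in L -> Y \in L -> pl X Y p = 0.
Proof.
have [B0 [B1 b]] := lbasis_ex SL; have [B0L B1L] := (lbasisL b, lbasisR b).
have [p pL0] := off_plane SL 0; have [q qL] := off_plane SL p.
have pL : p \notin L by apply: contraNN pL0; apply: (subvP (addvSl _ _)).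
have plane B : B \in L -> B != 0 -> exists2 z, z \notin L & f1 B z = 0.
  move=> BL Bn0; have [Bp|Bp] := eqVneq (f1 B p) 0; first by exists p.
  exists (q + (- f1 B q / f1 B p) *: p); last by rewrite cub1Dr cub1Zr divfK // subrr.
  apply: contraNN qL => h; rewrite -[q](addrK ((- f1 B q / f1 B p) *: p)) memvB //.
    exact: (subvP (addvSl _ _)).
  by apply: (subvP (addvSr _ _)); rewrite memvZ ?memv_line.
have [z0 z0L h0] := plane B0 B0L (lbasis_neq0 b).
have [z1 z1L h1] := plane B1 B1L (lbasis_neq0 (lbasisC b)).
have al0 := insep_split b z0L h0; have be0 := insep_split (lbasisC b) z1L h1.
have p0 := insep_root b z0L h0; have p1 := insep_root (lbasisC b) z1L h1; rewrite polarC in p1.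
have c2 : 2%:R = 0 :> K.
  (* In the plane of [v] the form on [L] is [y^2 - x^2], which splits in odd characteristic. *)
  apply/eqP/negPn/negP => c2; pose v := (f1 B1 z0)^-1 *: z0 + (- (f1 B0 z1)^-1) *: z1.
  have v0 : f1 B0 v = -1 by rewrite cub1Dr !cub1Zr h0; field; rewrite ?al0 ?be0.
  have v1 : f1 B1 v = 1 by rewrite cub1Dr !cub1Zr h1; field; rewrite ?al0 ?be0.
  have pv : pl B0 B1 v = 0 by rewrite polarDr !polarZr p0 p1 !mulr0 addr0.
  have vL : v \notin L.
    by apply: contra_eqN v0 => vL; rewrite (line_cub1 SL B0L vL) eq_sym oppr_eq0 oner_eq0.
  have b' : lbasis L (1 *: B0 + 1 *: B1) (1 *: B0 + (-1) *: B1).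
    by apply: (lbasis_change SL b); rewrite !mul1r -opprD oppr_eq0; exact: c2.
  have := insep_split b' vL; rewrite !cub1Dl !cub1Zl !polarZl !polarZm pv v0 v1.
  have -> : 1 ^+ 2 * -1 + 1 * (1 * 0) + 1 ^+ 2 * 1 = 0 :> K by ring.
  by move=> /(_ erefl) /eqP; apply; ring.
split=> // X Y v XL YL.
have z0z1 : z0 \notin (L + <[z1]>)%VS.
  apply: contraNN al0 => /memv_addP[l lL [_ /vlineP[k ->] ->]].
  by rewrite cub1Dr cub1Zr h1 (line_cub1 SL B1L lL) mulr0 addr0.
have base : pl B0 B1 v = 0.
  have [x [y [m [n ->]]]] := lbasis_spans b z1L z0z1 v.
  by rewrite !polarDr !polarZr p0 p1 polarxyx polarxyy !(lineE SL b); ring.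
have [x [y ->]] := lbasisP b XL; have [x' [y' ->]] := lbasisP b YL.
rewrite !polarDl !polarZl !polarDm !polarZm !polarxx [pl B1 B0 v]polarC base -[_ *+ 2]mulr_natl -[f1 B1 v *+ 2]mulr_natl c2; ring.
Qed.

Let c2 := proj1 insep.
Let line_pl := proj2 insep.

Lemma dbl0 (x : K) : x *+ 2 = 0.
Proof. by rewrite -mulr_natl c2 mul0r. Qed.

Lemma smooth_point v : v != 0 -> f v = 0 -> exists w, f1 v w != 0.
Proof.
move=> v0 fv; have [E [h _]] := fin_closure K.
have [||i] := sm (h := h) (x := map_mx h v); first by rewrite map_mx_eq0.
  by rewrite cub_map fv rmorph0.
by rewrite -(map_delta_mx h) cub1_map fmorph_eq0; exists (delta_mx 0 i).
Qed.

Lemma insep_dir X p l : X \in L -> l \in L -> f1 (p + l) X = f1 p X.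
Proof.
move=> XL lL; rewrite cub1Dl (line_cub1 SL lL XL) addr0.
by rewrite -(polar_perm c p l X) (polar_perm c l X p) line_pl ?addr0.
Qed.

(** The zero on [L] of the plane [p + n r] is [x X + y B] with [x^2 = n al], [y^2 = be], so the
    square of the derivative toward it is a quintic [R] in [n]. If [R] were zero the surface would
    have a rational singular point. *)
Lemma smooth_pencil X B p r : lbasis L X B -> r \notin L -> p \notin (L + <[r]>)%VS ->
  f1 X r = 0 -> f1 B p = 0 -> exists R : {poly K}, [/\ R != 0, (size R <= 6)%N &
    forall n, R.[n] != 0 -> exists Z, [/\ Z \in L, Z != 0, f1 Z (p + n *: r) = 0 & f1 (p + n *: r) Z != 0]].
Proof.
move=> b rL pr Xr Bp; have [XL BL] := (lbasisL b, lbasisR b).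
have pL : p \notin L by exact: notin_sum pr.
have al0 := insep_split b rL Xr; have be0 := insep_split (lbasisC b) pL Bp.
set al := f1 B r in al0; set be := f1 X p in be0.
pose R : {poly K} := Poly [:: be * f1 p B ^+ 2; al * f1 p X ^+ 2; be * pl p r B ^+ 2;
  al * pl p r X ^+ 2; be * f1 r B ^+ 2; al * f1 r X ^+ 2].
exists R; split; last 1 first.
- move=> n Rn; have [x xE] := sqrt_char2 (n * al) c2; have [y yE] := sqrt_char2 be c2.
  have y0 : y != 0 by apply: contraNneq be0 => y0; rewrite yE y0 expr0n.
  exists (x *: X + y *: B); split.
  - by rewrite memvD ?memvZ.
  - by apply/eqP => /(lbasis_comb b)[_ /eqP]; rewrite (negPf y0).
  - rewrite cub1Dl !cub1Zl polarZl polarZm line_pl // !cub1Dr !cub1Zr Xr Bp -xE -yE -/al -/be.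
    by transitivity (n * al * be *+ 2); [ring|exact: dbl0].
  apply: contraNneq Rn; rewrite cub1Dr !cub1Zr !cub1Dl !cub1Zl !polarZm => e0.
  rewrite horner_Poly /=; apply/eqP.
  transitivity (y ^+ 2 * (f1 p B + n * pl p r B + n ^+ 2 * f1 r B) ^+ 2 + x ^+ 2 * (f1 p X + n * pl p r X + n ^+ 2 * f1 r X) ^+ 2
    - be * (n * f1 p B * pl p r B + n ^+ 2 * f1 p B * f1 r B + n ^+ 3 * pl p r B * f1 r B) *+ 2
    - n * al * (n * f1 p X * pl p r X + n ^+ 2 * f1 p X * f1 r X + n ^+ 3 * pl p r X * f1 r X) *+ 2).
    by rewrite -xE -yE; ring.
  rewrite !dbl0 !subr0.
  transitivity ((x * (f1 p X + n * pl p r X + n ^+ 2 * f1 r X) + y * (f1 p B + n * pl p r B + n ^+ 2 * f1 r B)) ^+ 2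
    - (x * (f1 p X + n * pl p r X + n ^+ 2 * f1 r X) * (y * (f1 p B + n * pl p r B + n ^+ 2 * f1 r B))) *+ 2); first by ring.
  by rewrite e0 dbl0 expr0n subr0.
- apply/eqP => R0; have cf i : R`_i = 0 by rewrite R0 coef0.
  move: (cf 0%N) (cf 1%N) (cf 2%N) (cf 3%N) (cf 4%N) (cf 5%N); rewrite !coef_Poly /=.
  have nz (x y : K) : x != 0 -> x * y ^+ 2 = 0 -> y = 0.
    by move=> x0 /eqP; rewrite mulf_eq0 (negPf x0) sqrf_eq0 => /eqP.
  move=> /(nz _ _ be0) pB /(nz _ _ al0) pX /(nz _ _ be0) prB /(nz _ _ al0) prX /(nz _ _ be0) rB /(nz _ _ al0) rX.
  (* The derivatives toward [X] and [B] vanish already; [x] and [y] are chosen to cancel those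
     toward [p] and [r]. *)
  have [x xE] := sqrt_char2 (- f1 p p / be) c2; have [y yE] := sqrt_char2 (- f1 p r / al) c2.
  pose v := p + x *: X + y *: B.
  have vX : f1 v X = 0 by rewrite (conic1E SL _ _ _ b) pX line_pl // dbl0; ring.
  have vB : f1 v B = 0 by rewrite (conic2E SL _ _ _ b) pB line_pl // dbl0; ring.
  have vr : f1 v r = 0.
    rewrite /v !cub1Dl !cub1Zl polarDl !polarZl !polarZm.
    rewrite (polar_perm c p r X) prX (polar_perm c p r B) prB line_pl // Xr -yE.
    by rewrite -/al; field.
  have vp : f1 v p = 0.
    rewrite /v !cub1Dl !cub1Zl polarDl !polarZl !polarZm !polarxyx line_pl // Bp -xE !dbl0.
    by rewrite -/be; field.
  have all0 w : f1 v w = 0.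
    have [x' [y' [m [n ->]]]] := lbasis_spans b rL pr w.
    by rewrite !cub1Dr !cub1Zr vX vB vr vp !mulr0 !addr0.
  have fv : f v = 0 by have := cub1xx c v; rewrite all0 mulrS dbl0 addr0.
  have v0 : v != 0 by apply: notin_neq0 (notin_comb _ _ b pL).
  by have [w] := smooth_point v0 fv; rewrite all0 eqxx.
exact: size_Poly.
Qed.

End Inseparable.

Section InseparableCover.
Variables (K : finFieldType) (c : 'I_4 -> 'I_4 -> 'I_4 -> K).
Notation V := 'rV[K]_4.
Hypothesis sm : csmooth c.
Notation f := (cub c).
Notation f1 := (cub1 c).
Notation pl := (polar c).
Variable L : {vspace V}.
Hypothesis SL : surface_line c L.
Implicit Types X Y Z r v : V.
Hypothesis q8 : (8 <= #|K|)%N.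
Hypothesis noc : forall X Y p, ~ center c L X Y p.
Let c2 := proj1 (insep sm SL noc).
Let line_pl := proj2 (insep sm SL noc).
Let dbl0 := dbl0 sm SL noc.
Let insep_dir := insep_dir sm SL noc.

(** The derivative toward [X] would vanish everywhere; the three other conditions are quadratic
    equations that can be solved one after another over the algebraic closure, giving a singular
    point. *)
Lemma tangent_direction X B p r : lbasis L X B -> r \notin L -> p \notin (L + <[r]>)%VS ->
  f1 X r = 0 -> f1 B p = 0 -> f1 r X = 0 -> f1 p X = 0 -> pl p r X = 0 -> False.
Proof.
move=> b rL pr Xr Bp rX pX prX; have [XL BL] := (lbasisL b, lbasisR b).
have pL : p \notin L by exact: notin_sum pr.
have al0 := insep_split sm SL noc b rL Xr; have be0 := insep_split sm SL noc (lbasisC b) pL Bp.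
have [E [h _]] := fin_closure K.
pose hc i j k := h (c i j k).
have dblE (x : E) : x *+ 2 = 0 by rewrite -mulr_natl -(rmorph_nat h) c2 rmorph0 mul0r.
have [m [n [mn0 mnE]]] := closed_binary_quadratic (h (f1 p B)) (h (pl p r B)) (h (f1 r B)).
have ha : h (f1 B r) != 0 by rewrite fmorph_eq0.
have hb : h (f1 X p) != 0 by rewrite fmorph_eq0.
pose X' := map_mx h X; pose B' := map_mx h B; pose p' := map_mx h p; pose r' := map_mx h r.
have [y yE] : exists y, h (f1 B r) * y ^+ 2 + m * h (pl p r B) * y + cub1 hc (n *: r' + m *: p') r' = 0.
  have [y yE] := @solve_monicpoly E 2 (fun i => if i is 0 then - cub1 hc (n *: r' + m *: p') r' / h (f1 B r)
    else - (m * h (pl p r B)) / h (f1 B r)) isT.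
  by exists y; rewrite yE !big_ord_recl big_ord0 /=; field.
have [x xE] : exists x, h (f1 X p) * x ^+ 2 + (n * y * h (pl p r B) + cub1 hc (n *: r' + m *: p') p') = 0.
  have [x xE] := @solve_monicpoly E 2 (fun i => if i is 0 then
    - (n * y * h (pl p r B) + cub1 hc (n *: r' + m *: p') p') / h (f1 X p) else 0) isT.
  by exists x; rewrite xE !big_ord_recl big_ord0 /=; field.
pose w := n *: r' + m *: p'; pose v := x *: X' + y *: B' + n *: r' + m *: p'.
have vE : v = x *: X' + y *: B' + w by rewrite /v /w addrA.
have XX : cub1 hc X' X' = 0 by rewrite cub1_map (line_cub1 SL XL XL) rmorph0.
have XB : cub1 hc X' B' = 0 by rewrite cub1_map (line_cub1 SL XL BL) rmorph0.
have BX : cub1 hc B' X' = 0 by rewrite cub1_map (line_cub1 SL BL XL) rmorph0.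
have BB : cub1 hc B' B' = 0 by rewrite cub1_map (line_cub1 SL BL BL) rmorph0.
have XBz (z : V) : polar hc X' B' (map_mx h z) = 0 by rewrite polar_map line_pl // rmorph0.
have XBw : polar hc X' B' w = 0 by rewrite /w polarDr !polarZr !XBz !mulr0 addr0.
have lin z' : cub1 hc v z' = x ^+ 2 * cub1 hc X' z' + x * y * polar hc X' B' z' + y ^+ 2 * cub1 hc B' z'
    + x * polar hc X' w z' + y * polar hc B' w z' + cub1 hc w z'.
  by rewrite vE !cub1Dl !cub1Zl polarDl !polarZl !polarZm; ring.
have vX : cub1 hc v X' = 0.
  rewrite lin XX BX !polarxyx !dblE (polar_perm hc X' B' w) XBw.
  rewrite /w cub1Dl !cub1Zl polarZl polarZm !cub1_map polar_map (polar_perm c p r X) rX pX prX rmorph0; ring.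
have vB : cub1 hc v B' = 0.
  rewrite lin XB BB !polarxyy !polarxyx !dblE (polar_perm hc X' B' w) XBw.
  rewrite /w cub1Dl !cub1Zl polarZl polarZm !cub1_map polar_map (polar_perm c p r B).
  by rewrite -[RHS]mnE; ring.
have vr : cub1 hc v r' = 0.
  rewrite lin XBz !cub1_map Xr /w polarDm polarDm !polarZm !polarxyy !dblE !polar_map.
  rewrite -/w (polar_perm c p r X) prX (polar_perm c p r B) rmorph0 -[RHS]yE -/w; ring.
have vp : cub1 hc v p' = 0.
  rewrite lin XBz !cub1_map Bp /w polarDm polarDm !polarZm !polarxyy !dblE !polar_map.
  rewrite -/w (polar_perm c p r X) prX (polar_perm c p r B) rmorph0 -[RHS]xE -/w; ring.
have := @smooth_coords _ _ sm X B r p E h x y n m (lbasis_spans b rL pr).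
rewrite -/hc -/X' -/B' -/r' -/p'; have -> : [|| x != 0, y != 0, n != 0 | m != 0].
  by move: mn0; rewrite orbC => ->; rewrite !orbT.
move=> /(_ isT) /=; rewrite -/v; apply=> //.
have := cub1xx hc v; rewrite {2}/v !cub1Dr !cub1Zr vX vB vr vp !mulr0 !addr0.
by rewrite mulrS dblE addr0 => <-.
Qed.

Lemma insep_rootP p : p \notin L -> exists X, [/\ X \in L, X != 0 & f1 X p = 0].
Proof.
move=> pL; have [B0 [B1 b]] := lbasis_ex SL.
have [x xE] := sqrt_char2 (f1 B1 p) c2; have [y yE] := sqrt_char2 (f1 B0 p) c2.
exists (x *: B0 + y *: B1); split.
- by rewrite memvD ?memvZ ?(lbasisL b) ?(lbasisR b).
- apply/eqP => /(lbasis_comb b)[x0 y0]; rewrite x0 expr0n in xE; rewrite y0 expr0n in yE.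
  by have := insep_split sm SL noc b pL yE; rewrite xE eqxx.
rewrite cub1Dl !cub1Zl polarZl polarZm line_pl ?(lbasisL b) ?(lbasisR b) // -xE -yE !mulr0 addr0.
by rewrite mulrC -mulr2n dbl0.
Qed.

Section Closed.
Variable S : V -> Prop.
Hypothesis HS : sigma_closed c S.

(** [X] generates the conic off [L]. A secant through two of its points aligned with [Z] gives [Z];
    if [Z] is in the direction of the nucleus, a tangent does. *)
Lemma insep_line X z Z : X \in L -> X != 0 -> z \notin L -> f1 X z = 0 -> f1 z X != 0 -> S X ->
  Z \in L -> Z != 0 -> S Z.
Proof.
move=> XL X0 zL Xz zX SX ZL Z0; have [ZX|ZX] := boolP (Z \in <[X]>%VS).
  have /vlineP[k kE] := ZX; rewrite kE; apply: (cl_scale HS) => //.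
  by apply: contraNneq Z0 => k0; rewrite kE k0 scale0r.
have b := lbasis_free SL XL ZL X0 ZX; have ga0 := insep_split sm SL noc b zL Xz.
pose r y := z + (- (f z + y * f1 z Z + y ^+ 2 * f1 Z z) / f1 z X) *: X + y *: Z.
have Sr y : S (r y).
  apply: (gen_tangent HS XL SX).
  - by rewrite (conicE SL _ _ _ b) Xz line_pl //; field.
  - by rewrite (line_conicE SL _ _ _ b).
  by rewrite (conic1E SL _ _ _ b) Xz line_pl // dbl0 !mulr0 !addr0.
have rZ y : f1 (r y) Z = f1 z Z by rewrite (conic2E SL _ _ _ b) line_pl // dbl0 !mulr0 !addr0.
have [zZ|zZ] := eqVneq (f1 z Z) 0.
  apply: (cl_tangent HS (Sr 0)); rewrite ?(line_cub SL ZL) ?rZ //.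
  by rewrite (line_conicE SL _ _ _ b).
pose y := - f1 z Z / f1 Z z.
have y0 : y != 0 by rewrite mulf_neq0 ?invr_eq0 ?oppr_eq0.
apply: (gen_dir SL HS ZL y0 (Sr 0)); last by rewrite rZ.
suff -> : r 0 + y *: Z = r y by [].
rewrite /r scale0r addr0; congr (_ + _ *: _ + _); congr (- _ / _); rewrite /y; by field.
Qed.

Hypothesis HL : forall Z, Z \in L -> Z != 0 -> S Z.

(** Tangents at [L] miss only the conics singular on [L]; for these [eckardt_cover] applies, with
    smooth planes supplied by [smooth_pencil]. *)
Lemma insep_cover r : r != 0 -> f r = 0 -> S r.
Proof.
move=> r0 fr; have [rL|rL] := boolP (r \in L); first exact: HL.
have [X [XL X0 Xr]] := insep_rootP rL.
have [rX|rX] := eqVneq (f1 r X) 0; last exact: (cover_tangent HS HL XL).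
have ek : eckardt c L X r by split; split=> // Y YL; exact: line_pl.
have [p pr] := off_plane SL r; have pL : p \notin L by exact: notin_sum pr.
have [B [BL B0 Bp]] := insep_rootP pL.
have Xp := smooth_at_line sm SL XL X0 rL pr Xr.
have free_root z Z : Z \in L -> Z != 0 -> f1 Z z = 0 -> f1 X z != 0 -> lbasis L X Z.
  move=> ZL Z0 Zz Xz; apply: (lbasis_free SL XL ZL X0); apply: contraNN Xz => /vlineP[k kE].
  have k0 : k != 0 by apply: contraNneq Z0 => k0; rewrite kE k0 scale0r.
  by move: Zz; rewrite kE cub1Zl => /eqP; rewrite mulf_eq0 sqrf_eq0 (negPf k0).
have b := free_root p B BL B0 Bp Xp.
have [R [R0 sR RP]] := smooth_pencil sm SL noc b rL pr Xr Bp.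
pose D : {poly K} := Poly [:: f1 p X; pl p r X].
have D0 : D != 0.
  apply/eqP => D0; have cf i : D`_i = 0 by rewrite D0 coef0.
  move: (cf 0%N) (cf 1%N); rewrite !coef_Poly /= => pX prX.
  exact: (tangent_direction b rL pr Xr Bp rX pX prX).
have [||n] := @exists_nonroot K (R * D).
- by rewrite mulf_neq0.
- by apply: leq_trans q8; apply: leq_trans (@size_mul_le _ R D 5 1 sR (size_Poly _)) _.
rewrite hornerM mulf_eq0 negb_or => /andP[Rn Dn].
have [Z [ZL Z0 Zz zZ]] := RP n Rn; move zE : (p + n *: r) => z in Zz zZ.
pose Y := z + (- f z / f1 z Z) *: Z.
have lL : (- f z / f1 z Z) *: Z \in L by rewrite memvZ.
have ZY : f1 Z Y = 0 by rewrite cub1Dr (line_cub1 SL ZL lL) Zz addr0.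
have SY : S Y.
  apply: (cover_tangent HS HL ZL Z0) => //; last by rewrite insep_dir.
  by rewrite /Y !cubE Zz (line_cub SL ZL); field.
have XY : f1 X Y != 0.
  by rewrite cub1Dr (line_cub1 SL XL lL) addr0 -zE cub1Dr cub1Zr Xr mulr0 addr0.
have YX : f1 Y X != 0.
  rewrite insep_dir // -zE !cub1Dl !cub1Zl polarZm rX.
  by apply: contraNneq Dn => e0; rewrite horner_Poly /=; apply/eqP; rewrite -[RHS]e0; ring.
apply: (eckardt_cover sm SL HS HL ek SY YX XY) => a.
have Yr : Y \notin (L + <[r]>)%VS.
  apply: contraNN pr => YLr.
  have -> : p = Y - (- f z / f1 z Z) *: Z - n *: r by rewrite /Y -zE; apply/rowP => i; rewrite !mxE; ring.
  apply: memvB; last by apply: (subvP (addvSr _ _)); rewrite memvZ ?memv_line.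
  by apply: memvB => //; exact: (subvP (addvSl _ _)).
have [R' [R'0 sR' R'P]] := smooth_pencil sm SL noc (free_root Y Z ZL Z0 ZY XY) rL Yr Xr ZY.
(* The quintic and the two values [0] and [a] to be avoided make degree 7, which q = 8 just
   allows. *)
have [||m] := @exists_nonroot K (R' * ('X * ('X - a%:P))).
- by rewrite !mulf_neq0 ?polyX_eq0 ?polyXsubC_eq0.
- apply: leq_trans q8; apply: (@size_mul_le _ R' ('X * ('X - a%:P)) 5 2) => //.
  by apply: (@size_mul_le _ 'X ('X - a%:P) 1 1); rewrite ?size_polyX ?size_XsubC.
rewrite !hornerM hornerX hornerXsubC !mulf_eq0 !negb_or subr_eq0 => /and3P[Rm m0 ma].
exists m => //; split=> // w wY fw _; have [W [WL W0 Ww wW]] := R'P m Rm.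
apply: (cover_tangent HS HL WL W0) => //; last first.
  by rewrite -(subrK (Y + m *: r) w) addrC insep_dir.
by rewrite -(subrK (Y + m *: r) w) cub1Dr (line_cub1 SL WL wY) Ww addr0.
Qed.
End Closed.

Lemma insep_generator : exists P, P != 0 /\ f P = 0 /\
  forall S, sigma_closed c S -> S P -> forall r, r != 0 -> f r = 0 -> S r.
Proof.
have [p pL0] := off_plane SL 0.
have rL : p \notin L by apply: contraNN pL0; apply: (subvP (addvSl _ _)).
have [q qr] := off_plane SL p; have qL : q \notin L by exact: notin_sum qr.
have [X [XL X0 Xr]] := insep_rootP rL; have [B [BL B0 Bq]] := insep_rootP qL.
have Xq := smooth_at_line sm SL XL X0 rL qr Xr.
have b : lbasis L X B.
  apply: (lbasis_free SL XL BL X0); apply: contraNN Xq => /vlineP[k kE].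
  have k0 : k != 0 by apply: contraNneq B0 => k0; rewrite kE k0 scale0r.
  by move: Bq; rewrite kE cub1Zl => /eqP; rewrite mulf_eq0 sqrf_eq0 (negPf k0).
have [R [R0 sR RP]] := smooth_pencil sm SL noc b rL qr Xr Bq.
have [n Rn] := exists_nonroot R0 (leq_trans sR (leq_trans (isT : 6 <= 8)%N q8)).
have [Z [ZL Z0 Zz zZ]] := RP n Rn; have zL := plane_notin qr n.
exists Z; split=> //; split; first exact: (line_cub SL ZL).
move=> S HS SZ; apply: (insep_cover HS) => W WL W0.
exact: (insep_line HS ZL Z0 zL Zz zZ SZ WL W0).
Qed.
End InseparableCover.

(** * Conclusion *)

Lemma surface_generator (K : finFieldType) (c : 'I_4 -> 'I_4 -> 'I_4 -> K) (L : {vspace 'rV[K]_4}) :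
  csmooth c -> surface_line c L -> (#|K| == 8%N) || (16 <= #|K|)%N ->
  exists P, P != 0 /\ cub c P = 0 /\
    forall S, sigma_closed c S -> S P -> forall r, r != 0 -> cub c r = 0 -> S r.
Proof.
move=> sm SL hq; have q8 : (8 <= #|K|)%N by move: hq; move: #|K| => x; clear; lia.
have [[X [Y [p C]]]|noc] := classic (exists X Y p, center c L X Y p); last first.
  by apply: (insep_generator sm SL q8) => X Y p C; apply: noc; exists X, Y, p.
have b := center_basis C; exists X; split; first exact: lbasis_neq0 b.
split=> [|S HS SX r]; first exact: (line_cub SL (lbasisL b)).
have HL Z : Z \in L -> Z != 0 -> S Z.
  by apply: (gen_line_split sm HS _ SL C SX); apply: leq_trans q8.
(* Membership in [S] is decided classically, so that generated points can be counted. *)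
pose Sb v : bool := excluded_middle_informative (S v).
have SbP v : reflect (S v) (Sb v) by rewrite /Sb; case: excluded_middle_informative => h; constructor.
apply: (cover_all sm SL SbP HS HL _ q8 hq) => Z v.
exact: (eckardt_cover_split sm SL HS HL q8 C).
Qed.

Theorem theorem1p2 (K : finFieldType) (q : nat) (card_K : #|K| = q)
    (hq : q = 8%N \/ (16 <= q)%N)
    (F : {mpoly K[4]}) (F_cubic : F \is 3.-homog) (F_smooth : smooth F)
    (F_line : exists L : subspace K, is_line L /\ line_in_surface F L) :
  exists P : subspace K, rational_point F P /\
    forall X : subspace K, Span F (fun Y => Y = P) X <-> rational_point F X.
Proof.
have [c FE] := cubic_tens F_cubic; rewrite {}FE {F F_cubic} in F_smooth F_line *.
have [L [dL FL]] := F_line; have sm := smooth_tens F_smooth.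
have SL := SurfaceLine dL (line_in_surface_vanish FL).
have [|p [p0 [fp gen]]] := surface_generator sm SL.
  by case: hq; rewrite -card_K => ->; rewrite ?orbT.
exists <[p]>%VS; split; first exact: rational_point_vline.
exact: span_of_sigma.
Qed.
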